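(* Let $\mathbb{C}$ be a proto-Waldhausen category. Then there is a homotopy equivalence of spaces $|T_\bullet\mathbb{C}|\simeq |S^{\square}_\bullet\mathbb{C}|$.
   Context: A double category $\mathbb{C}$ (an internal category in $\mathrm{Cat}$) has objects, horizontal morphisms $A\rightarrowtail B$ forming a category $\mathcal{H}_{\mathbb{C}}$, vertical morphisms $A\twoheadrightarrow B$ forming a category $\mathcal{V}_{\mathbb{C}}$, and squares (2-cells whose boundary consists of two horizontal and two vertical morphisms) with associative and unital horizontal and vertical compositions. It is flat if a square is uniquely determined by its boundary; we then say a boundary ''is a square''. A squares category is a flat double category with a distinguished object $O$ which is initial in $\mathcal{H}_{\mathbb{C}}$ and terminal in $\mathcal{V}_{\mathbb{C}}$. For flat double categories $\mathbb{A},\mathbb{B}$ and double functors $F,G:\mathbb{A}\to\mathbb{B}$, a vertical natural transformation $\tau:F\Rightarrow G$ consists of vertical morphisms $\tau_A:F(A)\twoheadrightarrow G(A)$ such that for every horizontal $f:A\rightarrowtail A'$ the boundary with top $Ff$, left $\tau_A$, right $\tau_{A'}$, bottom $Gf$ is a square, and for every vertical $u:A\twoheadrightarrow A'$ we have $\tau_{A'}\circ Fu=Gu\circ\tau_A$ in $\mathcal{V}_{\mathbb{B}}$. $\mathrm{Fun}^v(\mathbb{A},\mathbb{B})$ is the category of double functors and vertical natural transformations. Let $\boxdot$ be the flat double category generated by one square (objects $a,b,c,d$, horizontal $a\rightarrowtail b$, $c\rightarrowtail d$, vertical $a\twoheadrightarrow c$, $b\twoheadrightarrow d$, and a square), and let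 $\mathrm{span}\subset\boxdot$ be the sub-double category on $a\rightarrowtail b$, $a\twoheadrightarrow c$, with inclusion $i$. A squares category $\mathbb{C}$ is proto-Waldhausen if (i) the restriction functor $i^*:\mathrm{Fun}^v(\boxdot,\mathbb{C})\to\mathrm{Fun}^v(\mathrm{span},\mathbb{C})$ admits a section functor $s$ (i.e. $i^*s=\mathrm{id}$), and (ii) there is a natural transformation $w:si^*\Rightarrow\mathrm{id}$ of endofunctors of $\mathrm{Fun}^v(\boxdot,\mathbb{C})$ whose component at every square has identity components at the three corners $a,b,c$. $T_n\mathbb{C}$ is the category whose objects are sequences $C_0\rightarrowtail C_1\rightarrowtail\cdots\rightarrowtail C_n$ of horizontal morphisms and whose morphisms are families of vertical morphisms $C_i\twoheadrightarrow C_i'$ such that each boundary $(C_i\rightarrowtail C_{i+1}, C_i\twoheadrightarrow C_i', C_{i+1}\twoheadrightarrow C_{i+1}', C_i'\rightarrowtail C_{i+1}')$ is a square; $T_\bullet\mathbb{C}$ is the simplicial category with nerve-like faces and degeneracies (composing, or inserting identities). $S^{\square}_n\mathbb{C}$ is the category whose objects are families $(A_{jk})_{0\le j\le k\le n}$ of objects with $A_{jj}=O$, horizontal morphisms $A_{jk}\rightarrowtail A_{j,k+1}$ and vertical morphisms $A_{jk}\twoheadrightarrow A_{j+1,k}$ ($j<k$), such that for all $j<k<n$ the boundary with corners $A_{jk},A_{j,k+1},A_{j+1,k},A_{j+1,k+1}$ is a square; morphisms are families of vertical morphisms $\varphi_{jk}:A_{jk}\twoheadrightarrow A'_{jk}$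 forming a vertical natural transformation (each boundary formed with a horizontal generator is a square, each square formed with a vertical generator commutes in $\mathcal{V}_{\mathbb{C}}$). For $\theta:[m]\to[n]$ in $\Delta$, $\theta^*$ sends $(A_{jk})$ to $(A_{\theta(j)\theta(k)})$ with the composite (or identity) morphisms; this makes $S^{\square}_\bullet\mathbb{C}$ a simplicial category ($d_i$ deletes the $i$th row and column, $s_i$ inserts identities). For a simplicial category $X$, $|X|$ denotes the realization of the bisimplicial set $([n],[m])\mapsto N_mX_n$. *)

(* Defs.v *)
From HB Require Import structures.
From mathcomp Require Import all_boot all_order all_algebra.
From mathcomp Require Import all_classical all_reals all_analysis.
From Stdlib Require Import Rdefinitions.
From mathcomp Require Import Rstruct Rstruct_topology.

Set Implicit Arguments.
Unset Strict Implicit.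
Unset Printing Implicit Defensive.

Import Order.TTheory GRing.Theory Num.Theory.
Local Open Scope classical_set_scope.
Local Open Scope quotient_scope.

(* Morphisms are given as "total" types with source/target maps (a category  *)
(* as (Ob, Mor, dom, cod, id, comp)); composition is a total function whose  *)
(* value is only constrained on composable pairs.  A flat double category is *)
(* a pair of categories on the same objects together with a predicate        *)
(* [dsq f u v g] on boundaries (top f, left u, right v, bottom g) saying     *)
(* "the boundary is a square"; it contains the identity squares and is       *)
(* closed under horizontal and vertical pasting.                             *)
(* Convention: [hcomp g f] is "first f, then g"; same for [vcomp].           *)

Record flatDC := FlatDC {
  dob : Type;
  hmor : Type;
  hs : hmor -> dob;
  ht : hmor -> dob;
  hid : dob -> hmor;
  hcomp : hmor -> hmor -> hmor;
  vmor : Type;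
  vs : vmor -> dob;
  vt : vmor -> dob;
  vid : dob -> vmor;
  vcomp : vmor -> vmor -> vmor;
  dsq : hmor -> vmor -> vmor -> hmor -> Prop;
  hs_id : forall A, hs (hid A) = A;
  ht_id : forall A, ht (hid A) = A;
  hs_comp : forall f g, ht f = hs g -> hs (hcomp g f) = hs f;
  ht_comp : forall f g, ht f = hs g -> ht (hcomp g f) = ht g;
  hcomp_idr : forall f, hcomp f (hid (hs f)) = f;
  hcomp_idl : forall f, hcomp (hid (ht f)) f = f;
  hcompA : forall f g h, ht f = hs g -> ht g = hs h ->
    hcomp h (hcomp g f) = hcomp (hcomp h g) f;
  vs_id : forall A, vs (vid A) = A;
  vt_id : forall A, vt (vid A) = A;
  vs_comp : forall u w, vt u = vs w -> vs (vcomp w u) = vs u;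
  vt_comp : forall u w, vt u = vs w -> vt (vcomp w u) = vt w;
  vcomp_idr : forall u, vcomp u (vid (vs u)) = u;
  vcomp_idl : forall u, vcomp (vid (vt u)) u = u;
  vcompA : forall u w x, vt u = vs w -> vt w = vs x ->
    vcomp x (vcomp w u) = vcomp (vcomp x w) u;
  dsq_bd : forall f u v g, dsq f u v g ->
    vs u = hs f /\ vs v = ht f /\ vt u = hs g /\ vt v = ht g;
  dsq_hid : forall u, dsq (hid (vs u)) u u (hid (vt u));
  dsq_vid : forall f, dsq f (vid (hs f)) (vid (ht f)) f;
  dsq_hcomp : forall f u v g f' w g',
    dsq f u v g -> dsq f' v w g' -> dsq (hcomp f' f) u w (hcomp g' g);
  dsq_vcomp : forall f u v g u' v' k,
    dsq f u v g -> dsq g u' v' k -> dsq f (vcomp u' u) (vcomp v' v) k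
}.

Record squaresCat := SquaresCat {
  sqc_dc :> flatDC;
  sqc_O : dob sqc_dc;
  sqc_init : forall A, exists! f : hmor sqc_dc, hs f = sqc_O /\ ht f = A;
  sqc_term : forall A, exists! u : vmor sqc_dc, vs u = A /\ vt u = sqc_O
}.

(* A double functor span -> C is a pair (f : a >-> b, u : a ->> c) with a    *)
(* common source; a double functor boxdot -> C is a square (f,u,v,g) of C.   *)
(* Vertical natural transformations are given by their components, subject  *)
(* to the conditions of the definition (for the non-identity generators; the *)
(* conditions for identities hold automatically).                          *)

Section Funv.
Variable C : flatDC.

Record spanC := SpanC {
  sp_f : hmor C;           (* a >-> b *)
  sp_u : vmor C;           (* a ->> c *)
  sp_ok : hs sp_f = vs sp_u
}.

Record sqC := SqC {
  q_f : hmor C;            (* a >-> b  (top)    *)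
  q_u : vmor C;            (* a ->> c  (left)   *)
  q_v : vmor C;            (* b ->> d  (right)  *)
  q_g : hmor C;            (* c >-> d  (bottom) *)
  q_ok : dsq q_f q_u q_v q_g
}.

Definition isSpanMor (X Y : spanC) (ta tb tc : vmor C) : Prop :=
  [/\ vs ta = hs (sp_f X) /\ vt ta = hs (sp_f Y),
      vs tb = ht (sp_f X) /\ vt tb = ht (sp_f Y),
      vs tc = vt (sp_u X) /\ vt tc = vt (sp_u Y),
      dsq (sp_f X) ta tb (sp_f Y)
    & vcomp tc (sp_u X) = vcomp (sp_u Y) ta].

Definition isSqMor (Q Q' : sqC) (ma mb mc md : vmor C) : Prop :=
  [/\ [/\ vs ma = hs (q_f Q) /\ vt ma = hs (q_f Q'),
          vs mb = ht (q_f Q) /\ vt mb = ht (q_f Q'),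
          vs mc = hs (q_g Q) /\ vt mc = hs (q_g Q')
        & vs md = ht (q_g Q) /\ vt md = ht (q_g Q')],
      dsq (q_f Q) ma mb (q_f Q'),
      dsq (q_g Q) mc md (q_g Q'),
      vcomp mc (q_u Q) = vcomp (q_u Q') ma
    & vcomp md (q_v Q) = vcomp (q_v Q') mb].

Lemma sqC_span_ok (Q : sqC) : hs (q_f Q) = vs (q_u Q).
Proof. by case: (dsq_bd (q_ok Q)) => ->. Qed.

Definition iObj (Q : sqC) : spanC := SpanC (sqC_span_ok Q).

End Funv.

(* C is proto-Waldhausen: a section s of i^* (given by completing every span *)
(* X = (f, u) to a square (f, u, s_v X, s_g X), and every morphism of spans  *)
(* (ta, tb, tc) to a morphism of squares (ta, tb, tc, s_mor _)), which is a  *)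
(* functor, and a natural transformation w : s i^* => id whose components    *)
(* have identity components at a, b, c (so w is given by its d-components). *)
Record protoWaldhausen (C : squaresCat) := ProtoWaldhausen {
  s_g : spanC C -> hmor C;
  s_v : spanC C -> vmor C;
  s_sq : forall X, dsq (sp_f X) (sp_u X) (s_v X) (s_g X);
  s_mor : forall (X Y : spanC C) (ta tb tc : vmor C),
    isSpanMor X Y ta tb tc -> vmor C;
  s_mor_ok : forall X Y ta tb tc (H : isSpanMor X Y ta tb tc),
    isSqMor (SqC (s_sq X)) (SqC (s_sq Y)) ta tb tc (s_mor H);
  s_mor_id : forall X
      (H : isSpanMor X X (vid (hs (sp_f X))) (vid (ht (sp_f X)))
                         (vid (vt (sp_u X)))),
    s_mor H = vid (ht (s_g X));
  s_mor_comp : forall X Y Z ta tb tc ta' tb' tc'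
      (H : isSpanMor X Y ta tb tc) (H' : isSpanMor Y Z ta' tb' tc')
      (H'' : isSpanMor X Z (vcomp ta' ta) (vcomp tb' tb) (vcomp tc' tc)),
    s_mor H'' = vcomp (s_mor H') (s_mor H);
  w_d : sqC C -> vmor C;
  w_ok : forall Q : sqC C,
    isSqMor (SqC (s_sq (iObj Q))) Q
      (vid (hs (q_f Q))) (vid (ht (q_f Q))) (vid (vt (q_u Q))) (w_d Q);
  w_nat : forall (Q Q' : sqC C) ma mb mc md,
    isSqMor Q Q' ma mb mc md ->
    forall H : isSpanMor (iObj Q) (iObj Q') ma mb mc,
    vcomp md (w_d Q) = vcomp (w_d Q') (s_mor H)
}.

(* A (pre)category is given by raw object/morphism types together with       *)
(* validity predicates (the actual objects/morphisms are the valid raw       *)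
(* data).  Raw data for sequences are nat-indexed functions, normalized      *)
(* (canonical values outside the relevant index range), so that distinct     *)
(* valid raw data represent distinct objects/morphisms.                      *)

Record precat := Precat {
  pc_ob : Type;
  pc_isob : pc_ob -> Prop;
  pc_mor : Type;
  pc_ismor : pc_mor -> Prop;
  pc_dom : pc_mor -> pc_ob;
  pc_cod : pc_mor -> pc_ob;
  pc_id : pc_ob -> pc_mor;
  pc_comp : pc_mor -> pc_mor -> pc_mor   (* pc_comp g f = g o f *)
}.

(* monotone maps [m] -> [n] of Delta, represented by nat -> nat (only the    *)
(* values on 0..m matter) *)
Definition monotone_map (m n : nat) (theta : nat -> nat) : Prop :=
  (forall i j, (i <= j)%N -> (j <= m)%N -> (theta i <= theta j)%N) /\
  (forall i, (i <= m)%N -> (theta i <= n)%N).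

(* A simplicial category: levels X_n and, for theta : [m] -> [n], the        *)
(* functor theta^* : X_n -> X_m (on objects and morphisms). *)
Record simpCat := SimpCat {
  sc_lvl : nat -> precat;
  sc_actO : forall (n m : nat) (theta : nat -> nat),
    pc_ob (sc_lvl n) -> pc_ob (sc_lvl m);
  sc_actM : forall (n m : nat) (theta : nat -> nat),
    pc_mor (sc_lvl n) -> pc_mor (sc_lvl m)
}.

Section Nerve.
Variable K : precat.

Fixpoint cpath (x : nat -> pc_ob K) (g : nat -> pc_mor K) (p k : nat)
  : pc_mor K :=
  match k with
  | 0 => @pc_id K (x p)
  | k'.+1 => @pc_comp K (g (p + k')%N) (cpath x g p k')
  end.

Definition isNerve (k : nat) (c : (nat -> pc_ob K) * (nat -> pc_mor K)) : Prop :=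
  [/\ forall i, (i <= k)%N -> @pc_isob K (c.1 i),
      forall i, (i < k)%N ->
        [/\ @pc_ismor K (c.2 i), @pc_dom K (c.2 i) = c.1 i
          & @pc_cod K (c.2 i) = c.1 i.+1],
      forall i, (k < i)%N -> c.1 i = c.1 k
    & forall i, (k <= i)%N -> c.2 i = @pc_id K (c.1 k)].

Definition nerve_act (k' : nat) (psi : nat -> nat)
  (c : (nat -> pc_ob K) * (nat -> pc_mor K)) :
  (nat -> pc_ob K) * (nat -> pc_mor K) :=
  (fun i => c.1 (psi (minn i k')),
   fun i => if (i < k')%N then cpath c.1 c.2 (psi i) (psi i.+1 - psi i)
            else @pc_id K (c.1 (psi k'))).

End Nerve.

Section Realization.
Variable X : simpCat.

Definition BEl (n k : nat) : Type :=
  {c : (nat -> pc_ob (sc_lvl X n)) * (nat -> pc_mor (sc_lvl X n)) | isNerve k c}.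

Definition chain_map (n n' : nat) (theta : nat -> nat)
  (c : (nat -> pc_ob (sc_lvl X n)) * (nat -> pc_mor (sc_lvl X n))) :
  (nat -> pc_ob (sc_lvl X n')) * (nat -> pc_mor (sc_lvl X n')) :=
  (fun i => @sc_actO X n n' theta (c.1 i), fun i => @sc_actM X n n' theta (c.2 i)).

Section Simplex.
Local Open Scope ring_scope.
Definition simplex_set (n : nat) : set 'rV[R]_(n.+1) :=
  [set s : 'rV[R]_(n.+1) | (forall i : 'I_n.+1, 0 <= s ord0 i) /\ \sum_(i < n.+1) s ord0 i = 1].
Definition simplex (n : nat) : topologicalType := set_type (@simplex_set n).

Definition simplex_push (m n : nat) (theta : nat -> nat) (s : 'rV[R]_(m.+1))
  : 'rV[R]_(n.+1) :=
  \row_(i < n.+1) \sum_(j < m.+1 | theta j == i) s ord0 j.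
End Simplex.

Definition Fib (p : nat * nat) : topologicalType :=
  (discrete_topology {classic BEl p.1 p.2} * simplex p.1 * simplex p.2)%type.

Definition RSig : topologicalType := {p : nat * nat & Fib p}.

Definition real_gen (a b : RSig) : Prop :=
  exists (n k n' k' : nat) (theta psi : nat -> nat)
         (y : BEl n k) (y' : BEl n' k')
         (s : simplex n) (s' : simplex n') (t : simplex k) (t' : simplex k'),
    [/\ monotone_map n' n theta /\ monotone_map k' k psi,
        sval y' = @chain_map n n' theta (@nerve_act (sc_lvl X n) k' psi (sval y)),
        val s = @simplex_push n' n theta (val s') /\
        val t = @simplex_push k' k psi (val t'),
        a = existT Fib (n', k') (y', s', t')
      & b = existT Fib (n, k) (y, s, t)].

End Realization.

Definition eqclos (T : Type) (r : T -> T -> Prop) (a b : T) : Prop :=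
  forall E : T -> T -> Prop, (forall x, E x x) -> (forall x y, E x y -> E y x) ->
  (forall x y z, E x y -> E y z -> E x z) -> (forall x y, r x y -> E x y) -> E a b.

Section Quot.
Variables (T : topologicalType) (r : T -> T -> Prop).
Definition eqclosb (a b : T) : bool := `[< eqclos r a b >].
Lemma eqclosb_refl : reflexive eqclosb.
Proof. by move=> x; rewrite /eqclosb; apply/asboolP => E h _ _ _. Qed.
Lemma eqclosb_sym : symmetric eqclosb.
Proof.
move=> x y; rewrite /eqclosb.
by apply: asbool_equiv_eq; split => h E h1 h2 h3 h4; apply: (h2); exact: (h E h1 h2 h3 h4).
Qed.
Lemma eqclosb_trans : transitive eqclosb.
Proof.
rewrite /eqclosb => y x z /asboolP h1 /asboolP h2; apply/asboolP => E e1 e2 e3 e4.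
by apply: (e3 _ y); [exact: (h1 E e1 e2 e3 e4)|exact: (h2 E e1 e2 e3 e4)].
Qed.
Definition eqclos_rel := EquivRel eqclosb eqclosb_refl eqclosb_sym eqclosb_trans.
Definition quot_space := {eq_quot eqclos_rel}.
HB.instance Definition _ := Topological.copy quot_space (quotient_topology quot_space).
End Quot.

(* |X| : realization of the bisimplicial set ([n],[k]) |-> N_k X_n, i.e.     *)
(* (coprod_{n,k} N_k X_n x Delta^n x Delta^k) / ~                            *)
Definition realization (X : simpCat) : topologicalType :=
  @quot_space (RSig X) (@real_gen X).

Section Homotopy.
Local Open Scope ring_scope.
Definition unit_interval : topologicalType :=
  set_type [set x : R | 0 <= x <= 1].

Definition homotopic (A B : topologicalType) (f g : A -> B) : Prop :=
  exists H : (A * unit_interval)%type -> B,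
    continuous H /\
    (forall a (t : unit_interval), val t = 0 -> H (a, t) = f a) /\
    (forall a (t : unit_interval), val t = 1 -> H (a, t) = g a).

Definition homotopy_equivalent (A B : topologicalType) : Prop :=
  exists (f : A -> B) (g : B -> A),
    [/\ continuous f, continuous g, homotopic (g \o f) idfun
      & homotopic (f \o g) idfun].
End Homotopy.

(* Junk (out-of-range) entries are normalized to O / identities of O.        *)

Section TS.
Variable C : squaresCat.
Local Notation O := (sqc_O C).

Fixpoint hpath (A : nat -> dob C) (h : nat -> hmor C) (p k : nat) : hmor C :=
  match k with
  | 0 => hid (A p)
  | k'.+1 => hcomp (h (p + k')%N) (hpath A h p k')
  end.

Fixpoint vpath (A : nat -> dob C) (u : nat -> vmor C) (p k : nat) : vmor C :=
  match k with
  | 0 => vid (A p)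
  | k'.+1 => vcomp (u (p + k')%N) (vpath A u p k')
  end.

Definition TOb : Type := ((nat -> dob C) * (nat -> hmor C))%type.

Definition isTOb (n : nat) (D : TOb) : Prop :=
  [/\ forall i, (i < n)%N -> hs (D.2 i) = D.1 i /\ ht (D.2 i) = D.1 i.+1,
      forall i, (n < i)%N -> D.1 i = O
    & forall i, (n <= i)%N -> D.2 i = hid O].

Definition TMor : Type := ((TOb * TOb) * (nat -> vmor C))%type.

Definition isTMor (n : nat) (F : TMor) : Prop :=
  [/\ isTOb n F.1.1, isTOb n F.1.2,
      forall i, vs (F.2 i) = F.1.1.1 i /\ vt (F.2 i) = F.1.2.1 i,
      forall i, (i < n)%N -> dsq (F.1.1.2 i) (F.2 i) (F.2 i.+1) (F.1.2.2 i)
    & forall i, (n < i)%N -> F.2 i = vid O].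

Definition Tcat (n : nat) : precat :=
  @Precat TOb (isTOb n) TMor (isTMor n)
    (fun F => F.1.1) (fun F => F.1.2)
    (fun D => ((D, D), fun i => vid (D.1 i)))
    (fun G F => ((F.1.1, G.1.2), fun i => vcomp (G.2 i) (F.2 i))).

Definition T_actO (n m : nat) (theta : nat -> nat) (D : TOb) : TOb :=
  (fun i => if (i <= m)%N then D.1 (theta i) else O,
   fun i => if (i < m)%N then hpath D.1 D.2 (theta i) (theta i.+1 - theta i)
            else hid O).

Definition T_actM (n m : nat) (theta : nat -> nat) (F : TMor) : TMor :=
  ((T_actO n m theta F.1.1, T_actO n m theta F.1.2),
   fun i => if (i <= m)%N then F.2 (theta i) else vid O).

Definition Tsimp : simpCat := @SimpCat Tcat T_actO T_actM.

Definition SOb : Type :=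
  ((nat -> nat -> dob C) * (nat -> nat -> hmor C) * (nat -> nat -> vmor C))%type.

Definition SA (D : SOb) := D.1.1.
Definition Sh (D : SOb) := D.1.2.
Definition Sv (D : SOb) := D.2.

Definition isSOb (n : nat) (D : SOb) : Prop :=
  [/\ forall j, SA D j j = O,
      forall j k, (j <= k < n)%N ->
        hs (Sh D j k) = SA D j k /\ ht (Sh D j k) = SA D j k.+1,
      forall j k, (j < k <= n)%N ->
        vs (Sv D j k) = SA D j k /\ vt (Sv D j k) = SA D j.+1 k,
      forall j k, (j < k < n)%N ->
        dsq (Sh D j k) (Sv D j k) (Sv D j k.+1) (Sh D j.+1 k)
    & [/\ forall j k, ~~ (j <= k <= n)%N -> SA D j k = O,
          forall j k, ~~ (j <= k < n)%N -> Sh D j k = hid O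
        & forall j k, ~~ (j < k <= n)%N -> Sv D j k = vid O]].

Definition SMor : Type := ((SOb * SOb) * (nat -> nat -> vmor C))%type.

Definition isSMor (n : nat) (F : SMor) : Prop :=
  [/\ isSOb n F.1.1, isSOb n F.1.2,
      forall j k, vs (F.2 j k) = SA F.1.1 j k /\ vt (F.2 j k) = SA F.1.2 j k,
      [/\ forall j k, (j <= k < n)%N ->
            dsq (Sh F.1.1 j k) (F.2 j k) (F.2 j k.+1) (Sh F.1.2 j k)
        & forall j k, (j < k <= n)%N ->
            vcomp (F.2 j.+1 k) (Sv F.1.1 j k) = vcomp (Sv F.1.2 j k) (F.2 j k)]
    & forall j k, ~~ (j <= k <= n)%N -> F.2 j k = vid O].

Definition Scat (n : nat) : precat :=
  @Precat SOb (isSOb n) SMor (isSMor n)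
    (fun F => F.1.1) (fun F => F.1.2)
    (fun D => ((D, D), fun j k => vid (SA D j k)))
    (fun G F => ((F.1.1, G.1.2), fun j k => vcomp (G.2 j k) (F.2 j k))).

Definition S_actO (n m : nat) (theta : nat -> nat) (D : SOb) : SOb :=
  (fun j k => if (j <= k <= m)%N then SA D (theta j) (theta k) else O,
   fun j k => if (j <= k < m)%N then
                hpath (SA D (theta j)) (Sh D (theta j))
                      (theta k) (theta k.+1 - theta k)
              else hid O,
   fun j k => if (j < k <= m)%N then
                vpath (fun r => SA D r (theta k)) (fun r => Sv D r (theta k))
                      (theta j) (theta j.+1 - theta j)
              else vid O).

Definition S_actM (n m : nat) (theta : nat -> nat) (F : SMor) : SMor :=
  ((S_actO n m theta F.1.1, S_actO n m theta F.1.2),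
   fun j k => if (j <= k <= m)%N then F.2 (theta j) (theta k) else vid O).

Definition Ssimp : simpCat := @SimpCat Scat S_actO S_actM.

End TS.

(* Main.v *)
Require Import Defs.
From HB Require Import structures.
From mathcomp Require Import all_boot all_order all_algebra.
From mathcomp Require Import all_classical all_reals all_analysis.
From Stdlib Require Import Rdefinitions.
From mathcomp Require Import Rstruct Rstruct_topology.
From mathcomp Require Import zify lra ring.

(* Let M be the collage of T and S: the bisimplicial set of grids, chains of objects of
   level n each of which is marked as a T-object or an S-object, with a vertical
   transformation from a T-object C to an S-object A being one from C to the first row of A
   compatible with the quotient maps.  The realizations of T and S sit in |M| as the
   subspaces of the points all of whose rows carry the mark T, resp. S.  For fixed n both
   inclusions are deformation retracts: an S-object maps to, and receives a transformation
   from, its first row, while a T-object C_0 >-> ... >-> C_n maps to the S-object of its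
   iterated quotients, built with the section s and compared with other S-objects through w.
   These retractions are not simplicial in n.  They still induce deformations of |M|,
   because the realization is built from its levels by pushouts along inclusions, which
   have the homotopy extension property: a deformation can be prolonged over each skeleton.
   As T and S are closed subspaces of |M|, both inclusions are homotopy equivalences. *)

Set Implicit Arguments.
Unset Strict Implicit.
Unset Printing Implicit Defensive.

Import Order.TTheory GRing.Theory Num.Theory.
Import numFieldNormedType.Exports.
Local Open Scope classical_set_scope.
Delimit Scope nat_scope with N.
Delimit Scope ring_scope with R.
Bind Scope ring_scope with R.

(** * Topological preliminaries, simplices and realizations *)

(** Neither comparison of T with S respects the face $d_0$. After deleting the index 0, the iterated
    quotients of $C$ begin with $(C/C_0)/(C_1/C_0)$ where those of the shortened sequence begin with
    $C/C_1$, and $w$ gives only a vertical map between the two; likewise, deleting row 0 of an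
    S-object replaces its first row. Hence the detour through a collage that is deformed level by
    level. Gluing such deformations meets two difficulties: the one given on a new piece and the one
    already built disagree on the attaching part, and what is added there has to be stationary. Both
    are met by never letting a marked point leave the marked points, and by proving the extension
    property with a spare real parameter, so that a homotopy moving the attaching part among marked
    points can be exchanged for one that fixes it. The same invariance lets the final deformation
    restrict to the marked points, which gives the second homotopy of each equivalence. Times run
    through all of R, which is locally compact Hausdorff, so that products with it preserve quotient
    maps. *)

Lemma locally_compactR2 : locally_compact [set: (R * R)%type].
Proof.
move=> [x y] _; have [A] := @locally_compactR R x I; rewrite withinET => xA [cA clA].
have [B] := @locally_compactR R y I; rewrite withinET => yB [cB clB].
exists (A `*` B); first by rewrite withinET; exists (A, B).
split; first exact: compact_setX.
have -> : A `*` B = (fst @^-1` A) `&` (snd @^-1` B) by [].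
by apply: closedI; apply: preimage_closed => // z _; [apply: cvg_fst|apply: cvg_snd].
Qed.

Lemma hausdorffR2 : hausdorff_space (R * R)%type.
Proof.
move=> [x y] [x' y'] cl; congr pair; apply: Rhausdorff => A B nA nB.
  have [] := cl (A `*` setT) (B `*` setT).
  - by exists (A, setT) => //; split => //; apply: filterT.
  - by exists (B, setT) => //; split => //; apply: filterT.
  by move=> [a b] [[/= ? _] [/= ? _]]; exists a.
have [] := cl (setT `*` A) (setT `*` B).
- by exists (setT, A) => //; split => //; apply: filterT.
- by exists (setT, B) => //; split => //; apply: filterT.
by move=> [a b] [[/= _ ?] [/= _ ?]]; exists b.
Qed.

Section QuotLift.
Import ArrowAsCompactOpen.
Variables (T : topologicalType) (r : T -> T -> Prop).

Definition qcl (x : T) : quot_space r := \pi_(quot_space r)%qT x.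

Lemma qcl_continuous : continuous qcl.
Proof. exact: pi_continuous. Qed.

Lemma qcl_surj (x : quot_space r) : exists y, x = qcl y.
Proof. by exists (repr x); rewrite /qcl reprK. Qed.

Lemma qcl_rel a b : r a b -> qcl a = qcl b.
Proof.
move=> rab; apply: (@eqmodP _ (eqclos_rel r) a b); apply/asboolP => E _ _ _; exact.
Qed.

(** Currying turns [F] into a map from [T] to functions on [Z] with the compact-open topology, and
    there it descends to the quotient. Uncurrying the result is continuous because [Z] is locally
    compact Hausdorff. *)
Lemma qlift (Z Y : topologicalType) (F : T * Z -> Y) :
  locally_compact [set: Z] -> hausdorff_space Z -> continuous F ->
  (forall a b z, r a b -> F (a, z) = F (b, z)) ->
  exists G : quot_space r * Z -> Y, continuous G /\ forall a z, G (qcl a, z) = F (a, z).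
Proof.
move=> lcZ hZ cF rF.
pose g (x : quot_space r) (z : Z) := F (repr x, z).
have gE a z : g (qcl a) z = F (a, z).
  have : eqclos r (repr (qcl a)) a.
    by apply/asboolP; apply/(@eqmodP _ (eqclos_rel r)); apply: (reprK (qcl a)).
  move/(_ (fun u v => F (u, z) = F (v, z))); apply => //.
  - by move=> u v w -> ->.
  - by move=> u v; apply: rF.
exists (uncurry g); split; last by move=> a z; apply: gE.
have [cuF cF2] := continuous_curry cF.
apply: continuous_uncurry => //.
  move/continuousP: cuF => cuF; apply/continuousP => A /cuF.
  suff -> : curry F @^-1` A = qcl @^-1` (g @^-1` A) by [].
  apply/seteqP; split => a /=.
    by suff -> : g (qcl a) = curry F a by []; apply/funext => z; apply: gE.
  by suff -> : g (qcl a) = curry F a by []; apply/funext => z; apply: gE.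
move=> x; have [a ->] := qcl_surj x.
by rewrite (_ : g _ = curry F a) //; apply/funext => z; apply: gE.
Qed.

End QuotLift.

Lemma continuous_pair (T A B : topologicalType) (f : T -> A) (g : T -> B) :
  continuous f -> continuous g -> continuous (fun x => (f x, g x)).
Proof. by move=> cf cg x; apply: cvg_pair; [apply: cf|apply: cg]. Qed.

Lemma continuous_compf (A B D : topologicalType) (g : B -> D) (f : A -> B) :
  continuous g -> continuous f -> continuous (fun x => g (f x)).
Proof. by move=> cg cf x; apply: continuous_comp; [apply: cf|apply: cg]. Qed.

Lemma continuous_fst (A B : topologicalType) : continuous (@fst A B).
Proof. by move=> x; apply: cvg_fst. Qed.

Lemma continuous_snd (A B : topologicalType) : continuous (@snd A B).
Proof. by move=> x; apply: cvg_snd. Qed.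

Section RealContinuity.
Local Open Scope ring_scope.
Variables (R0 : realType) (T : topologicalType).
Implicit Types f g : T -> R0.

Lemma ccst (A B : topologicalType) (c : B) : continuous (fun _ : A => c).
Proof. exact: cst_continuous. Qed.

Lemma cD f g : continuous f -> continuous g -> continuous (fun x => f x + g x).
Proof. by move=> cf cg x; apply: (@continuousD R0 R0^o _ f g); [apply: cf|apply: cg]. Qed.

Lemma cN f : continuous f -> continuous (fun x => - f x).
Proof. by move=> cf x; apply: (@continuousN R0 R0^o _ f); apply: cf. Qed.

Lemma cB f g : continuous f -> continuous g -> continuous (fun x => f x - g x).
Proof. by move=> cf cg; apply: cD => //; apply: cN. Qed.

Lemma cM f g : continuous f -> continuous g -> continuous (fun x => f x * g x).
Proof. by move=> cf cg x; apply: (@continuousM _ _ f g); [apply: cf|apply: cg]. Qed.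

Lemma cV f : (forall x, f x != 0) -> continuous f -> continuous (fun x => (f x)^-1).
Proof. by move=> nz cf x; apply: (@continuousV _ _ f) => //; apply: cf. Qed.

Lemma cmin f g : continuous f -> continuous g -> continuous (fun x => Order.min (f x) (g x)).
Proof. by move=> cf cg x; apply: (@continuous_min _ _ f g); [apply: cf|apply: cg]. Qed.

Lemma cmax f g : continuous f -> continuous g -> continuous (fun x => Order.max (f x) (g x)).
Proof. by move=> cf cg x; apply: (@continuous_max _ _ f g); [apply: cf|apply: cg]. Qed.

Lemma csum (I : Type) (r : seq I) (P : pred I) (F : I -> T -> R0) :
  (forall i, continuous (F i)) -> continuous (fun x => \sum_(i <- r | P i) F i x).
Proof.
move=> cF; elim: r => [|i r IH].
  by rewrite (_ : (fun x => _) = fun _ => 0); [exact: ccst|apply/funext => x; rewrite big_nil].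
case Pi : (P i).
  rewrite (_ : (fun x => _) = fun x => F i x + \sum_(j <- r | P j) F j x).
    exact: cD.
  by apply/funext => x; rewrite big_cons Pi.
rewrite (_ : (fun x => _) = fun x => \sum_(j <- r | P j) F j x) //.
by apply/funext => x; rewrite big_cons Pi.
Qed.

Lemma closed_lef f g : continuous f -> continuous g -> closed [set x | f x <= g x].
Proof.
move=> cf cg; rewrite (_ : mkset _ = (fun x => g x - f x) @^-1` [set x | 0 <= x]).
  by apply: preimage_closed; [move=> x _; apply: (cB cg cf)|apply: closed_ge].
by apply/seteqP; split => x /=; rewrite subr_ge0.
Qed.

Lemma closed_eqf f g : continuous f -> continuous g -> closed [set x | f x = g x].
Proof.
move=> cf cg; rewrite (_ : mkset _ = [set x | f x <= g x] `&` [set x | g x <= f x]).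
  by apply: closedI; apply: closed_lef.
apply/seteqP; split => x /=; first by move=> ->; rewrite !lexx.
by move=> [h1 h2]; apply/eqP; rewrite eq_le h1.
Qed.

End RealContinuity.

(** Near a point only the members that contain it matter, since the complements of the finitely many
    others are neighbourhoods. *)
Lemma continuous_cover (T Y : topologicalType) (I : finType) (A : I -> set T)
    (g : I -> T -> Y) (f : T -> Y) :
  (forall i, closed (A i)) -> (forall x, exists i, A i x) ->
  (forall i x, A i x -> f x = g i x) -> (forall i, continuous (g i)) -> continuous f.
Proof.
move=> cA cov fg cg x U Ux.
suff : nbhs x [set y | forall i, A i y -> U (f y)].
  by apply: filterS => y h; have [i Ai] := cov y; apply: (h i Ai).
apply: filter_forall => i; have [Aix|nAix] := pselect (A i x).
  have H : nbhs x (g i @^-1` U) by apply: cg; rewrite -(fg i x Aix).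
  by apply: filterS H => y /= h Aiy; rewrite (fg i).
have H : nbhs x (~` A i) by apply: open_nbhs_nbhs; split => //; apply: closed_openC.
by apply: filterS H => y /= h /h.
Qed.

Lemma continuous_cover2 (T Y : topologicalType) (A B : set T) (g h f : T -> Y) :
  closed A -> closed B -> (forall x, A x \/ B x) ->
  (forall x, A x -> f x = g x) -> (forall x, B x -> f x = h x) ->
  continuous g -> continuous h -> continuous f.
Proof.
move=> cA cB cov fg fh cg ch.
apply: (@continuous_cover _ _ bool (fun b => if b then A else B)
         (fun b => if b then g else h)).
- by case.
- by move=> x; have [?|?] := cov x; [exists true|exists false].
- by case => x; [apply: fg|apply: fh].
- by case.
Qed.

(** The value at [m] is repeated beyond [m], so that operators agreeing on [0..m] are equal terms
    and the functor laws are plain equalities. *)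
Record mono (m n : nat) := Mono {
  mf :> nat -> nat;
  mf_homo : forall i j, i <= j -> mf i <= mf j;
  mf_le : forall i, mf i <= n;
  mf_norm : forall i, mf i = mf (minn i m) }.

Lemma mono_eq m n (f g : mono m n) : (forall i, i <= m -> f i = g i) -> f = g.
Proof.
move=> fg; have {fg} : mf f = mf g.
  by apply/funext => i; rewrite mf_norm [RHS]mf_norm fg // geq_minr.
case: f g => [f f1 f2 f3] [g g1 g2 g3] /= E; case: _ / E g1 g2 g3 => g1 g2 g3.
by congr Mono; apply: Prop_irrelevance.
Qed.

Definition mid n : mono n n.
Proof. by refine (@Mono n n (minn^~ n) _ _ _) => *; lia. Defined.

Definition mcomp m n p (g : mono n p) (f : mono m n) : mono m p.
Proof.
refine (@Mono m p (fun i => g (f i)) _ _ _) => [i j ij|i|i].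
- by apply: (mf_homo g); apply: (mf_homo f).
- exact: (mf_le g).
- by rewrite (mf_norm f i).
Defined.

Lemma mcompA m n p q (h : mono p q) (g : mono n p) (f : mono m n) :
  mcomp h (mcomp g f) = mcomp (mcomp h g) f.
Proof. by apply: mono_eq. Qed.

Lemma mcomp_idl m n (f : mono m n) : mcomp (mid n) f = f.
Proof. by apply: mono_eq => i _ /=; apply/minn_idPl/mf_le. Qed.

Lemma mcomp_idr m n (f : mono m n) : mcomp f (mid m) = f.
Proof. by apply: mono_eq => i _ /=; rewrite -mf_norm. Qed.

Definition msurj m n (f : mono m n) := forall j, j <= n -> exists2 i, i <= m & f i = j.

Definition hom (d' d : nat * nat) : Type := (mono d'.1 d.1 * mono d'.2 d.2)%type.
Definition hid_ (d : nat * nat) : hom d d := (mid d.1, mid d.2).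
Definition hc d d' d'' (g : hom d' d'') (f : hom d d') : hom d d'' :=
  (mcomp g.1 f.1, mcomp g.2 f.2).

Section Simplices.
Local Open Scope ring_scope.

Definition co n (s : simplex n) (i : 'I_n.+1) : R := val s ord0 i.

Lemma co_ge0 n (s : simplex n) i : 0 <= co s i.
Proof. by case: s => s sP; have [+ _] := set_mem sP; apply. Qed.

Lemma co_sum n (s : simplex n) : \sum_(i < n.+1) co s i = 1.
Proof. by case: s => s sP; have [_] := set_mem sP. Qed.

Lemma simplex_eq n (s t : simplex n) : (forall i, co s i = co t i) -> s = t.
Proof. by move=> st; apply/val_inj/rowP => i; rewrite -[LHS]/(co s i) st. Qed.

Lemma mk_simplex_subproof n (w : 'I_n.+1 -> R) :
  (forall i, 0 <= w i) -> \sum_(i < n.+1) w i = 1 -> (\row_i w i) \in @simplex_set n.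
Proof.
move=> w0 w1; apply: mem_set; split => [i|]; first by rewrite mxE.
by under eq_bigr do rewrite mxE.
Qed.

Definition mk_simplex n (w : 'I_n.+1 -> R) w0 w1 : simplex n :=
  exist _ (\row_i w i) (@mk_simplex_subproof n w w0 w1).

Lemma co_mk n (w : 'I_n.+1 -> R) w0 w1 i : co (@mk_simplex n w w0 w1) i = w i.
Proof. by rewrite /co /= mxE. Qed.

Lemma co_continuous n (i : 'I_n.+1) : continuous (fun s : simplex n => co s i).
Proof.
have -> : (fun s : simplex n => co s i) = (fun M : 'rV[R]_n.+1 => M ord0 i) \o set_val by [].
move=> s; apply: continuous_comp; first exact: initial_continuous.
exact: coord_continuous.
Qed.

Lemma continuous_simplex (T : topologicalType) n (f : T -> simplex n) :
  (forall i, continuous (fun x => co (f x) i)) -> continuous f.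
Proof.
move=> cf; apply: continuous_comp_initial => x U [P /= nP PU].
suff : nbhs x [set y | forall i, P ord0 i (co (f y) i)].
  by apply: filterS => y Py; apply: PU => i j; rewrite (ord1 i); apply: Py.
apply: filter_forall => i; apply: cf; exact: nP.
Qed.

Lemma spush_subproof m n (f : mono m n) (s : simplex m) :
  \sum_(i < n.+1) \sum_(j < m.+1 | f j == i) co s j = 1.
Proof.
rewrite -(co_sum s) (partition_big (fun j : 'I_m.+1 => inord (f j) : 'I_n.+1) xpredT) //=.
apply: eq_bigr => i _; apply: eq_bigl => j.
by rewrite -val_eqE /= inordK // ltnS mf_le.
Qed.

Definition spush m n (f : mono m n) (s : simplex m) : simplex n :=
  mk_simplex (fun i => sumr_ge0 _ (fun j _ => co_ge0 s j)) (spush_subproof f s).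

Lemma co_push m n (f : mono m n) (s : simplex m) i :
  co (spush f s) i = \sum_(j < m.+1 | f j == i) co s j.
Proof. exact: co_mk. Qed.

Lemma spush_id n (s : simplex n) : spush (mid n) s = s.
Proof.
apply: simplex_eq => i; rewrite co_push (bigD1 i) /=; last first.
  by apply/eqP/minn_idPl; rewrite -ltnS.
rewrite big1 ?addr0 // => j /andP[/eqP ji nji].
by move: nji; rewrite -val_eqE /= -ji; have := ltn_ord j; lia.
Qed.

Lemma spush_comp m n p (g : mono n p) (f : mono m n) s :
  spush g (spush f s) = spush (mcomp g f) s.
Proof.
apply: simplex_eq => i; rewrite !co_push.
under eq_bigr do rewrite co_push.
rewrite (exchange_big_dep xpredT) //= [RHS]big_mkcond /=; apply: eq_bigr => j _.
have fj : (f j < n.+1)%N by rewrite ltnS mf_le.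
case: ifP => gi; last first.
  rewrite big_pred0 // => l; apply/negP => /andP[/eqP gl /eqP fl].
  by rewrite fl gl eqxx in gi.
rewrite (big_pred1 (Ordinal fj)) // => l /=; rewrite -val_eqE /=.
apply/andP/eqP => [[_ /eqP ->]//|->]; split => //.
Qed.

(** A vertex without mass contributes nothing, so an operator may be altered off the support of the
    point. *)
Lemma spush_ext m n (f g : mono m n) s :
  (forall j : 'I_m.+1, co s j != 0 -> f j = g j) -> spush f s = spush g s.
Proof.
move=> fg; apply: simplex_eq => i; rewrite !co_push big_mkcond [RHS]big_mkcond /=.
apply: eq_bigr => j _; have [->|nz] := eqVneq (co s j) 0; first by rewrite !if_same.
by rewrite fg.
Qed.

Lemma spush_continuous m n (f : mono m n) : continuous (spush f).
Proof.
apply: continuous_simplex => i.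
have -> : (fun s => co (spush f s) i) = (fun s => \sum_(j < m.+1 | f j == i) co s j).
  by apply/funext => s; rewrite co_push.
by apply: csum => j; exact: co_continuous.
Qed.

End Simplices.

Definition pt (d : nat * nat) : topologicalType := (simplex d.1 * simplex d.2)%type.

Definition push d' d (h : hom d' d) (p : pt d') : pt d := (spush h.1 p.1, spush h.2 p.2).

Lemma push_comp d d' d'' (g : hom d' d'') (f : hom d d') p :
  push g (push f p) = push (hc g f) p.
Proof. by rewrite /push /= !spush_comp. Qed.

Lemma push_continuous d' d (h : hom d' d) : continuous (push h).
Proof.
apply: continuous_pair; apply: continuous_compf; try exact: spush_continuous.
- exact: continuous_fst.
- exact: continuous_snd.
Qed.

Section BSets.

(** A bisimplicial set with a subobject [bmk], whose points form the subspace that deformations have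
    to reach and preserve. *)
Record bset := Bset {
  bel :> nat * nat -> Type;
  bact : forall d d', hom d' d -> bel d -> bel d';
  bmk : forall d, bel d -> Prop;
  bact_id : forall d (b : bel d), bact (hid_ d) b = b;
  bact_comp : forall d d' d'' (g : hom d' d) (f : hom d'' d') (b : bel d),
    bact f (bact g b) = bact (hc g f) b;
  bmk_act : forall d d' (h : hom d' d) (b : bel d), bmk b -> bmk (bact h b) }.

Variable B : bset.

Definition BFib (p : nat * nat) : topologicalType :=
  (discrete_topology {classic B p} * simplex p.1 * simplex p.2)%type.
Definition BSig : topologicalType := {p : nat * nat & BFib p}.

Definition bgen (a b : BSig) : Prop :=
  exists d d' (h : hom d' d) (x : B d) (p : pt d'),
    a = existT BFib d' (bact h x, p.1, p.2) /\
    b = existT BFib d (x, (push h p).1, (push h p).2).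

Definition breal : topologicalType := quot_space bgen.

Definition cls d (b : B d) (p : pt d) : breal := qcl bgen (existT BFib d (b, p.1, p.2)).

Lemma cls_act d d' (h : hom d' d) (b : B d) p : cls (bact h b) p = cls b (push h p).
Proof. by apply: qcl_rel; exists d, d', h, b, p. Qed.

Lemma cls_surj (x : breal) : exists d (b : B d) p, x = cls b p.
Proof. by have [[d [[b s] t]] ->] := qcl_surj x; exists d, b, (s, t). Qed.

Lemma cls_continuous d (b : B d) : continuous (cls b).
Proof.
move=> p; apply: (@continuous_comp _ _ _ (fun p : pt d => existT BFib d (b, p.1, p.2))).
  apply: (@continuous_comp _ _ _ (fun p : pt d => ((b, p.1), p.2) : BFib d)).
    apply: continuous_pair; last exact: continuous_snd.
    by apply: continuous_pair; [exact: ccst|exact: continuous_fst].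
  exact: existT_continuous.
exact: qcl_continuous.
Qed.

(** Elements form a discrete factor, so continuity is checked one cell at a time. The factor [Z]
    will hold the parameters of homotopies. *)
Lemma breal_lift (Z Y : topologicalType) (F : forall d, B d -> pt d * Z -> Y) :
  locally_compact [set: Z] -> hausdorff_space Z ->
  (forall d (b : B d), continuous (F d b)) ->
  (forall d d' (h : hom d' d) (b : B d) p z, F d' (bact h b) (p, z) = F d b (push h p, z)) ->
  exists G : breal * Z -> Y, continuous G /\ forall d (b : B d) p z, G (cls b p, z) = F d b (p, z).
Proof.
move=> lcZ hZ cF FE.
pose F' (u : BSig * Z) : Y :=
  let: existT d x := u.1 in F d x.1.1 ((x.1.2, x.2), u.2).
have [||G [cG GE]] := @qlift _ bgen Z Y F' lcZ hZ.
- move=> [[d [[b s] t]] z] U /= /(cF d b ((s, t), z)) [[P Q] [/= [[P1 P2] [/= nP1 nP2] P12] nQ] PQ].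
  exists (existT BFib d @` (([set b] `*` P1) `*` P2), Q).
    split => //=; apply: existT_nbhs.
    exists ([set b] `*` P1, P2) => //=; split => //.
    by exists ([set b], P1) => //=; split => //; rewrite nbhs_principalE.
  by move=> [x z'] /= [[[[b' s'] t'] [[/= -> h1] h2] <-] h3]; apply: PQ; split => //; apply: P12.
- move=> a b z [d [d' [h [x [p [-> ->]]]]]]; rewrite /F' /=.
  by have := FE _ _ h x p z; rewrite -!surjective_pairing.
by exists G; split => // d b p z; rewrite GE /F' /= -surjective_pairing.
Qed.

End BSets.
Arguments cls {B d}.

(** * Nondegenerate roots and the geometry of simplices *)

(** Any choice of preimages is monotone because [f] is, and the one over [f x] can be taken to be
    [x]. Sections through a prescribed point let [root_unique] compare operators pointwise. *)
Lemma msection m n (f : mono m n) x : msurj f -> x <= m ->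
  exists g : mono n m, mcomp f g = mid n /\ g (f x) = x.
Proof.
move=> sf xm.
have /choice[g0 g0P] : forall j, exists i, (j <= n -> i <= m /\ f i = j) /\ (j = f x -> i = x).
  move=> j; have [->|jx] := eqVneq j (f x); first by exists x.
  have [jn|nj] := leqP j n; last by exists 0; split => [|E]; [lia|rewrite E eqxx in jx].
  by have [i im fi] := sf j jn; exists i; split => // E; rewrite E eqxx in jx.
have fg j : j <= n -> f (g0 j) = j by move=> /(g0P j).1[].
unshelve eexists (@Mono n m (fun j => g0 (minn j n)) _ _ _).
- move=> i j ij; rewrite leqNgt; apply/negP => gt.
  have := mf_homo f (ltnW gt); rewrite !fg ?geq_minr // => le.
  have E : minn i n = minn j n by lia.
  by rewrite E ltnn in gt.
- by move=> i; have [] := (g0P (minn i n)).1 (geq_minr _ _).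
- by move=> i /=; congr g0; lia.
split; first by apply: mono_eq => i ni /=; rewrite fg ?geq_minr.
by apply: (g0P _).2; apply/minn_idPl/mf_le.
Qed.

(** A section is strictly increasing, hence gains at least one at each step. *)
Lemma msection_ge m n (f : mono m n) (g : mono n m) : mcomp f g = mid n ->
  forall i j, i <= j -> j <= n -> g i + (j - i) <= g j.
Proof.
move=> fg i j ij jn; rewrite -(subnKC ij) in jn *; move: (j - i) jn => {ij} k.
have fgE x : x <= n -> f (g x) = x.
  by move=> xn; have := congr1 (fun h : mono n n => h x) fg => /= ->; apply/minn_idPl.
elim: k => [|k IH] le; first by rewrite addn0; lia.
have := IH ltac:(lia).
suff : g (i + k) < g (i + k.+1) by lia.
rewrite ltnNge; apply/negP => /(mf_homo f); rewrite !fgE; lia.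
Qed.

Lemma msurj_le m n (f : mono m n) : msurj f -> n <= m.
Proof.
move=> sf; have [g [fg _]] := msection sf (leq0n m).
by have := msection_ge fg (leq0n n) (leqnn n); have := mf_le g n; lia.
Qed.

Lemma msurj_id n (f : mono n n) : msurj f -> f = mid n.
Proof.
move=> sf; have [g [fg _]] := msection sf (leq0n n).
suff E : g = mid n by rewrite -fg E mcomp_idr.
apply: mono_eq => i ni /=; have := msection_ge fg ni (leqnn n).
have := msection_ge fg (leq0n i) ni; have := mf_le g n; lia.
Qed.

(* [mskip n j] misses exactly [j] when [0 < n], and [munskip n j] inverts it off [j]. *)
Definition mskip n (j : nat) : mono n.-1 n.
Proof.
refine (@Mono n.-1 n (fun x => minn (bump j (minn x n.-1)) n) _ _ _) => *; rewrite /bump; lia.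
Defined.

Definition munskip n (j : nat) : mono n n.-1.
Proof.
refine (@Mono n n.-1 (fun x => minn (unbump j (minn x n)) n.-1) _ _ _) => *; rewrite /unbump; lia.
Defined.

Lemma mskipK n j x : j <= n -> x <= n -> x <> j -> mskip n j (munskip n j x) = x.
Proof. rewrite /= /bump /unbump; lia. Qed.

Lemma mskip_neq n j x : 0 < n -> j <= n -> mskip n j x <> j.
Proof. rewrite /= /bump; lia. Qed.

Lemma not_msurj m n (f : mono m n) : ~ msurj f ->
  exists2 j, j <= n & forall i, f i <> j.
Proof.
move=> /existsNP[j /not_implyP[jn nj]]; exists j => // i E.
by apply: nj; exists (minn i m); [exact: geq_minr|rewrite -mf_norm].
Qed.

Lemma not_msurj_factor m n (f : mono m n) : ~ msurj f ->
  0 < n /\ exists (g : mono n.-1 n) (f' : mono m n.-1), f = mcomp g f'.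
Proof.
move=> /not_msurj[j jn nj]; split.
  by case: n f j jn nj => // f j; rewrite leqn0 => /eqP -> /(_ 0); have := mf_le f 0; lia.
exists (mskip n j), (mcomp (munskip n j) f); apply: mono_eq => i _.
by rewrite -[RHS]/(mskip n j (munskip n j (f i))) mskipK //; exact: mf_le.
Qed.

Definition hsurj d' d (h : hom d' d) := msurj h.1 /\ msurj h.2.

Lemma hsurj_id d (h : hom d d) : hsurj h -> h = hid_ d.
Proof. by case: h => h1 h2 [/= /msurj_id -> /msurj_id ->]. Qed.

Lemma hsection d' d (h : hom d' d) x y : hsurj h -> x <= d'.1 -> y <= d'.2 ->
  exists g : hom d d', [/\ hc h g = hid_ d, g.1 (h.1 x) = x & g.2 (h.2 y) = y].
Proof.
move=> [s1 s2] xm ym; have [g1 [e1 e1']] := msection s1 xm; have [g2 [e2 e2']] := msection s2 ym.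
by exists (g1, g2); rewrite /hc /= e1 e2.
Qed.

Section Roots.
Variable B : bset.

(** Every operator [h] is allowed, not only surjective ones; factoring [h] through its image shows
    that this is the usual nondegeneracy in each of the two directions. *)
Definition nondeg d (r : B d) := forall d' (h : hom d d') (b : B d'),
  r = bact h b -> d.1 <= d'.1 /\ d.2 <= d'.2.

Lemma not_hsurj_factor d d' (h : hom d d') : ~ hsurj h ->
  exists d'' (g : hom d'' d') (f : hom d d''),
    [/\ h = hc g f, d''.1 <= d'.1, d''.2 <= d'.2 & d''.1 + d''.2 < d'.1 + d'.2].
Proof.
case: h => h1 h2 /not_andP[] /= /not_msurj_factor[lt [g [f E]]].
  exists (d'.1.-1, d'.2), (g, mid d'.2), (f, h2).
  by rewrite /hc /= mcomp_idl -E; split => //=; lia.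
exists (d'.1, d'.2.-1), (mid d'.1, g), (h1, f).
by rewrite /hc /= mcomp_idl -E; split => //=; lia.
Qed.

Lemma nondeg_hsurj d (r : B d) d' (h : hom d d') (b : B d') :
  nondeg r -> r = bact h b -> d'.1 <= d.1 -> d'.2 <= d.2 -> hsurj h.
Proof.
move=> nr rE l1 l2; apply: contrapT => /not_hsurj_factor[d'' [g [f [hE _ _ lt]]]].
have := nr d'' f (bact g b); rewrite bact_comp -hE => /(_ rE); lia.
Qed.

Lemma root_exists d (b : B d) : exists d' (r : B d') (h : hom d d'),
  [/\ nondeg r, hsurj h & b = bact h r].
Proof.
suff H N d' (r : B d') (h : hom d d') : d'.1 + d'.2 <= N -> b = bact h r ->
    exists d' (r : B d') (h : hom d d'), [/\ nondeg r, hsurj h & b = bact h r].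
  by apply: (H _ d b (hid_ d) (leqnn _)); rewrite bact_id.
elim: N d' r h => [|N IH] d' r h le bE.
  all: have [nr|] := pselect (nondeg r); last first.
  1,3: move=> /existsNP[d2 /existsNP[k /existsNP[c /not_implyP[rE]]]].
  1,2: move=> /not_andP[]/negP; rewrite -ltnNge => lt.
- by exfalso; lia.
- by exfalso; lia.
(* Only one of the two dimensions is known to drop and the other may grow, so [k] is split and its
   component in the other direction is absorbed into the element. *)
- apply: (IH (d2.1, d'.2) (bact ((mid _, k.2) : hom (d2.1, d'.2) d2) c)
     (hc ((k.1, mid _) : hom d' (d2.1, d'.2)) h)); first by rewrite /=; lia.
  by rewrite -bact_comp bE rE; congr (bact h _); rewrite bact_comp /hc /= mcomp_idl mcomp_idr -surjective_pairing.
- apply: (IH (d'.1, d2.2) (bact ((k.1, mid _) : hom (d'.1, d2.2) d2) c)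
     (hc ((mid _, k.2) : hom d' (d'.1, d2.2)) h)); first by rewrite /=; lia.
  by rewrite -bact_comp bE rE; congr (bact h _); rewrite bact_comp /hc /= mcomp_idl mcomp_idr -surjective_pairing.
all: have [sh|/not_hsurj_factor[d'' [g [f [hE _ _ lt]]]]] := pselect (hsurj h).
- by exists d', r, h.
- by exfalso; lia.
- by exists d', r, h.
- by apply: (IH d'' (bact g r) f); [lia|rewrite bact_comp -hE].
Qed.

(** Eilenberg-Zilber. A section [g] of [h1] expresses [r1] as [hc h2 g] acting on [r2], and
    symmetrically, so the dimensions agree; by nondegeneracy [hc h2 g] is then surjective, hence the
    identity. With [g] chosen through [x], the operators [h1] and [h2] agree at [x]. *)
Lemma root_unique d d1 d2 (r1 : B d1) (r2 : B d2) (h1 : hom d d1) (h2 : hom d d2) :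
  nondeg r1 -> nondeg r2 -> hsurj h1 -> hsurj h2 -> bact h1 r1 = bact h2 r2 ->
  existT (fun e => (B e * hom d e)%type) d1 (r1, h1) = existT _ d2 (r2, h2).
Proof.
move=> n1 n2 s1 s2 E.
have sec (e e' : nat * nat) (r : B e) (r' : B e') (h : hom d e) (h' : hom d e') x y :
    hsurj h -> bact h r = bact h' r' -> x <= d.1 -> y <= d.2 ->
    exists g : hom e d, [/\ g.1 (h.1 x) = x, g.2 (h.2 y) = y & r = bact (hc h' g) r'].
  move=> sh E' xm ym; have [g [gE gx gy]] := hsection sh xm ym.
  by exists g; rewrite -bact_comp -E' bact_comp gE bact_id.
have [g [_ _ E1]] := sec _ _ _ _ _ _ _ _ s1 E (leq0n _) (leq0n _).
have [g' [_ _ E2]] := sec _ _ _ _ _ _ _ _ s2 (esym E) (leq0n _) (leq0n _).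
have [l1 l2] := n1 _ _ _ E1; have [l3 l4] := n2 _ _ _ E2.
have e12 : d1 = d2 by case: d1 d2 l1 l2 l3 l4 {r1 r2 h1 h2 n1 n2 s1 s2 E g g' E1 E2} => a b [a' b'] /=; move=> *; congr pair; lia.
move: e12 r2 h2 n2 s2 E {g g' E1 E2 l1 l2 l3 l4}; case: _ / => r2 h2 n2 s2 E.
have idg g : r1 = bact (hc h2 g) r2 -> hc h2 g = hid_ d1.
  by move=> Eg; apply: hsurj_id; apply: (nondeg_hsurj n1 Eg).
have [g [_ _ Eg]] := sec _ _ _ _ _ _ _ _ s1 E (leq0n _) (leq0n _).
have <- : r1 = r2 by rewrite Eg (idg g Eg) bact_id.
suff -> : h1 = h2 by [].
suff [E1 E2] : h1.1 = h2.1 /\ h1.2 = h2.2 by rewrite [LHS]surjective_pairing E1 E2 -surjective_pairing.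
split; apply: mono_eq => x xm.
  have [k [kx _ Ek]] := sec _ _ _ _ _ _ x 0 s1 E xm (leq0n _).
  have := congr1 (fun h : hom d1 d1 => h.1 (h1.1 x)) (idg k Ek) => /=; rewrite kx => ->.
  by apply/esym/minn_idPl/mf_le.
have [k [_ kx Ek]] := sec _ _ _ _ _ _ 0 x s1 E (leq0n _) xm.
have := congr1 (fun h : hom d1 d1 => h.2 (h1.2 x)) (idg k Ek) => /=; rewrite kx => ->.
by apply/esym/minn_idPl/mf_le.
Qed.

End Roots.

Section SimplexGeometry.
Local Open Scope ring_scope.

(** The unit 1 of the minimum bounds all coordinates, so [smin] vanishes exactly on the boundary. *)
Definition smin n (s : simplex n) : R := \big[Order.min/1]_(i < n.+1) co s i.

Lemma smin_le n (s : simplex n) i : smin s <= co s i.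
Proof. by rewrite /smin (bigD1 i) //= ge_min lexx. Qed.

Lemma smin_ge0 n (s : simplex n) : 0 <= smin s.
Proof.
rewrite /smin; elim/big_ind: _ => // [x y x0 y0|i _]; last exact: co_ge0.
by rewrite le_min x0.
Qed.

Lemma smin_attained n (s : simplex n) : smin s = 1 \/ exists i, smin s = co s i.
Proof.
rewrite /smin; elim/big_ind: _ => [|x y hx hy|i _]; [by left| |by right; exists i].
by rewrite minEle; case: ifP.
Qed.

Lemma smin_continuous n : continuous (@smin n).
Proof.
rewrite /smin; elim: (index_enum _) => [|i r IH].
  by rewrite (_ : (fun x => _) = fun _ => 1); [exact: ccst|apply/funext => x; rewrite big_nil].
rewrite (_ : (fun x => _) = fun x => Order.min (co x i) (\big[Order.min/1]_(j <- r) co x j)).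
  by apply: cmin => //; exact: co_continuous.
by apply/funext => x; rewrite big_cons.
Qed.

(* The radial push away from the barycentre: subtract [l] from every coordinate,
   truncate at [0] and renormalize; [l] is capped so that the total mass stays positive. *)
Definition cap n (l : R) : R := Order.min l (n.+2%:R^-1).

Definition sgap n (s : simplex n) (l : R) : R :=
  \sum_(i < n.+1) Order.max (co s i - cap n l) 0.

(** Each of the n+1 coordinates loses at most 1/(n+2), so a mass of at least 1/(n+2) remains. *)
Lemma sgap_gt0 n (s : simplex n) l : 0 < sgap s l.
Proof.
apply: (@lt_le_trans _ _ (\sum_(i < n.+1) (co s i - cap n l))); last first.
  by apply: ler_sum => i _; rewrite le_max lexx.
rewrite big_split /= co_sum sumrN sumr_const card_ord subr_gt0 -mulr_natl.
apply: (@le_lt_trans _ _ (n.+1%:R * n.+2%:R^-1)).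
  by rewrite ler_wpM2l ?ler0n // /cap ge_min lexx orbT.
by rewrite ltr_pdivrMr ?ltr0n // mul1r ltr_nat.
Qed.

Lemma sshrink_ge0 n (s : simplex n) l i : 0 <= Order.max (co s i - cap n l) 0 / sgap s l.
Proof. by rewrite divr_ge0 ?le_max ?lexx ?orbT // ltW // sgap_gt0. Qed.

Lemma sshrink_sum n (s : simplex n) l :
  \sum_(i < n.+1) (Order.max (co s i - cap n l) 0 / sgap s l) = 1.
Proof. by rewrite -mulr_suml divff // gt_eqF // sgap_gt0. Qed.

Definition sshrink n (s : simplex n) (l : R) : simplex n :=
  mk_simplex (sshrink_ge0 s l) (sshrink_sum s l).

Lemma sshrink0 n (s : simplex n) : sshrink s 0 = s.
Proof.
have c0 : cap n 0 = 0 by rewrite /cap min_l // invr_ge0 ler0n.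
have mx i : Order.max (co s i - cap n 0) 0 = co s i by rewrite c0 subr0 max_l ?co_ge0.
apply: simplex_eq => i; rewrite co_mk mx /sgap.
by under eq_bigr do rewrite mx; rewrite co_sum divr1.
Qed.

Lemma sshrink_eq0 n (s : simplex n) l i : co s i <= l -> l <= n.+2%:R^-1 -> co (sshrink s l) i = 0.
Proof. by move=> sl ln; rewrite co_mk /cap min_l // max_r ?mul0r // subr_le0. Qed.

Lemma sshrink_continuous (T : topologicalType) n (f : T -> simplex n) (l : T -> R) :
  continuous f -> continuous l -> continuous (fun x => sshrink (f x) (l x)).
Proof.
move=> cf cl.
have cn i : continuous (fun x => Order.max (co (f x) i - cap n (l x)) 0).
  apply: cmax; last exact: ccst.
  apply: cB; first by apply: (continuous_compf (@co_continuous n i)).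
  by apply: cmin => //; exact: ccst.
apply: continuous_simplex => i.
under eq_fun do rewrite co_mk.
apply: cM; first exact: cn.
by apply: cV; [move=> x; rewrite gt_eqF // sgap_gt0|apply: csum => j; exact: cn].
Qed.

Lemma ssupp_ex n (s : simplex n) : exists i : 'I_n.+1, co s i != 0.
Proof.
apply: contrapT => /forallNP h; have := co_sum s.
rewrite big1 => [/eqP|i _]; first by rewrite eq_sym oner_eq0.
by apply/eqP; apply: contrapT => /negP; exact: h.
Qed.

(** A monotone retraction of [[n]] onto the support: [j] goes to the largest support vertex not
    above the maximum of [j] and the least support vertex [i0]. An endomorphism, unlike the
    inclusion of a smaller ordinal, names the face carrying [s] without changing the dimension. *)
Lemma ssupp_exists n (s : simplex n) : exists e : mono n n,
  (forall i : 'I_n.+1, co s i != 0 -> e i = i) /\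
  (forall x, exists2 i : 'I_n.+1, co s i != 0 & e x = i).
Proof.
pose P (i : 'I_n.+1) := co s i != 0; have P0 : P (xchoose (ssupp_ex s)) by exact: xchooseP.
pose i0 := [arg min_(i < xchoose (ssupp_ex s) | P i) (i : nat)]%N.
have [Pi0 mi0] : P i0 /\ forall j, P j -> (i0 <= j)%N by rewrite /i0; case: arg_minnP.
pose Q j (i : 'I_n.+1) := P i && (i <= maxn j i0)%N.
have Qi0 j : Q j i0 by rewrite /Q Pi0 leq_maxr.
pose E j := [arg max_(i > i0 | Q j i) (i : nat)]%N.
have EP j : Q j (E j) /\ forall i, Q j i -> (i <= E j)%N by rewrite /E; case: arg_maxnP.
unshelve eexists (@Mono n n (fun j => E (minn j n) : nat) _ _ _).
- move=> i j ij; apply: (EP _).2; have [/andP[PE le] _] := EP (minn i n).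
  by rewrite /Q PE; lia.
- by move=> i; rewrite -ltnS.
- by move=> i /=; congr (nat_of_ord (E _)); lia.
split => [i Pi|x] /=; last by exists (E (minn x n)) => //; have [/andP[]] := EP (minn x n).
have [/andP[PE le] h] := EP (minn i n); have := h i; rewrite /Q /P Pi.
by have := mi0 _ Pi; have := ltn_ord i; lia.
Qed.

Definition ssupp n (s : simplex n) : mono n n := sval (cid (ssupp_exists s)).

Lemma ssupp_fix n (s : simplex n) (i : 'I_n.+1) : co s i != 0 -> ssupp s i = i.
Proof. by rewrite /ssupp; case: cid => e /= [+ _]; apply. Qed.

Lemma ssupp_in n (s : simplex n) x : exists2 i : 'I_n.+1, co s i != 0 & ssupp s x = i.
Proof. by rewrite /ssupp; case: cid => e /= [_]; apply. Qed.

Lemma spush_fix n (e : mono n n) (s : simplex n) :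
  (forall i : 'I_n.+1, co s i != 0 -> e i = i) -> spush e s = s.
Proof.
move=> h; rewrite -[RHS]spush_id; apply: spush_ext => i /h -> /=.
by apply/esym/minn_idPl; rewrite -ltnS.
Qed.

Lemma mcomp_ssupp n m (e e' : mono n m) (s : simplex n) :
  (forall i : 'I_n.+1, co s i != 0 -> e i = e' i) -> mcomp e (ssupp s) = mcomp e' (ssupp s).
Proof. by move=> h; apply: mono_eq => x _ /=; have [i /h E ->] := ssupp_in s x. Qed.

Lemma ssupp_not_surj n (s : simplex n) i : co s i = 0 -> ~ msurj (ssupp s).
Proof.
move=> si /(_ i); rewrite -ltnS => /(_ (ltn_ord i))[x _]; have [j sj ->] := ssupp_in s x.
by move=> /val_inj ji; rewrite ji si eqxx in sj.
Qed.

Lemma spush_gt0 m n (f : mono m n) (s : simplex m) (i : 'I_m.+1) (j : 'I_n.+1) :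
  co s i != 0 -> f i = j -> co (spush f s) j != 0.
Proof.
move=> si fi; rewrite co_push (bigD1 i) ?fi //= gt_eqF //.
rewrite ltr_wpDr ?sumr_ge0 //; last by rewrite lt_def si co_ge0.
by move=> l _; exact: co_ge0.
Qed.

Lemma spush_eq0 m n (f : mono m n) (s : simplex m) (j : 'I_n.+1) :
  (forall i, f i <> j) -> co (spush f s) j = 0.
Proof. by move=> h; rewrite co_push big_pred0 // => i; apply/eqP/h. Qed.

End SimplexGeometry.

(** * The homotopy extension property *)

Record bmap (A B : bset) := Bmap {
  bm :> forall d, A d -> B d;
  bm_act : forall d d' (h : hom d' d) (a : A d), bm (bact h a) = bact h (bm a);
  bm_mk : forall d (a : A d), bmk (bm a) <-> bmk a }.
Arguments bm {A B} b {d}.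

Lemma cidf (T : topologicalType) : continuous (fun x : T => x).
Proof. by move=> x; exact: cvg_id. Qed.

Lemma breal_lift1 (B : bset) (Y : topologicalType) (F : forall d, B d -> pt d -> Y) :
  (forall d (b : B d), continuous (F d b)) ->
  (forall d d' (h : hom d' d) (b : B d) p, F d' (bact h b) p = F d b (push h p)) ->
  exists G : breal B -> Y, continuous G /\ forall d (b : B d) p, G (cls b p) = F d b p.
Proof.
move=> cF FE.
have [||G [cG GE]] := @breal_lift B R Y (fun d b u => F d b u.1) (@locally_compactR R) (@Rhausdorff R).
- by move=> d b; apply: continuous_compf; [exact: cF|exact: continuous_fst].
- by move=> d d' h b p z /=; exact: FE.
exists (fun x => G (x, 0%R)); split => [|d b p]; last by rewrite GE.
by apply: continuous_compf => //; apply: continuous_pair; [exact: cidf|exact: ccst].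
Qed.

Lemma bmapr_exists (A B : bset) (i : bmap A B) : exists G : breal A -> breal B,
  continuous G /\ forall d (a : A d) p, G (cls a p) = cls (i _ a) p.
Proof.
apply: (@breal_lift1 A _ (fun d a => cls (i d a))) => [d b|d d' h b p].
- exact: cls_continuous.
- by rewrite bm_act cls_act.
Qed.

Definition bmapr (A B : bset) (i : bmap A B) : breal A -> breal B :=
  sval (cid (bmapr_exists i)).

Lemma bmapr_continuous (A B : bset) (i : bmap A B) : continuous (bmapr i).
Proof. by rewrite /bmapr; case: cid => G /= []. Qed.

Lemma bmapr_cls (A B : bset) (i : bmap A B) d (a : A d) p : bmapr i (cls a p) = cls (i _ a) p.
Proof. by rewrite /bmapr; case: cid => G /= []. Qed.

Section HEP.
Local Open Scope ring_scope.
Variables (A B : bset) (i : bmap A B) (Y : topologicalType).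
Hypothesis i_inj : forall d, injective (@bm _ _ i d).
Variables (f : breal B * R -> Y) (g : breal A * (R * R) -> Y).
Hypotheses (cf : continuous f) (cg : continuous g).
Hypothesis fg : forall a z t, t <= 0 -> g (a, (z, t)) = f (bmapr i a, z).

Definition pmin d (p : pt d) : R := Order.min (smin p.1) (smin p.2).
Definition pshrink d (p : pt d) (l : R) : pt d := (sshrink p.1 l, sshrink p.2 l).
Definition psupp d (p : pt d) : hom d d := (ssupp p.1, ssupp p.2).

(** At most the caps 1/(n+2) of both factors, so that [cap] does not interfere with shrinking by
    amounts up to [kap d], and below 1, the value of [smin] on a 0-simplex. *)
Definition kap (d : nat * nat) : R := ((d.1 + d.2).+2%:R)^-1.
Definition tpos (t : R) : R := Order.max t 0.
(** With [pshrink], the functions [lam] and [trem] retract a cell times the half-line onto its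
    bottom and its sides. A point at time [t] is pushed outwards by [lam d t]; if it reaches the
    boundary before that, [trem] is the time it has left there. For [m = lam d t] nothing is left,
    so the two cases agree, and for [m = 0] all of [t] is left, so the sides stay fixed. *)
Definition lam d (t : R) : R := kap d * (tpos t / (1 + tpos t)).
Definition trem d (m t : R) : R := tpos t - m * (1 + tpos t) / kap d.

Lemma tpos_ge0 t : 0 <= tpos t. Proof. by rewrite /tpos le_max lexx orbT. Qed.

Lemma tpos1_gt0 t : 0 < 1 + tpos t.
Proof. by rewrite ltr_pwDl ?tpos_ge0. Qed.

Lemma kap_gt0 d : 0 < kap d. Proof. by rewrite invr_gt0 ltr0n. Qed.

Lemma lam_lt d t : lam d t < kap d.
Proof.
rewrite /lam gtr_pMr ?kap_gt0 // ltr_pdivrMr ?tpos1_gt0 // mul1r.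
by rewrite ltrDr.
Qed.

Lemma lam0 d t : t <= 0 -> lam d t = 0.
Proof. by move=> t0; rewrite /lam /tpos max_r // mul0r mulr0. Qed.

Lemma lam_gt0 d t : 0 < t -> 0 < lam d t.
Proof.
by move=> t0; rewrite mulr_gt0 ?kap_gt0 // divr_gt0 ?tpos1_gt0 // /tpos lt_max t0.
Qed.

Lemma kap_le1 d : kap d <= d.1.+2%:R^-1.
Proof. by rewrite lef_pV2 ?posrE ?ltr0n // ler_nat; lia. Qed.

Lemma kap_le2 d : kap d <= d.2.+2%:R^-1.
Proof. by rewrite lef_pV2 ?posrE ?ltr0n // ler_nat; lia. Qed.

Lemma kap_lt1 d : kap d < 1.
Proof. by rewrite invf_lt1 ?ltr0n // ltr1n. Qed.

Lemma trem_lam d t : trem d (lam d t) t = 0.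
Proof.
rewrite /trem /lam; have := gt_eqF (tpos1_gt0 t); have := gt_eqF (kap_gt0 d).
move=> /negbT k0 /negbT t0; field.
by rewrite k0 t0.
Qed.

Lemma trem0 d t : 0 <= t -> trem d 0 t = t.
Proof. by move=> t0; rewrite /trem !mul0r subr0 /tpos max_l. Qed.

Lemma lam_continuous (T : topologicalType) d (t : T -> R) :
  continuous t -> continuous (fun x => lam d (t x)).
Proof.
move=> ct; have cp : continuous (fun x => tpos (t x)) by apply: cmax => //; exact: ccst.
apply: cM; first exact: ccst.
apply: cM => //; apply: cV; first by move=> x; rewrite gt_eqF // tpos1_gt0.
by apply: cD => //; exact: ccst.
Qed.

Lemma trem_continuous (T : topologicalType) d (m t : T -> R) :
  continuous m -> continuous t -> continuous (fun x => trem d (m x) (t x)).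
Proof.
move=> cm ct; have cp : continuous (fun x => tpos (t x)) by apply: cmax => //; exact: ccst.
apply: cB => //; apply: cM; last exact: ccst.
by apply: cM => //; apply: cD => //; exact: ccst.
Qed.

Lemma pmin_continuous d : continuous (@pmin d).
Proof.
by apply: cmin; apply: continuous_compf (@smin_continuous _) _;
  [exact: continuous_fst|exact: continuous_snd].
Qed.

Lemma pshrink_continuous (T : topologicalType) d (p : T -> pt d) (l : T -> R) :
  continuous p -> continuous l -> continuous (fun x => pshrink (p x) (l x)).
Proof.
move=> cp cl; apply: continuous_pair; apply: sshrink_continuous => //.
- by apply: continuous_compf => //; exact: continuous_fst.
- by apply: continuous_compf => //; exact: continuous_snd.
Qed.

Lemma pshrink0 d (p : pt d) : pshrink p 0 = p.
Proof. by rewrite /pshrink !sshrink0 -surjective_pairing. Qed.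

Definition pfix d (e : hom d d) (p : pt d) :=
  (forall j, co p.1 j != 0 -> e.1 j = j) /\ (forall j, co p.2 j != 0 -> e.2 j = j).

Lemma push_fix d (e : hom d d) (p : pt d) : pfix e p -> push e p = p.
Proof. by move=> [h1 h2]; rewrite /push !spush_fix -?surjective_pairing. Qed.

Lemma psupp_fix d (p : pt d) : pfix (psupp p) p.
Proof. by split => j; apply: ssupp_fix. Qed.

Lemma hc_psupp d (e : hom d d) (p : pt d) : pfix e p -> hc e (psupp p) = psupp p.
Proof.
move=> [h1 h2]; rewrite /hc /psupp /=; congr pair; rewrite -[RHS]mcomp_idl;
  apply: mcomp_ssupp => j nz; rewrite ?h1 ?h2 //=; apply/esym/minn_idPl; by rewrite -ltnS.
Qed.

Definition pbdry d (p : pt d) := (exists j, co p.1 j = 0) \/ (exists j, co p.2 j = 0).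

Lemma psupp_not_surj d (p : pt d) : pbdry p -> ~ hsurj (psupp p).
Proof. by case=> -[j /ssupp_not_surj h] []. Qed.

Lemma pmin_bdry d (p : pt d) : pbdry p -> pmin p = 0.
Proof.
move=> h; apply/eqP; rewrite eq_le le_min !smin_ge0 !andbT ge_min.
by case: h => -[j <-]; rewrite smin_le ?orbT.
Qed.

Lemma pmin_ge0 d (p : pt d) : 0 <= pmin p.
Proof. by rewrite le_min !smin_ge0. Qed.

Lemma pmin_attained d (p : pt d) : pmin p < 1 ->
  (exists2 j, pmin p = co p.1 j & 0 < d.1)%N \/ (exists2 j, pmin p = co p.2 j & 0 < d.2)%N.
Proof.
have dim n (s : simplex n) j : co s j < 1 -> (0 < n)%N.
  case: n s j => // s j; rewrite -(co_sum s) big_ord1 (ord1 j).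
  by rewrite (_ : 0 = ord0) ?ltxx.
rewrite /pmin minElt; case: ifP => [_ lt|_ lt]; [left|right].
  by have [E|[j E]] := smin_attained p.1; [rewrite E ltxx in lt|exists j => //; apply: (dim _ p.1 j); rewrite -E].
by have [E|[j E]] := smin_attained p.2; [rewrite E ltxx in lt|exists j => //; apply: (dim _ p.2 j); rewrite -E].
Qed.

Lemma pshrink_bdry d (p : pt d) l : pmin p <= l -> l <= kap d -> pmin p < 1 -> pbdry (pshrink p (pmin p)).
Proof.
move=> ml lk /pmin_attained[] [j E _]; [left|right]; exists j;
  apply: sshrink_eq0; rewrite -?E //; apply: (le_trans ml); apply: (le_trans lk).
- exact: kap_le1.
- exact: kap_le2.
Qed.

Lemma pbdry_push d' d (h : hom d' d) (p : pt d') : ~ hsurj h -> pbdry (push h p).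
Proof.
move=> /not_andP[] /not_msurj[j]; rewrite -ltnS => jn nj; [left|right];
  by exists (Ordinal jn); apply: spush_eq0.
Qed.

Let rt_ex d (b : B d) : exists e : {d' & (B d' * hom d d')%type},
  [/\ nondeg (projT2 e).1, hsurj (projT2 e).2 & b = bact (projT2 e).2 (projT2 e).1].
Proof. by have [d' [r [h H]]] := root_exists b; exists (existT _ d' (r, h)). Qed.

Definition rt d (b : B d) := sval (cid (rt_ex b)).
Definition rd d (b : B d) : nat * nat := projT1 (rt b).
Definition rr d (b : B d) : B (rd b) := (projT2 (rt b)).1.
Definition rhm d (b : B d) : hom d (rd b) := (projT2 (rt b)).2.
Definition rdim d (b : B d) : nat := ((rd b).1 + (rd b).2)%N.

Lemma rtP d (b : B d) : [/\ nondeg (rr b), hsurj (rhm b) & b = bact (rhm b) (rr b)].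
Proof. by rewrite /rr /rhm /rd /rt; case: cid => [[d' [r h]]]. Qed.

Lemma rt_unique d (b : B d) d' (r : B d') (h : hom d d') :
  nondeg r -> hsurj h -> b = bact h r -> rt b = existT _ d' (r, h).
Proof.
move=> nr sh bE; have [nr' sh' bE'] := rtP b.
have := root_unique nr' nr sh' sh; rewrite -bE -bE' => /(_ erefl) <-.
by rewrite /rr /rhm /rd; case: (rt b) => ? [].
Qed.

Lemma rdim_le d (b : B d) : (rdim b <= d.1 + d.2)%N.
Proof. by have [_ [/msurj_le h1 /msurj_le h2] _] := rtP b; rewrite /rdim; lia. Qed.

Lemma rdim_act d d' (h : hom d' d) (b : B d) : (rdim (bact h b) <= rdim b)%N.
Proof.
have [nr sh E] := rtP (bact h b); have [nr2 sh2 E2] := rtP b.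
have [s [sE _ _]] := hsection sh (leq0n _) (leq0n _).
have E3 : rr (bact h b) = bact (hc (rhm b) (hc h s)) (rr b).
  rewrite -bact_comp -E2 -bact_comp.
  by have := congr1 (bact s) E; rewrite [X in _ = X -> _]bact_comp sE bact_id => <-.
by have := nr _ _ _ E3; rewrite /rdim; lia.
Qed.

Lemma rdim_lt d d' (r : B d) (h : hom d' d) : ~ hsurj h ->
  (rdim (bact h r) < d.1 + d.2)%N.
Proof.
move=> /not_hsurj_factor[e [k [k' [hE _ _ lt]]]].
rewrite hE -bact_comp; apply: leq_ltn_trans (rdim_act _ _) _.
exact: leq_ltn_trans (rdim_le _) lt.
Qed.

Definition fam := forall d, B d -> pt d * (R * R) -> Y.

(** On the cell of a nondegenerate [r] the extension is composed with the retraction: the bottom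
    carries [f], and a side carries what is already built on the face through the retracted point,
    named by [psupp]. Cells of [A] carry [g]. *)
Definition body (G : fam) e (r : B e) (q : pt e) (w : R * R) : Y :=
  match pselect (exists a : A e, i _ a = r) with
  | left Ha => g (cls (sval (cid Ha)) q, w)
  | right _ =>
    if lam e w.2 <= pmin q then f (cls r (pshrink q (lam e w.2)), w.1)
    else G e (bact (psupp (pshrink q (pmin q))) r)
           (pshrink q (pmin q), (w.1, trem e (pmin q) w.2))
  end.

Definition step (G : fam) : fam := fun d b u => body G (rr b) (push (rhm b) u.1) u.2.

(** Fuel for a recursion on the dimension of the root: the value at [b] no longer depends on [N]
    once [rdim b < N]. *)
Definition Gn (N : nat) : fam := iter N step (fun d b u => f (cls b u.1, u.2.1)).

Lemma body_ext (G G' : fam) e (r : B e) q w :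
  (forall d (b : B d), (rdim b < e.1 + e.2)%N -> G d b = G' d b) ->
  body G r q w = body G' r q w.
Proof.
move=> GG'; rewrite /body; case: pselect => // _; case: ifP => // /negbT.
rewrite -ltNge => lt; rewrite GG' //; apply: rdim_lt; apply: psupp_not_surj.
have lk := ltW (lam_lt e w.2).
by apply: (pshrink_bdry (ltW lt) lk); apply: lt_trans lt _; apply: lt_trans (lam_lt _ _) (kap_lt1 _).
Qed.

Lemma Gn_stable N d (b : B d) : (rdim b < N)%N -> Gn N.+1 b = Gn N b.
Proof.
elim: N d b => // N IH d b lt; apply/funext => u.
by rewrite [LHS]/Gn iterS [RHS]/Gn iterS /step; apply: body_ext => d' b' lt'; apply: IH; move: lt lt'; rewrite /rdim; lia.
Qed.

Definition GG : fam := fun d b u => Gn (rdim b).+1 b u.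

Lemma GGE d (b : B d) p w : GG b (p, w) = body GG (rr b) (push (rhm b) p) w.
Proof.
rewrite {1}/GG /Gn iterS /step /=; apply: body_ext => d' b' lt; apply/funext => u.
rewrite /GG -/(Gn _); have {lt} : ((rdim b').+1 <= rdim b)%N by [].
move: (rdim b) => N; elim: N => // N IH; rewrite leq_eqVlt => /orP[/eqP -> //|lt].
by rewrite Gn_stable // IH.
Qed.

Lemma GG_root d (b : B d) d' (r : B d') (h : hom d d') p w :
  nondeg r -> hsurj h -> b = bact h r -> GG b (p, w) = body GG r (push h p) w.
Proof.
move=> nr sh bE; rewrite GGE; have := rt_unique nr sh bE.
by rewrite /rr /rhm /rd => ->.
Qed.

Lemma GG_A d (a : A d) p w : GG (i _ a) (p, w) = g (cls a p, w).
Proof.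
rewrite GGE /body; have [nr sh E] := rtP (i _ a); have [s [sE _ _]] := hsection sh (leq0n _) (leq0n _).
case: pselect => [Ha|[]]; last first.
  exists (bact s a); rewrite bm_act.
  by have := congr1 (bact s) E; rewrite [X in _ = X -> _]bact_comp sE bact_id => <-.
case: cid => a' /= a'E; rewrite -cls_act; congr (g (cls _ _, _)).
by apply: i_inj; rewrite bm_act a'E -E.
Qed.

Lemma GG_init d (b : B d) p z t : t <= 0 -> GG b (p, (z, t)) = f (cls b p, z).
Proof.
move=> t0; rewrite GGE /body /=; have [nr sh E] := rtP b.
case: pselect => [Ha|_].
  by case: cid => a' /= a'E; rewrite fg // bmapr_cls a'E -cls_act -E.
by rewrite lam0 // pmin_ge0 pshrink0 -cls_act -E.
Qed.

(** If the root operator of [b] composed with [h] is still surjective, both sides have the same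
    root. Otherwise the pushed point lies on the boundary of the root cell; there [pmin] is 0, the
    retraction is the identity, and both sides are values on proper faces, to which the induction
    hypothesis applies. *)
Lemma GG_act N d (b : B d) : (rdim b < N)%N ->
  forall d' (h : hom d' d) p w, GG (bact h b) (p, w) = GG b (push h p, w).
Proof.
elim: N d b => // N IH d b lt d' h p w.
have [nr sh E] := rtP b; set r := rr b in nr E *; set eta := rhm b in sh E *.
have hbE : bact h b = bact (hc eta h) r by rewrite -bact_comp -E.
rewrite (GG_root _ _ nr sh E) push_comp.
have [sk|nsk] := pselect (hsurj (hc eta h)); first by rewrite (GG_root _ _ nr sk hbE).
rewrite hbE; set k := hc eta h in nsk *.
have rlt e (l : hom e (rd b)) : ~ hsurj l -> (rdim (bact l r) < N)%N.
  by move=> /(rdim_lt r) lt'; apply: leq_trans lt' _; move: lt; rewrite /rdim; lia.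
rewrite /body; case: pselect => [Ha|_].
  by case: cid => a /= aE; rewrite -aE -bm_act GG_A cls_act.
have bq := pbdry_push p nsk; rewrite (pmin_bdry bq) pshrink0.
case: w => z t /=; have [t0|t0] := leP t 0.
  by rewrite lam0 // lexx pshrink0 GG_init // cls_act.
rewrite leNgt lam_gt0 //= trem0 ?(ltW t0) //.
set q := push k p in bq *.
have ns : ~ hsurj (psupp q) := psupp_not_surj bq.
have nsq : ~ hsurj (hc (psupp q) k).
  move=> [s1 s2]; apply: ns; split => j jn.
    by have [x xm <-] := s1 j jn; exists (k.1 x) => //; exact: mf_le.
  by have [x xm <-] := s2 j jn; exists (k.2 x) => //; exact: mf_le.
(* Precomposing with [psupp p] leaves the value alone and reduces the comparison of operators to the
   vertices in the support of [p]. *)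
have sE e (l : hom d' e) (x : B e) : (rdim (bact l x) < N)%N ->
    GG (bact l x) (p, (z, t)) = GG (bact (hc l (psupp p)) x) (p, (z, t)).
  by move=> lt'; rewrite -bact_comp (IH _ _ lt') (push_fix (psupp_fix p)).
rewrite (sE _ _ _ (rlt _ _ nsk)) /q -(IH _ _ (rlt _ _ ns)) bact_comp.
rewrite (sE _ _ _ (rlt _ _ nsq)).
congr (GG (bact _ _) _); rewrite /hc /=; congr pair; apply: mcomp_ssupp => j nz /=.
  apply/esym; have kj : (k.1 j < (rd b).1.+1)%N by rewrite ltnS mf_le.
  exact: (ssupp_fix (i := Ordinal kj) (spush_gt0 (f := k.1) (j := Ordinal kj) nz erefl)).
apply/esym; have kj : (k.2 j < (rd b).2.+1)%N by rewrite ltnS mf_le.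
exact: (ssupp_fix (i := Ordinal kj) (spush_gt0 (f := k.2) (j := Ordinal kj) nz erefl)).
Qed.

Lemma GG_compat d d' (h : hom d' d) (b : B d) p w : GG (bact h b) (p, w) = GG b (push h p, w).
Proof. exact: (GG_act (ltnSn (rdim b))). Qed.

(** The face carrying a point jumps as the point moves. Continuity needs one operator for a whole
    region, and any that fixes the support will do. *)
Lemma GG_fix e (r : B e) (x : hom e e) q w : pfix x q ->
  GG (bact x r) (q, w) = GG (bact (psupp q) r) (q, w).
Proof.
move=> fx; rewrite -{1}(push_fix (psupp_fix q)) -GG_compat bact_comp.
by rewrite hc_psupp.
Qed.

Definition mdrop n j : mono n n := mcomp (mskip n j) (munskip n j).

Lemma mdrop_fix n (j x : nat) : (j <= n)%N -> (x <= n)%N -> x <> j -> mdrop n j x = x.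
Proof. exact: mskipK. Qed.

Lemma mdrop_not_surj n j : (0 < n)%N -> (j <= n)%N -> ~ msurj (mdrop n j).
Proof. by move=> n0 jn /(_ j jn)[x _]; apply: mskip_neq. Qed.

Lemma GG_continuous d (b : B d) : continuous (GG b).
Proof.
have [N] := ubnP (rdim b); elim: N d b => // N IH d b lt.
suff cb : continuous (fun u : pt (rd b) * (R * R) => body GG (rr b) u.1 u.2).
  rewrite (_ : GG b = (fun u => body GG (rr b) u.1 u.2) \o (fun u => (push (rhm b) u.1, u.2))).
    apply: (continuous_compf cb); apply: continuous_pair; last exact: continuous_snd.
    by apply: (continuous_compf (@push_continuous _ _ _)); exact: continuous_fst.
  by apply/funext => -[p w]; rewrite GGE.
move: (rr b) lt; rewrite /rdim; move: (rd b) => e r lt.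
rewrite /body; case: pselect => [Ha|_].
  apply: (continuous_compf cg); apply: continuous_pair; last exact: continuous_snd.
  by apply: (continuous_compf (@cls_continuous _ _ _)); exact: continuous_fst.
have cq : continuous (fun u : pt e * (R * R) => u.1) by exact: continuous_fst.
have cw : continuous (fun u : pt e * (R * R) => u.2) by exact: continuous_snd.
have cw1 : continuous (fun u : pt e * (R * R) => u.2.1).
  by apply: (continuous_compf _ cw); exact: continuous_fst.
have cw2 : continuous (fun u : pt e * (R * R) => u.2.2).
  by apply: (continuous_compf _ cw); exact: continuous_snd.
have cl : continuous (fun u : pt e * (R * R) => lam e u.2.2) by exact: lam_continuous.
have cm : continuous (fun u : pt e * (R * R) => pmin u.1).
  exact: (continuous_compf (@pmin_continuous e) cq).
have cc1 j : continuous (fun u : pt e * (R * R) => co u.1.1 j).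
  apply: (continuous_compf (@co_continuous _ j)).
  by apply: (continuous_compf _ cq); exact: continuous_fst.
have cc2 j : continuous (fun u : pt e * (R * R) => co u.1.2 j).
  apply: (continuous_compf (@co_continuous _ j)).
  by apply: (continuous_compf _ cq); exact: continuous_snd.
pose F0 (u : pt e * (R * R)) := f (cls r (pshrink u.1 (lam e u.2.2)), u.2.1).
have cF0 : continuous F0.
  apply: (continuous_compf cf); apply: continuous_pair => //.
  by apply: (continuous_compf (@cls_continuous _ _ _)); exact: pshrink_continuous.
pose F1 (x : hom e e) (u : pt e * (R * R)) :=
  GG (bact x r) (pshrink u.1 (pmin u.1), (u.2.1, trem e (pmin u.1) u.2.2)).
have cF1 x : ~ hsurj x -> continuous (F1 x).
  move=> nx; have lt' : (rdim (bact x r) < N)%N.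
    by apply: leq_trans (rdim_lt r nx) _; lia.
  apply: (continuous_compf (IH _ _ lt')); apply: continuous_pair.
    exact: pshrink_continuous.
  by apply: continuous_pair => //; exact: trem_continuous.
have F1E x u : pmin u.1 <= lam e u.2.2 -> pfix x (pshrink u.1 (pmin u.1)) ->
    (if lam e u.2.2 <= pmin u.1 then F0 u else F1 (psupp (pshrink u.1 (pmin u.1))) u) = F1 x u.
  move=> le fx; case: ifP => [ge|_]; last by rewrite /F1 (GG_fix _ _ fx).
  have eml : pmin u.1 = lam e u.2.2 by apply/eqP; rewrite eq_le le ge.
  by rewrite /F1 eml trem_lam GG_init // cls_act push_fix // -eml.
(* Where the coordinate [j] is minimal and at most [lam], the shrunk point has no mass at [j], so
   dropping the vertex [j] is an operator to which [GG_fix] applies on that whole closed set. *)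
pose ex (j : 'I_e.1.+1 + 'I_e.2.+1) : hom e e :=
  match j with inl j => (mdrop e.1 j, mid e.2) | inr j => (mid e.1, mdrop e.2 j) end.
pose cx (j : 'I_e.1.+1 + 'I_e.2.+1) (u : pt e * (R * R)) : R :=
  match j with inl j => co u.1.1 j | inr j => co u.1.2 j end.
have ccx j : continuous (cx j) by case: j => j; [exact: cc1|exact: cc2].
have kl (u : pt e * (R * R)) : lam e u.2.2 < 1 by exact: lt_trans (lam_lt e u.2.2) (kap_lt1 e).
have exf j u : cx j u <= pmin u.1 -> pmin u.1 <= lam e u.2.2 -> pfix (ex j) (pshrink u.1 (pmin u.1)).
  have lk := ltW (lam_lt e u.2.2).
  case: j => j /= jm ml; split => x /= nz; try by apply/minn_idPl; rewrite -ltnS.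
    apply: mdrop_fix (leq_ord j) (leq_ord x) _ => /val_inj E; rewrite E in nz.
    by move: nz; rewrite sshrink_eq0 ?eqxx //; apply: (le_trans ml); apply: (le_trans lk); exact: kap_le1.
  apply: mdrop_fix (leq_ord j) (leq_ord x) _ => /val_inj E; rewrite E in nz.
  by move: nz; rewrite sshrink_eq0 ?eqxx //; apply: (le_trans ml); apply: (le_trans lk); exact: kap_le2.
(* In a factor of dimension 0 dropping the only vertex is the identity, and no smaller face is
   reached; such an index gets the empty set in the cover. *)
have exs j : hsurj (ex j) \/ ~ hsurj (ex j) by exact: EM.
apply: (@continuous_cover _ _ (option ('I_e.1.+1 + 'I_e.2.+1)%type)
  (fun o => match o with
     | None => [set u : pt e * (R * R) | lam e u.2.2 <= pmin u.1]
     | Some j => [set u : pt e * (R * R) | cx j u <= pmin u.1 /\ pmin u.1 <= lam e u.2.2 /\ ~ hsurj (ex j)] end)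
  (fun o => match o with
     | None => F0 | Some j => if `[< hsurj (ex j) >] then F0 else F1 (ex j) end)).
- case=> [j|]; last exact: closed_lef.
  have [sj|nj] := exs j.
    rewrite (_ : mkset _ = set0); first exact: closed0.
    by apply/seteqP; split => u // -[_ [_ /(_ sj)]].
  rewrite (_ : mkset _ = [set u | cx j u <= pmin u.1] `&` [set u | pmin u.1 <= lam e u.2.2]).
    by apply: closedI; apply: closed_lef.
  by apply/seteqP; split => u /=; [move=> [? [? _]]|move=> [? ?]].
- move=> u; have [le|lt'] := leP (lam e u.2.2) (pmin u.1); first by exists None.
  have [[j E n0]|[j E n0]] := pmin_attained (lt_trans lt' (kl u)).
    exists (Some (inl j)) => /=; rewrite E lexx -E ltW //; split => //; split => // -[+ _].
    by apply: mdrop_not_surj => //; rewrite -ltnS.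
  exists (Some (inr j)) => /=; rewrite E lexx -E ltW //; split => //; split => // -[_].
  by apply: mdrop_not_surj => //; rewrite -ltnS.
- case=> [j|] u /= => [[h1 [h2 h3]]|->] //.
  by rewrite asboolF // -F1E //; exact: exf.
- case=> [j|] //; case: asboolP => // nj; exact: cF1.
Qed.

(** Every branch of the recursion ends in [f] or [g] on an element obtained from [b] by operators.
    [compress] uses this with [K] the marked elements, and at [z = 1] with [K] everything. *)
Lemma GG_support (K : forall d, B d -> Prop) (Y0 : set Y) (z : R) :
  (forall d d' (h : hom d' d) b, K d b -> K d' (bact h b)) ->
  (forall d (b : B d) p, K d b -> Y0 (f (cls b p, z))) ->
  (forall d (a : A d) p t, K d (i _ a) -> Y0 (g (cls a p, (z, t)))) ->
  forall d (b : B d) p t, K d b -> Y0 (GG b (p, (z, t))).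
Proof.
move=> Kact Kf Kg d b; have [N] := ubnP (rdim b); elim: N d b => // N IH d b lt p t Kb.
rewrite GGE; have [nr sh E] := rtP b; have [s [sE _ _]] := hsection sh (leq0n _) (leq0n _).
have Kr : K _ (rr b).
  by have := Kact _ _ s _ Kb; have := congr1 (bact s) E; rewrite [X in _ = X -> _]bact_comp sE bact_id => <-.
rewrite /body; case: pselect => [Ha|_]; first by case: cid => a /= aE; apply: Kg; rewrite aE.
case: ifP => [_|/negbT]; first exact: Kf.
rewrite -ltNge /= => lt'; apply: IH; last exact: Kact.
apply: (@leq_trans (rdim b)); last by move: lt; lia.
apply: rdim_lt; apply: psupp_not_surj; apply: (pshrink_bdry (ltW lt') (ltW (lam_lt _ _))).
exact: lt_trans lt' (lt_trans (lam_lt _ _) (kap_lt1 _)).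
Qed.

(** The homotopy time is [t], while [z] is carried along unchanged: a whole family of homotopies is
    extended at once. The start is prescribed for all [t <= 0], which keeps the parameter space a
    plane. *)
Lemma hep : exists G : breal B * (R * R) -> Y,
  [/\ continuous G,
    forall x z t, t <= 0 -> G (x, (z, t)) = f (x, z),
    forall a z t, G (bmapr i a, (z, t)) = g (a, (z, t))
  & forall (K : forall d, B d -> Prop) (Y0 : set Y) (z : R),
      (forall d d' (h : hom d' d) b, K d b -> K d' (bact h b)) ->
      (forall d (b : B d) p, K d b -> Y0 (f (cls b p, z))) ->
      (forall d (a : A d) p t, K d (i _ a) -> Y0 (g (cls a p, (z, t)))) ->
      forall d (b : B d) p t, K d b -> Y0 (G (cls b p, (z, t)))].
Proof.
have [||G [cG GE]] := @breal_lift B (R * R)%type Y GG locally_compactR2 hausdorffR2.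
- exact: GG_continuous.
- by move=> *; exact: GG_compat.
exists G; split => //.
- by move=> x z t t0; have [d [b [p ->]]] := cls_surj x; rewrite GE GG_init.
- by move=> a z t; have [d [b [p ->]]] := cls_surj a; rewrite bmapr_cls GE GG_A.
- by move=> K Y0 z h1 h2 h3 d b p t Kb; rewrite GE; exact: (GG_support h1 h2 h3).
Qed.

End HEP.

(** * Gluing deformations *)

Section Deformations.
Local Open Scope ring_scope.

Definition inV (B : bset) : set (breal B) :=
  [set x | exists d (b : B d) p, bmk b /\ x = cls b p].
Arguments inV : clear implicits.

Lemma inV_bmapr (A B : bset) (i : bmap A B) x : inV A x -> inV B (bmapr i x).
Proof.
move=> [d [b [p [mb ->]]]]; rewrite bmapr_cls; exists d, (i _ b), p; split => //.
exact/bm_mk.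
Qed.

(** The end time is part of the data because gluing prolongs a deformation past the time at which
    the old part has come to rest. *)
Definition good (B : bset) (T : R) (H : breal B * R -> breal B) : Prop :=
  [/\ 0 <= T /\ continuous H,
      forall x t, t <= 0 -> H (x, t) = x,
      forall x t, T <= t -> H (x, t) = H (x, T),
      forall x, inV B (H (x, T))
    & forall x t, inV B x -> inV B (H (x, t))].

Definition clamp (t : R) : R := Order.max 0 (Order.min t 1).

Lemma clamp0 t : t <= 0 -> clamp t = 0.
Proof. by move=> t0; rewrite /clamp min_l ?max_l //; lra. Qed.

Lemma clamp1 t : 1 <= t -> clamp t = 1.
Proof. by move=> t1; rewrite /clamp min_r // max_r. Qed.

Lemma clamp_continuous (T : topologicalType) (f : T -> R) :
  continuous f -> continuous (fun x => clamp (f x)).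
Proof. by move=> cf; apply: cmax; [exact: ccst|apply: cmin => //; exact: ccst]. Qed.

Section Pair.
Variables (A B : bset) (i : bmap A B) (Y : topologicalType) (V : set Y).
Hypothesis i_inj : forall d, injective (@bm _ _ i d).

Lemma extend (f : breal B -> Y) (g : breal A * R -> Y) :
  continuous f -> continuous g -> (forall a t, t <= 0 -> g (a, t) = f (bmapr i a)) ->
  (forall x, inV B x -> V (f x)) -> (forall a t, inV A a -> V (g (a, t))) ->
  exists E : breal B * R -> Y,
  [/\ continuous E, forall x t, t <= 0 -> E (x, t) = f x,
      forall a t, E (bmapr i a, t) = g (a, t)
    & forall x t, inV B x -> V (E (x, t))].
Proof.
move=> cf cg fg Vf Vg.
have [|||G [cG G0 GA GV]] := @hep A B i Y i_inj (fun u => f u.1) (fun u => g (u.1, u.2.2)).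
- by apply: (continuous_compf cf); exact: continuous_fst.
- apply: (continuous_compf cg); apply: continuous_pair; first exact: continuous_fst.
  by apply: (continuous_compf (@continuous_snd _ _)); exact: continuous_snd.
- by move=> a z t /= /fg.
exists (fun u => G (u.1, (0, u.2))); split.
- apply: (continuous_compf cG); apply: continuous_pair; first exact: continuous_fst.
  by apply: continuous_pair; [exact: ccst|exact: continuous_snd].
- by move=> x t t0 /=; rewrite G0.
- by move=> a t /=; rewrite GA.
- move=> x t [d [b [p [mb ->]]]] /=; apply: (GV (@bmk B)) => //.
  + exact: bmk_act.
  + by move=> d' b' p' mb'; apply: Vf; exists d', b', p'.
  + by move=> d' a p' t' /bm_mk ma; apply: Vg; exists d', a, p'.
Qed.

(* A homotopy [k] into [V] which moves [A] only inside [V] can be replaced by one that is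
   stationary on [A]: drag [k_z] back along the track of [A], then follow the boundary of
   the square of the two parameters. *)
Lemma compress (k : breal B * R -> Y) :
  continuous k -> (forall x t, t <= 0 -> k (x, t) = k (x, 0)) ->
  (forall x t, 1 <= t -> V (k (x, t))) -> (forall a t, V (k (bmapr i a, t))) ->
  (forall x t, inV B x -> V (k (x, t))) ->
  exists J : breal B * R -> Y,
  [/\ continuous J /\ (forall x t, t <= 0 -> J (x, t) = k (x, 0)),
      forall x t, 1 <= t -> J (x, t) = J (x, 1),
      forall x, V (J (x, 1)), forall a t, J (bmapr i a, t) = k (bmapr i a, 0)
    & forall x t, inV B x -> V (J (x, t))].
Proof.
move=> ck k0 k1 kA kV.
have [|||G [cG G0 GA GV]] := @hep A B i Y i_inj k
  (fun u => k (bmapr i u.1, u.2.1 * (1 - clamp u.2.2))).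
- by [].
- apply: (continuous_compf ck); apply: continuous_pair.
    by apply: (continuous_compf (@bmapr_continuous _ _ i)); exact: continuous_fst.
  apply: cM; first by apply: (continuous_compf (@continuous_fst _ _)); exact: continuous_snd.
  apply: cB; first exact: ccst.
  by apply: clamp_continuous; apply: (continuous_compf (@continuous_snd _ _)); exact: continuous_snd.
- by move=> a z t t0 /=; rewrite clamp0 // subr0 mulr1.
exists (fun u => G (u.1, (clamp (2 * u.2 - 1), clamp (2 * u.2)))); split.
- split.
    apply: (continuous_compf cG); apply: continuous_pair; first exact: continuous_fst.
    apply: continuous_pair; apply: clamp_continuous.
      apply: cB; last exact: ccst.
      by apply: cM; [exact: ccst|exact: continuous_snd].
    by apply: cM; [exact: ccst|exact: continuous_snd].
  by move=> x t t0 /=; rewrite !clamp0 ?G0 //; lra.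
- by move=> x t t1 /=; rewrite !clamp1 //; lra.
(* At the end [z = 1], where both [k] and the prescription on [A] take all their values in [V];
   hence the trivial predicate. *)
- move=> x /=; have [d [b [p ->]]] := cls_surj x; rewrite !clamp1; try lra.
  by apply: (GV (fun _ _ => True)) => // d' b' p' _; exact: k1.
- move=> a t; rewrite GA /=.
  have [t2|t2] := leP t (1/2).
    have h : 2 * t - 1 <= 0 by lra.
    by rewrite (clamp0 h) mul0r.
  have h : 1 <= 2 * t by lra.
  by rewrite (clamp1 h) (clamp1 (lexx 1)) subrr mulr0.
- move=> x t [d [b [p [mb ->]]]] /=; apply: (GV (@bmk B)) => //.
  + exact: bmk_act.
  + by move=> d' b' p' mb'; apply: kV; exists d', b', p'.
Qed.

End Pair.

Section Pushout.
Variables (K1 K A B : bset) (i1 : bmap K1 K) (i : bmap A B) (phi : bmap B K) (phiA : bmap A K1).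
Hypotheses (i_inj : forall d, injective (@bm _ _ i d)) (i1_inj : forall d, injective (@bm _ _ i1 d)).
Hypothesis comm : forall d (a : A d), phi _ (i _ a) = i1 _ (phiA _ a).
Hypothesis cover : forall d (k : K d), (exists k1, k = i1 _ k1) \/ (exists b, k = phi _ b).
Hypothesis meet : forall d (b : B d) k1, phi _ b = i1 _ k1 -> exists a, b = i _ a.
Hypothesis off : forall d (b b' : B d), phi _ b = phi _ b' -> b = b' \/ exists a, b = i _ a.

Lemma bmapr_comm a : bmapr phi (bmapr i a) = bmapr i1 (bmapr phiA a).
Proof. by have [d [b [p ->]]] := cls_surj a; rewrite !bmapr_cls comm. Qed.

Lemma breal_cover x : (exists y, x = bmapr i1 y) \/ (exists y, x = bmapr phi y).
Proof.
have [d [k [p ->]]] := cls_surj x; have [[k1 ->]|[b ->]] := cover k; [left|right].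
- by exists (cls k1 p); rewrite bmapr_cls.
- by exists (cls b p); rewrite bmapr_cls.
Qed.

Lemma breal_coverV x : inV K x ->
  (exists2 y, inV K1 y & x = bmapr i1 y) \/ (exists2 y, inV B y & x = bmapr phi y).
Proof.
move=> [d [k [p [mk ->]]]]; have [[k1 E]|[b E]] := cover k; [left|right]; rewrite E in mk *.
- by exists (cls k1 p); [exists d, k1, p; split => //; exact/(bm_mk i1)|rewrite bmapr_cls].
- by exists (cls b p); [exists d, b, p; split => //; exact/(bm_mk phi)|rewrite bmapr_cls].
Qed.

(** Every cell lies in [K1] or comes from [B]. By [meet] and [off] the ambiguities all come from
    [A], where the two prescriptions agree. *)
Lemma breal_glue (Y : topologicalType) (f1 : breal K1 * R -> Y) (f2 : breal B * R -> Y) :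
  continuous f1 -> continuous f2 ->
  (forall a z, f1 (bmapr phiA a, z) = f2 (bmapr i a, z)) ->
  exists F : breal K * R -> Y, [/\ continuous F,
    forall x z, F (bmapr i1 x, z) = f1 (x, z) & forall x z, F (bmapr phi x, z) = f2 (x, z)].
Proof.
move=> c1 c2 f12.
pose F d (k : K d) (u : pt d * R) : Y :=
  match pselect (exists k1, k = i1 _ k1) with
  | left H1 => f1 (cls (sval (cid H1)) u.1, u.2)
  | right H1 => match pselect (exists b, k = phi _ b) with
    | left H2 => f2 (cls (sval (cid H2)) u.1, u.2)
    | right H2 => False_rect Y (or_ind H1 H2 (cover k)) end end.
have F1 d (k1 : K1 d) u : F d (i1 _ k1) u = f1 (cls k1 u.1, u.2).
  rewrite /F; case: pselect => [H1|[]]; last by exists k1.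
  by case: cid => k2 /= /i1_inj ->.
have F2 d (b : B d) u : F d (phi _ b) u = f2 (cls b u.1, u.2).
  rewrite /F; case: pselect => [H1|H1].
    case: cid => k1 /= E; have [a aE] := meet E.
    have := f12 (cls a u.1) u.2; rewrite !bmapr_cls -aE => <-.
    by congr (f1 (cls _ _, _)); apply: i1_inj; rewrite -E aE comm.
  case: pselect => [H2|H2]; last by exfalso; apply: H2; exists b.
  case: cid => b' /= /off[<- //|[a aE]].
  by exfalso; apply: H1; exists (phiA _ a); rewrite aE comm.
have [||G [cG GE]] := @breal_lift K R Y F (@locally_compactR R) (@Rhausdorff R).
- move=> d k; have [[k1 ->]|[b ->]] := cover k.
    rewrite (_ : F d _ = fun u => f1 (cls k1 u.1, u.2)); last by apply/funext => u; rewrite F1.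
    apply: (continuous_compf c1); apply: continuous_pair; last exact: continuous_snd.
    by apply: (continuous_compf (@cls_continuous _ _ _)); exact: continuous_fst.
  rewrite (_ : F d _ = fun u => f2 (cls b u.1, u.2)); last by apply/funext => u; rewrite F2.
  apply: (continuous_compf c2); apply: continuous_pair; last exact: continuous_snd.
  by apply: (continuous_compf (@cls_continuous _ _ _)); exact: continuous_fst.
- move=> d d' h k p z; have [[k1 ->]|[b ->]] := cover k.
    by rewrite -bm_act !F1 cls_act.
  by rewrite -bm_act !F2 cls_act.
exists G; split => // x z; have [d [b [p ->]]] := cls_surj x; rewrite bmapr_cls GE.
- exact: F1.
- exact: F2.
Qed.

Lemma continuous_join (X Y : topologicalType) (T : R) (F J : X * R -> Y) :
  continuous F -> continuous J -> (forall x, F (x, T) = J (x, T)) ->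
  continuous (fun u : X * R => if u.2 <= T then F u else J u).
Proof.
move=> cF cJ FJ.
apply: (@continuous_cover2 _ _ [set u : X * R | u.2 <= T] [set u : X * R | T <= u.2] F J) => //.
- by apply: closed_lef; [exact: continuous_snd|exact: ccst].
- by apply: closed_lef; [exact: ccst|exact: continuous_snd].
- by move=> u; case: (leP u.2 T) => h; [left|right => /=; exact: ltW].
- by move=> u /= ->.
- move=> [x t] /= Tt; case: ifP => // tT.
  by have -> : t = T by apply/eqP; rewrite eq_le Tt tT.
Qed.

(** On [B] the extension of [H1] is followed up to time [T]; the time from [T] to [T'] then brings
    the rest of [B] among the marked points while [A] rests. That second stage comes from a
    deformation [D] of [B] whose effect on [A] stays among marked points after [H1]. Since [DB] may
    push [A] anywhere in [B], it is first combined with [DA] into a [D] that moves [A] along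
    [DA]. *)
Lemma glue_good T T' H1 TA DA TB DB : good (B := K1) T H1 -> good (B := A) TA DA ->
  good (B := B) TB DB -> T < T' ->
  exists H, good (B := K) T' H /\ forall x t, H (bmapr i1 x, t) = bmapr i1 (H1 (x, t)).
Proof.
move=> [[T0 cH1] H10 H1T H1V H1N] [[TA0 cDA] DA0 DAT DAV DAN] [[TB0 cDB] DB0 DBT DBV DBN] TT'.
have [|||||E [cE E0 EA EV]] := @extend A B i (breal B) (inV B) i_inj idfun (fun u => bmapr i (DA u)).
- exact: cidf.
- exact: (continuous_compf (@bmapr_continuous _ _ i) cDA).
- by move=> a t /DA0 ->.
- by [].
- by move=> a t /(DAN _ t) /(inV_bmapr i).
(* At time [TA] the map [E] has brought [A] among the marked points, where [DB] keeps it, so the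
   continuation by [DB] can be made stationary on [A]. *)
have [|||||J0 [[cJ0 J00] J01 J0V J0A J0N]] := @compress A B i (breal B) (inV B) i_inj
    (fun u => DB (E (u.1, TA), TB * u.2)).
- apply: (continuous_compf cDB); apply: continuous_pair.
    by apply: (continuous_compf cE); apply: continuous_pair; [exact: continuous_fst|exact: ccst].
  by apply: cM; [exact: ccst|exact: continuous_snd].
- by move=> x t t0 /=; rewrite !DB0 ?mulr0 // mulr_ge0_le0.
- move=> x t t1 /=; rewrite DBT; last by rewrite ler_peMr.
  exact: DBV.
- by move=> a t /=; rewrite EA; apply: DBN; exact: inV_bmapr (DAV a).
- by move=> x t Vx /=; apply: DBN; exact: EV.
pose D (u : breal B * R) := if u.2 <= TA then E u else J0 (u.1, u.2 - TA).
have cD : continuous D.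
  apply: (@continuous_join _ _ TA E (fun u => J0 (u.1, u.2 - TA)) cE).
    apply: (continuous_compf cJ0); apply: continuous_pair; first exact: continuous_fst.
    by apply: cB; [exact: continuous_snd|exact: ccst].
  by move=> x /=; rewrite subrr J00 // mulr0 DB0.
have DA' a t : D (bmapr i a, t) = bmapr i (DA (a, Order.min t TA)).
  rewrite /D /=; case: leP => [le|lt]; first by rewrite EA.
  by rewrite J0A /= mulr0 DB0 // EA.
have D0 x t : t <= 0 -> D (x, t) = x by move=> t0; rewrite /D /= (le_trans t0 TA0) E0.
have DV x t : TA + 1 <= t -> inV B (D (x, t)).
  move=> le; rewrite /D /= ifF; last by apply/negbTE; rewrite -ltNge; lra.
  by rewrite J01 ?J0V //; lra.
have DN x t : inV B x -> inV B (D (x, t)).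
  by move=> Vx; rewrite /D /=; case: ifP => _; [exact: EV|exact: J0N].
have [|||||E' [cE' E'0 E'A E'V]] := @extend A B i (breal K) (inV K) i_inj (bmapr phi)
    (fun u => bmapr i1 (H1 (bmapr phiA u.1, u.2))).
- exact: bmapr_continuous.
- apply: (continuous_compf (@bmapr_continuous _ _ i1)); apply: (continuous_compf cH1).
  apply: continuous_pair; last exact: continuous_snd.
  by apply: (continuous_compf (@bmapr_continuous _ _ _)); exact: continuous_fst.
- by move=> a t t0 /=; rewrite H10 // bmapr_comm.
- by move=> x; exact: inV_bmapr.
- by move=> a t Va /=; apply: inV_bmapr; apply: H1N; exact: inV_bmapr.
(* Along [D] a point of [A] stays in the image of [A], where [E'] at time [T] is the end of [H1] and
   hence takes marked values. This is the hypothesis of [compress] on [A]. *)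
have [|||||J [[cJ J00'] J1 JV JA JN]] := @compress A B i (breal K) (inV K) i_inj
    (fun u => E' (D (u.1, (TA + 1) * u.2), T)).
- apply: (continuous_compf cE'); apply: continuous_pair; last exact: ccst.
  apply: (continuous_compf cD); apply: continuous_pair; first exact: continuous_fst.
  by apply: cM; [exact: ccst|exact: continuous_snd].
- by move=> x t t0 /=; rewrite !D0 ?mulr0 // mulr_ge0_le0 //; lra.
- move=> x t t1 /=; apply: E'V; apply: DV.
  by rewrite ler_peMr //; lra.
- by move=> a t /=; rewrite DA' E'A /=; exact: inV_bmapr (H1V _).
- by move=> x t Vx /=; apply: E'V; exact: DN.
pose sc t := (t - T) / (T' - T).
have d0 : 0 < T' - T by lra.
pose HB (u : breal B * R) := if u.2 <= T then E' u else J (u.1, sc u.2).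
have cHB : continuous HB.
  apply: (@continuous_join _ _ T E' (fun u => J (u.1, sc u.2)) cE').
    apply: (continuous_compf cJ); apply: continuous_pair; first exact: continuous_fst.
    apply: cM; last exact: ccst.
    by apply: cB; [exact: continuous_snd|exact: ccst].
  by move=> x /=; rewrite /sc subrr mul0r J00' // mulr0 D0.
have [|||H [cH HK HP]] := @breal_glue _ (fun u => bmapr i1 (H1 u)) HB.
- exact: (continuous_compf (@bmapr_continuous _ _ i1) cH1).
- exact: cHB.
- move=> a z; rewrite /HB /=; case: leP => le; first by rewrite E'A.
  by rewrite JA /= mulr0 D0 // E'A /= H1T // ltW.
exists H; split; last exact: HK.
split.
- by split; [lra|exact: cH].
- move=> x t t0; have [[y ->]|[y ->]] := breal_cover x; first by rewrite HK H10.
  by rewrite HP /HB /= (le_trans t0 T0) E'0.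
- move=> x t Tt; have [[y ->]|[y ->]] := breal_cover x.
    by rewrite !HK (H1T _ t) ?(H1T _ T') //; lra.
  have h s : T' <= s -> (s <= T) = false by move=> ?; apply/negbTE; rewrite -ltNge; lra.
  rewrite !HP /HB /= !h // [LHS]J1 ?[RHS]J1 // /sc ler_pdivlMr //; lra.
- move=> x; have [[y ->]|[y ->]] := breal_cover x.
    by rewrite HK H1T ?(ltW TT') //; exact: inV_bmapr (H1V _).
  rewrite HP /HB /= leNgt TT' /= J1 // /sc divff //; exact: lt0r_neq0.
- move=> x t /breal_coverV[[y Vy ->]|[y Vy ->]].
    by rewrite HK; apply: inV_bmapr; exact: H1N.
  by rewrite HP /HB; case: ifP => _; [exact: E'V|exact: JN].
Qed.

End Pushout.
End Deformations.
Arguments inV : clear implicits.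

(** * The realization lemma *)

Lemma sval_inj (T : Type) (P : T -> Prop) : injective (@sval T P).
Proof.
move=> [x Px] [y Py] /= E; case: _ / E Py => Py; congr exist; exact: Prop_irrelevance.
Qed.

Section Sub.
Variables (M : bset).

Definition bclosed (P : forall d, M d -> Prop) :=
  forall d d' (h : hom d' d) (b : M d), P d b -> P d' (bact h b).

Definition bsub (P : forall d, M d -> Prop) (cP : bclosed P) : bset.
Proof.
refine (@Bset (fun d => {b : M d | P d b})
  (fun d d' h b => exist _ (bact h (sval b)) (cP _ _ h _ (svalP b)))
  (fun d b => bmk (sval b)) _ _ _).
- by move=> d b; apply: sval_inj; exact: bact_id.
- by move=> *; apply: sval_inj; exact: bact_comp.
- by move=> *; exact: bmk_act.
Defined.

Definition bincl (P Q : forall d, M d -> Prop) (cP : bclosed P) (cQ : bclosed Q)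
  (PQ : forall d b, P d b -> Q d b) : bmap (bsub cP) (bsub cQ).
Proof.
refine (@Bmap (bsub cP) (bsub cQ) (fun d b => exist _ (sval b) (PQ _ _ (svalP b))) _ _) => //.
by move=> *; apply: sval_inj.
Defined.

Lemma bincl_inj P Q cP cQ PQ d : injective (@bm _ _ (@bincl P Q cP cQ PQ) d).
Proof. by move=> x y /(congr1 sval) /= E; apply: sval_inj. Qed.

Definition bval (P : forall d, M d -> Prop) (cP : bclosed P) : bmap (bsub cP) M.
Proof. by refine (@Bmap (bsub cP) M (fun d b => sval b) _ _). Defined.

End Sub.

Section RealizationLemma.
Variable M : bset.
(** Marks belong to the second direction, so operators of the first direction reflect them; this
    makes the attaching maps respect marks both ways. *)
Hypothesis mark_h : forall d j (t : mono d.1 j) (c : M (j, d.2)),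
  bmk (bact ((t, mid d.2) : hom d (j, d.2)) c) -> bmk c.

Definition actv n k k' (psi : mono k' k) (c : M (n, k)) : M (n, k') :=
  bact ((mid n, psi) : hom (n, k') (n, k)) c.

Definition acth n n' k (t : mono n' n) (c : M (n, k)) : M (n', k) :=
  bact ((t, mid k) : hom (n', k) (n, k)) c.

Lemma acth_comp n n' n'' k (g : mono n' n) (f : mono n'' n') (c : M (n, k)) :
  acth f (acth g c) = acth (mcomp g f) c.
Proof. by rewrite /acth bact_comp /hc /= mcomp_idl. Qed.

Lemma acth_id n k (c : M (n, k)) : acth (mid n) c = c.
Proof. exact: bact_id. Qed.

Lemma acthv n n' k k' (t : mono n' n) (psi : mono k' k) (c : M (n, k)) :
  acth t (actv psi c) = actv psi (acth t c).
Proof. by rewrite /acth /actv !bact_comp /hc /= !mcomp_idl !mcomp_idr. Qed.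

(** Level [n], constant in the first direction, times the standard [m]-simplex: the pieces from
    which the realization is assembled. *)
Definition levb (n m : nat) : bset.
Proof.
refine (@Bset (fun d => M (n, d.2) * mono d.1 m)%type
  (fun d d' h x => (actv h.2 x.1, mcomp x.2 h.1)) (fun d x => bmk x.1) _ _ _).
- by move=> d [c al] /=; rewrite mcomp_idr /actv bact_id.
- by move=> d d' d'' g f [c al] /=; rewrite mcompA /actv bact_comp /hc /= mcomp_idl.
- by move=> d d' h [c al] /=; exact: bmk_act.
Defined.

(** Such a [q] is a subcomplex of the standard [m]-simplex; the assembly uses the whole simplex and
    its boundary. *)
Definition mclosed m (q : forall a, mono a m -> Prop) :=
  forall a a' (al : mono a m) (t : mono a' a), q a al -> q a' (mcomp al t).

Definition qlev n m (q : forall a, mono a m -> Prop) d (x : levb n m d) : Prop := q d.1 x.2.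

Lemma qlev_closed n m q : mclosed q -> bclosed (@qlev n m q).
Proof. by move=> cq d d' h x; exact: cq. Qed.

(** The deformations of different levels need not be compatible. *)
Hypothesis lev_good : forall n m q (cq : @mclosed m q),
  exists T H, good (B := bsub (qlev_closed (n := n) cq)) T H.

(** The union of the images of the first [k] degeneracies; for [j < n] the operator [munskip n j]
    identifies [j] with [j+1]. *)
Definition deg k n l (c : M (n, l)) : Prop :=
  exists j, [/\ j < k, j < n & exists c' : M (n.-1, l), c = acth (munskip n j) c'].

Lemma deg_actv k n l l' (psi : mono l' l) (c : M (n, l)) : deg k c -> deg k (actv psi c).
Proof.
by move=> [j [jk jn [c' ->]]]; exists j; split => //; exists (actv psi c'); rewrite acthv.
Qed.

Definition dlev k n m (q : forall a, mono a m -> Prop) d (x : levb n m d) : Prop := deg k x.1 /\ q d.1 x.2.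
Arguments dlev k n m q d x : clear implicits.

Lemma dlev_closed k n m q : @mclosed m q -> bclosed (dlev k n m q).
Proof. by move=> cq d d' h x [h1 h2]; split; [exact: deg_actv|exact: cq]. Qed.
Arguments dlev_closed k n {m q}.

Lemma good_empty (B : bset) : (forall d, B d -> False) -> good (B := B) 0%R fst.
Proof.
move=> e; have e' (x : breal B) : False by have [d [b _]] := cls_surj x; exact: (e d b).
split; try by move=> x; case: (e' x).
by split => //; exact: continuous_fst.
Qed.

Lemma munskipE n j x : j < n -> x <= n -> munskip n j x = x - (j < x).
Proof. by move=> jn xn; rewrite /= /unbump (minn_idPl xn); case: (ltnP j x) => /=; lia. Qed.

Lemma mskipE n j x : 0 < n -> j <= n -> x <= n.-1 -> mskip n j x = (j <= x) + x.
Proof. by move=> n0 jn xn; rewrite /= /bump (minn_idPl xn); case: (leqP j x) => /=; lia. Qed.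

Lemma munskipK n k : k < n -> mcomp (munskip n k) (mskip n k.+1) = mid n.-1.
Proof.
move=> kn; apply: mono_eq => x xn.
rewrite -[LHS]/(munskip n k (mskip n k.+1 x)) -[RHS]/(minn x n.-1) mskipE ?munskipE //; lia.
Qed.

Lemma munskip_munskip n j k : j < k -> k < n ->
  mcomp (munskip n.-1 j) (munskip n k) = mcomp (munskip n.-1 k.-1) (munskip n j).
Proof.
move=> jk kn; apply: mono_eq => x xn.
rewrite -[LHS]/(munskip n.-1 j (munskip n k x)) -[RHS]/(munskip n.-1 k.-1 (munskip n j x)).
have jn : j < n by lia.
rewrite (munskipE kn xn) (munskipE jn xn).
rewrite !munskipE; lia.
Qed.

Lemma munskip_mskip n j k : j < k -> k < n ->
  mcomp (munskip n j) (mskip n k.+1) = mcomp (mskip n.-1 k) (munskip n.-1 j).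
Proof.
move=> jk kn; apply: mono_eq => x xn.
rewrite -[LHS]/(munskip n j (mskip n k.+1 x)) -[RHS]/(mskip n.-1 k (munskip n.-1 j x)).
have jn : j < n by lia.
have h : munskip n.-1 j x <= n.-1.-1 by exact: mf_le.
rewrite !mskipE ?munskipE //; lia.
Qed.

(** One more degeneracy adds a copy of level [n-1], embedded by the degeneracy at [k]. By the
    simplicial identities it meets the earlier images in the part of that copy that is degenerate at
    an index below [k]. So induction on [k], for all [n] at once, is a sequence of pushouts. *)
Lemma dlev_good n m q (cq : @mclosed m q) k : k <= n ->
  exists T H, good (B := bsub (dlev_closed k n cq)) T H.
Proof.
elim: k n => [|k IH] n kn; first by exists 0%R, fst; apply: good_empty => d [x [[j []]]].
have [T [H1 gH1]] := IH n (ltnW kn).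
have kn' : k <= n.-1 by lia.
have [TA [DA gA]] := IH n.-1 kn'.
have [TB [DB gB]] := lev_good n.-1 cq.
have s_in d (x : levb n.-1 m d) : qlev q x -> dlev k.+1 n m q d (acth (munskip n k) x.1, x.2).
  by move=> qx; split => //; exists k; split => //; exists x.1.
have sA_in d (x : levb n.-1 m d) : dlev k n.-1 m q d x -> dlev k n m q d (acth (munskip n k) x.1, x.2).
  move=> [[j [jk jn [c' xE]]] qx]; split => //; exists j; split => //; first lia.
  exists (acth (munskip n.-1 k.-1) c'); rewrite /= xE !acth_comp; congr acth.
  by apply: munskip_munskip.
have i1P d (x : levb n m d) : dlev k n m q d x -> dlev k.+1 n m q d x.
  by move=> [[j [jk jn h]] qx]; split => //; exists j; split => //; lia.
have iP d (x : levb n.-1 m d) : dlev k n.-1 m q d x -> qlev q x by case.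
pose i1 := bincl (dlev_closed k _ cq) (dlev_closed k.+1 _ cq) i1P.
pose i := bincl (dlev_closed k _ cq) (qlev_closed cq) iP.
have phi_act0 d d' (h : hom d' d) (x : levb n.-1 m d) :
    (acth (munskip n k) (actv h.2 x.1), mcomp x.2 h.1) =
    bact h ((acth (munskip n k) x.1, x.2) : levb n m d) by rewrite /= acthv.
have phi_mk0 d (c : M (n.-1, d)) : bmk (acth (munskip n k) c) <-> bmk c.
  split; last exact: bmk_act.
  exact: (mark_h (d := (n, d))).
pose phi_ d (x : (bsub (qlev_closed (n := n.-1) cq)) d) : (bsub (dlev_closed k.+1 n cq)) d := exist _ (acth (munskip n k) (sval x).1, (sval x).2) (s_in _ _ (svalP x)).
have phi_act d d' (h : hom d' d) x : phi_ d' (bact h x) = bact h (phi_ d x).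
  by apply: sval_inj; exact: phi_act0.
have phi_mk d x : bmk (phi_ d x) <-> bmk x by exact: phi_mk0.
pose phi := Bmap phi_act phi_mk.
pose phiA_ d (x : (bsub (dlev_closed k n.-1 cq)) d) : (bsub (dlev_closed k n cq)) d := exist _ (acth (munskip n k) (sval x).1, (sval x).2) (sA_in _ _ (svalP x)).
have phiA_act d d' (h : hom d' d) x : phiA_ d' (bact h x) = bact h (phiA_ d x).
  by apply: sval_inj; exact: phi_act0.
have phiA_mk d x : bmk (phiA_ d x) <-> bmk x by exact: phi_mk0.
pose phiA := Bmap phiA_act phiA_mk.
have s_inj l (c c' : M (n.-1, l)) : acth (munskip n k) c = acth (munskip n k) c' -> c = c'.
  by move=> /(congr1 (acth (mskip n k.+1))); rewrite !acth_comp munskipK // !acth_id.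
have TT' : (T < T + 1)%R by lra.
have [||||||H [gH _]] := @glue_good _ _ _ _ i1 i phi phiA _ _ _ _ _ _ _ _ _ _ _ _ _ gH1 gA gB TT'.
- exact: bincl_inj.
- exact: bincl_inj.
- by move=> d a; apply: sval_inj.
- move=> d [[c al] cx]; have [[j [jk jn [c' cE]]] qx] := cx; rewrite /= in cE qx.
  have := jk; rewrite ltnS leq_eqVlt => /orP[/eqP jE|jlt]; [right|left].
    by exists (exist _ (c', al) qx); apply: sval_inj; rewrite /= -jE -cE.
  have dx : dlev k n m q d (c, al) by split => //; exists j; split => //; exists c'.
  by exists (exist _ _ dx); apply: sval_inj.
- move=> d [[c' al] qx] [y [[j [jk jn [c'' yE]]] qy]] /(congr1 sval) /= E.
  have dx : dlev k n.-1 m q d (c', al).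
    split => //; exists j; split => //; first lia.
    exists (acth (mskip n.-1 k) c'').
    have := congr1 (acth (mskip n k.+1)) (congr1 fst E); rewrite /= yE !acth_comp munskipK // acth_id => ->.
    by congr acth; apply: munskip_mskip.
  by exists (exist _ _ dx); apply: sval_inj.
- move=> d [[c al] qx] [[c' al'] qx'] /(congr1 sval) /= [/s_inj E1 E2]; left.
  by apply: sval_inj => /=; rewrite E1 E2.
by exists (T + 1)%R, H.
Qed.

(** Elements coming from levels strictly below [n]: [nsk n] is the (n-1)-skeleton in the first
    direction, and [nsk 0] is empty. *)
Definition nsk n d (b : M d) : Prop :=
  exists j, j < n /\ exists (t : mono d.1 j) (c : M (j, d.2)), b = bact ((t, mid d.2) : hom d (j, d.2)) c.

Lemma nsk_closed n : bclosed (@nsk n).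
Proof.
move=> d d' h b [j [jn [t [c ->]]]]; exists j; split => //; exists (mcomp t h.1), (actv h.2 c).
by rewrite /actv !bact_comp /hc /= !mcomp_idl mcomp_idr.
Qed.

Lemma nsk_deg n l (c : M (n, l)) : nsk n c <-> deg n c.
Proof.
split => [[j [jn [t [c' cE]]]]|[j [jn _ [c' ->]]]]; last first.
  by exists n.-1; split; [lia|exists (munskip n j), c'].
(* A monotone map from [[n]] to a shorter [[j]] repeats a value at two neighbours, and factors
   through the degeneracy there. *)
have [i [iN ti]] : exists i, i < n /\ t i = t i.+1.
  apply: contrapT => h.
  have inc i : i <= n -> i <= t i.
    elim: i => // i IHi iN; have := IHi (ltnW iN); have := mf_homo t (leqnSn i).
    suff : t i <> t i.+1 by lia.
    by move=> E; apply: h; exists i.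
  by have := inc n (leqnn n); have := mf_le t n; lia.
exists i; split => //; exists (acth (mcomp t (mskip n i.+1)) c').
rewrite acth_comp cE; congr (bact (_, _) _); apply: mono_eq => x xn.
have xle : x - (i < x) <= n.-1 by rewrite -(munskipE iN xn); exact: mf_le.
have n0 : 0 < n by lia.
rewrite -[RHS]/(t (mskip n i.+1 (munskip n i x))) munskipE // (mskipE n0 iN xle).
case: (ltnP i x) => ix; last by rewrite subn0 ltnNge ix.
have [->|xi] := eqVneq x i.+1; first by rewrite subn1 ltnn.
have -> : i < x - true by move: xi => /eqP; rewrite subn1; lia.
by congr (mf t); rewrite subn1; lia.
Qed.

Definition nsurj m a (al : mono a m) := ~ msurj al.

Lemma nsurj_closed m : mclosed (@nsurj m).
Proof.
move=> a a' al t ns s; apply: ns => j /s[x xm <-]; exists (t x) => //.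
exact: mf_le.
Qed.

Definition any m a (al : mono a m) := True.
Lemma any_closed m : mclosed (@any m). Proof. by []. Qed.

(* The part of [levb n n], i.e. of the n-th level times the n-simplex, that is glued to
   the (n-1)-skeleton. *)
Definition alev n d (x : levb n n d) : Prop := deg n x.1 \/ nsurj x.2.

Lemma alev_closed n : bclosed (@alev n).
Proof. by move=> d d' h x [?|?]; [left; exact: deg_actv|right; exact: nsurj_closed]. Qed.

(** The degenerate part times the simplex and the level times the boundary meet in the degenerate
    part times the boundary. *)
Lemma alev_good n : exists T H, good (B := bsub (@alev_closed n)) T H.
Proof.
have [T [H1 gH1]] := dlev_good (@any_closed n) (leqnn n).
have [TA [DA gA]] := dlev_good (@nsurj_closed n) (leqnn n).
have [TB [DB gB]] := lev_good n (@nsurj_closed n).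
have i1P d (x : levb n n d) : dlev n n n (@any n) d x -> alev x by case; left.
have iP d (x : levb n n d) : dlev n n n (@nsurj n) d x -> qlev (@nsurj n) x by case.
have phiP d (x : levb n n d) : qlev (@nsurj n) x -> alev x by right.
have phiAP d (x : levb n n d) : dlev n n n (@nsurj n) d x -> dlev n n n (@any n) d x by case.
have TT' : (T < T + 1)%R by lra.
have [||||||H [gH _]] := @glue_good _ _ _ _ (bincl (dlev_closed n n (@any_closed n)) (@alev_closed n) i1P)
  (bincl (dlev_closed n n (@nsurj_closed n)) (qlev_closed (@nsurj_closed n)) iP)
  (bincl (qlev_closed (@nsurj_closed n)) (@alev_closed n) phiP)
  (bincl (dlev_closed n n (@nsurj_closed n)) (dlev_closed n n (@any_closed n)) phiAP)
  _ _ _ _ _ _ _ _ _ _ _ _ _ gH1 gA gB TT'.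
- exact: bincl_inj.
- exact: bincl_inj.
- by move=> d a; apply: sval_inj.
- move=> d [x [dx|sx]]; [left|right].
    have ax : dlev n n n (@any n) d x by [].
    by exists (exist _ x ax); apply: sval_inj.
  have ax : qlev (@nsurj n) x by [].
  by exists (exist _ x ax); apply: sval_inj.
- move=> d [x sx] [y [dy _]] /(congr1 sval) /= E.
  have ax : dlev n n n (@nsurj n) d x by rewrite E; split => //; rewrite -E.
  by exists (exist _ x ax); apply: sval_inj.
- by move=> d x y /bincl_inj ->; left.
by exists (T + 1)%R, H.
Qed.

Lemma nskS n d (b : M d) : nsk n b -> nsk n.+1 b.
Proof. by move=> [j [jn h]]; exists j; split => //; lia. Qed.

Definition skincl n := bincl (@nsk_closed n) (@nsk_closed n.+1) (@nskS n).

Lemma skel_step n T T' H1 : good (B := bsub (@nsk_closed n)) T H1 -> (T < T')%R ->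
  exists H, good (B := bsub (@nsk_closed n.+1)) T' H /\
    forall x t, H (bmapr (skincl n) x, t) = bmapr (skincl n) (H1 (x, t)).
Proof.
move=> gH1 TT'.
have [TA [DA gA]] := alev_good n.
have [TB [DB gB]] := lev_good n (@any_closed n).
have iP d (x : levb n n d) : alev x -> qlev (@any n) x by [].
pose f d (x : levb n n d) : M d := bact ((x.2, mid d.2) : hom d (n, d.2)) x.1.
have fP d (x : levb n n d) : nsk n.+1 (f d x).
  by exists n; split => //; exists x.2, x.1.
have fAP d (x : levb n n d) : alev x -> nsk n (f d x).
  case=> [/nsk_deg [j [jn [t [c E]]]]|/not_msurj_factor[n0 [g [k E]]]].
    exists j; split => //; exists (mcomp t x.2), c.
    by rewrite /f E bact_comp /hc /= mcomp_idl.
  exists n.-1; split; first lia; exists k, (acth g x.1).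
  by rewrite /f /acth bact_comp /hc /= mcomp_idl -E.
have f_act d d' (h : hom d' d) (x : levb n n d) : f d' (bact h x) = bact h (f d x).
  by rewrite /f /= /actv !bact_comp /hc /= !mcomp_idl mcomp_idr.
have f_mk d (x : levb n n d) : bmk (f d x) <-> bmk x.
  by split; [exact: mark_h|exact: (@bmk_act M)].
pose phi_ d (x : (bsub (qlev_closed (n := n) (@any_closed n))) d) : (bsub (@nsk_closed n.+1)) d := exist _ (f d (sval x)) (fP _ _).
have phi_act d d' (h : hom d' d) x : phi_ d' (bact h x) = bact h (phi_ d x).
  by apply: sval_inj; exact: f_act.
have phi_mk d x : bmk (phi_ d x) <-> bmk x by exact: f_mk.
pose phi := Bmap phi_act phi_mk.
pose phiA_ d (x : (bsub (@alev_closed n)) d) : (bsub (@nsk_closed n)) d := exist _ (f d (sval x)) (fAP _ _ (svalP x)).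
have phiA_act d d' (h : hom d' d) x : phiA_ d' (bact h x) = bact h (phiA_ d x).
  by apply: sval_inj; exact: f_act.
have phiA_mk d x : bmk (phiA_ d x) <-> bmk x by exact: f_mk.
pose phiA := Bmap phiA_act phiA_mk.
pose i := bincl (@alev_closed n) (qlev_closed (n := n) (@any_closed n)) iP.
have fsec d (x : levb n n d) (g : mono n d.1) :
    bact ((g, mid d.2) : hom (n, d.2) d) (f d x) = acth (mcomp x.2 g) x.1.
  by rewrite /f /acth bact_comp /hc /= mcomp_idl.
have gg := @glue_good _ _ _ _ (skincl n) i phi phiA _ _ _ _ _ _ T T' H1 TA DA TB DB.
apply: gg => //.
- exact: bincl_inj.
- exact: bincl_inj.
- by move=> d a; apply: sval_inj.
- move=> d [b bn]; have [j [jn [t [c bE]]]] := bn.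
  rewrite ltnS leq_eqVlt in jn; case/orP: jn => [/eqP jn|jn]; [right|left].
    subst j; exists (exist _ ((c, t) : levb n n d) I); exact: sval_inj.
  have bn' : nsk n b by exists j; split => //; exists t, c.
  by exists (exist _ _ bn'); apply: sval_inj.
- move=> d [x qx] [y yn] /(congr1 sval) /= E.
  have ax : alev x.
    (* A section of a surjective [x.2] recovers [x.1] from the image, which lies in the lower
       skeleton. *)
    have [sx|?] := pselect (msurj x.2); last by right.
    have [g [gE _]] := msection sx (leq0n _).
    left; apply/nsk_deg; rewrite -[x.1]acth_id -gE -fsec E; exact: nsk_closed.
  by exists (exist _ x ax); apply: sval_inj.
- move=> d [x qx] [y qy] /(congr1 sval) /= E.
  have [ax|/not_orP[dx /contrapT sx]] := pselect (alev x).
    by right; exists (exist _ x ax); apply: sval_inj.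
  left; apply: sval_inj => /=.
  have sec z : z <= d.1 -> x.1 = y.1 /\ y.2 z = x.2 z.
    move=> zd; have [g [gE gz]] := msection sx zd.
    have E1 : x.1 = acth (mcomp y.2 g) y.1 by rewrite -fsec -E fsec gE acth_id.
    (* If this composite missed a vertex, [x.1] would come from a lower level, against [dx]. *)
    have yg : mcomp y.2 g = mid n.
      apply: msurj_id; apply: contrapT => /not_msurj_factor[n0 [g1 [k gk]]].
      apply: dx; apply/nsk_deg; exists n.-1; split; first lia.
      by exists k, (acth g1 y.1); rewrite E1 gk -acth_comp.
    split; first by rewrite E1 yg acth_id.
    have := congr1 (fun h : mono n n => h (x.2 z)) yg => /=; rewrite gz => ->.
    exact/minn_idPl/mf_le.
  rewrite [x]surjective_pairing [y]surjective_pairing (sec 0 (leq0n _)).1; congr pair.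
  by apply: mono_eq => z /sec[].
Qed.

Definition Tn (n : nat) : R := (1 - n.+1%:R^-1)%R.

Lemma TnS n : (Tn n < Tn n.+1)%R.
Proof. by rewrite /Tn ltrD2l ltrN2 ltf_pV2 ?posrE ?ltr0n // ltr_nat. Qed.

Lemma Tn_le1 n : (Tn n <= 1)%R.
Proof. by rewrite /Tn gerBl invr_ge0 ler0n. Qed.

Lemma skel0_good : good (B := bsub (@nsk_closed 0)) (Tn 0) fst.
Proof. by rewrite /Tn invr1 subrr; apply: good_empty => d [x [j []]]. Qed.

(** Each stage carries its proof, so that the next one can be chosen to extend this very
    homotopy. *)
Fixpoint skelH n : {H | good (B := bsub (@nsk_closed n)) (Tn n) H} :=
  match n with
  | 0 => exist _ fst skel0_good
  | n'.+1 => let P := cid (skel_step (svalP (skelH n')) (TnS n')) in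
             exist _ (sval P) (svalP P).1
  end.

Lemma skelHS n x t :
  sval (skelH n.+1) (bmapr (skincl n) x, t) = bmapr (skincl n) (sval (skelH n) (x, t)).
Proof. by rewrite /=; case: cid => H /= []. Qed.

Definition skelW n x t : breal M := bmapr (bval (@nsk_closed n)) (sval (skelH n) (x, t)).

Lemma skelW_indep n n' d (b : M d) (h : nsk n b) (h' : nsk n' b) p t : n <= n' ->
  skelW (cls (exist _ b h' : bsub (@nsk_closed n') d) p) t =
  skelW (cls (exist _ b h : bsub (@nsk_closed n) d) p) t.
Proof.
elim: n' h' => [|n' IH] h'.
  by rewrite leqn0 => /eqP n0; move: h; rewrite n0 => h; congr (skelW (cls _ _) _); exact: sval_inj.
rewrite leq_eqVlt => /orP[/eqP E|nn'].
  by clear IH; move: h; rewrite E => h; congr (skelW (cls _ _) _); exact: sval_inj.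
have h2 : nsk n' b by have [j [jn hj]] := h; exists j; split => //; lia.
rewrite -(IH h2 nn') /skelW.
have -> : cls (exist _ b h' : bsub (@nsk_closed n'.+1) d) p =
    bmapr (skincl n') (cls (exist _ b h2 : bsub (@nsk_closed n') d) p).
  by rewrite bmapr_cls; congr cls; apply: sval_inj.
rewrite skelHS; have [d' [b' [p' ->]]] := cls_surj (sval (skelH n') (cls (exist _ b h2 : bsub _ d) p, t)).
by rewrite !bmapr_cls.
Qed.

Lemma nsk_self d (b : M d) : nsk d.1.+1 b.
Proof. by case: d b => a k b; exists a; split => //; exists (mid a), b; rewrite bact_id. Qed.

(* The homotopies are built on the skeleta in the first direction; the one on the
   [n]-skeleton is stationary after the time [Tn n < 1], so that they fit together. *)
Lemma realization_deform : exists H : breal M * R -> breal M,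
  [/\ continuous H, forall x t, (t <= 0)%R -> H (x, t) = x,
      forall x, inV M (H (x, 1%R)) & forall x t, inV M x -> inV M (H (x, t))].
Proof.
pose sb N d (b : M d) h : bsub (@nsk_closed N) d := exist _ b h.
pose F d (b : M d) (u : pt d * R) := skelW (cls (sb _ _ b (nsk_self b)) u.1) u.2.
have [||H [cH HE]] := @breal_lift M R _ F (@locally_compactR R) (@Rhausdorff R).
- move=> d b; have [[_ cS] _ _ _ _] := svalP (skelH d.1.+1).
  apply: (continuous_compf (@bmapr_continuous _ _ _)); apply: (continuous_compf cS).
  apply: continuous_pair; last exact: continuous_snd.
  by apply: (continuous_compf (@cls_continuous _ _ _)); exact: continuous_fst.
- move=> d d' h b p t; rewrite /F /=.
  have hN : nsk (maxn d.1 d'.1).+1 b.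
    by have [j [jn hj]] := nsk_self b; exists j; split => //; lia.
  rewrite -(skelW_indep _ hN); last by lia.
  rewrite -(skelW_indep _ (nsk_closed h hN)); last by lia.
  rewrite -cls_act; congr (skelW (cls _ _) _); exact: sval_inj.
have HW d (b : M d) p t : H (cls b p, t) =
    bmapr (bval (@nsk_closed d.1.+1)) (sval (skelH d.1.+1) (cls (sb _ _ b (nsk_self b)) p, t)).
  by rewrite HE.
exists H; split => //.
- move=> x t t0; have [d [b [p ->]]] := cls_surj x; rewrite HW.
  by have [_ S0 _ _ _] := svalP (skelH d.1.+1); rewrite S0 // bmapr_cls.
- move=> x; have [d [b [p ->]]] := cls_surj x; rewrite HW; apply: inV_bmapr.
  by have [_ _ ST SV _] := svalP (skelH d.1.+1); rewrite ST ?Tn_le1.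
- move=> x t [d [b [p [mb ->]]]]; rewrite HW; apply: inV_bmapr.
  have [_ _ _ _] := svalP (skelH d.1.+1); apply.
  by exists d, (sb _ _ b (nsk_self b)), p.
Qed.

End RealizationLemma.

(** * Cylinders *)

Section Cumulative.
Local Open Scope ring_scope.

(** A point of the simplex is read as a subdivision of [0,1] in which the vertex [a] owns the
    interval from [cs t a] to [cs t a.+1]. *)
Definition cs k (t : simplex k) (a : nat) : R := \sum_(x < k.+1 | (x < a)%N) co t x.

Lemma cs0 k (t : simplex k) : cs t 0 = 0.
Proof. by rewrite /cs big_pred0. Qed.

Lemma cs_end k (t : simplex k) : cs t k.+1 = 1.
Proof. by rewrite /cs -(co_sum t); apply: eq_bigl => x; exact: ltn_ord. Qed.

Lemma csS k (t : simplex k) (a : 'I_k.+1) : cs t a.+1 = cs t a + co t a.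
Proof.
rewrite /cs (bigD1 a) ?ltnS ?leqnn //= addrC; congr (_ + _); apply: eq_bigl => x.
by rewrite ltnS -val_eqE /= [RHS]ltn_neqAle andbC.
Qed.

Lemma cs_homo k (t : simplex k) a b : (a <= b)%N -> cs t a <= cs t b.
Proof.
move=> ab; rewrite /cs [X in _ <= X](bigID (fun x : 'I_k.+1 => (x < a)%N)) /=.
rewrite [X in _ <= X + _](eq_bigl (fun x : 'I_k.+1 => (x < a)%N)); last by move=> x /=; lia.
by rewrite lerDl; apply: sumr_ge0 => x _; exact: co_ge0.
Qed.

Lemma cs_continuous k a : continuous (fun t : simplex k => cs t a).
Proof. by apply: csum => x; exact: co_continuous. Qed.

(** Preimages of initial segments are initial segments, so the division points of a pushed point are
    division points of the original. *)
Lemma mono_cut k' k (psi : mono k' k) b :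
  exists2 N, (N <= k'.+1)%N & forall a, (a <= k')%N -> (psi a < b)%N = (a < N)%N.
Proof.
have [[a0 [a0k h0]]|h] := pselect (exists a, (a <= k')%N /\ (b <= psi a)%N); last first.
  exists k'.+1 => // a ak; rewrite ltnS ak ltnNge; apply/negP => h'.
  by apply: h; exists a.
have ex : exists a, (a <= k')%N && (b <= psi a)%N by exists a0; rewrite a0k.
case: (ex_minnP ex) => N /andP[Nk hN] mN; exists N; first lia.
move=> a ak; apply/idP/idP => [lt|lt].
  by rewrite ltnNge; apply/negP => Na; have := mf_homo psi Na; lia.
by rewrite ltnNge; apply/negP => h; have := mN a; rewrite ak h => /(_ isT); lia.
Qed.

Lemma cs_push k' k (psi : mono k' k) (t : simplex k') b N : (b <= k.+1)%N -> (N <= k'.+1)%N ->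
  (forall a, (a <= k')%N -> (psi a < b)%N = (a < N)%N) -> cs (spush psi t) b = cs t N.
Proof.
move=> bk Nk h; rewrite /cs; under eq_bigr do rewrite co_push.
rewrite (exchange_big_dep (fun a : 'I_k'.+1 => (a < N)%N)) /=; last first.
  by move=> x a xb /eqP E; rewrite -h ?E // leq_ord.
apply: eq_bigr => a aN.
have pa : (psi a < k.+1)%N by rewrite ltnS mf_le.
rewrite (big_pred1 (Ordinal pa)) // => x /=; rewrite -val_eqE /=.
by apply/andP/eqP => [[_ /eqP -> //]|E]; split; rewrite E ?eqxx // h ?leq_ord.
Qed.

Definition dm (f : R -> R) k (t : simplex k) (a : nat) : R := f (cs t a.+1) - f (cs t a).

(** Over an initial segment the masses telescope to the value of [f] at a division point, which
    pushing preserves; a single vertex is a difference of two segments. *)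
Lemma dm_push f k' k (psi : mono k' k) (t : simplex k') (b : 'I_k.+1) :
  dm f (spush psi t) b = \sum_(a < k'.+1 | psi a == b) dm f t a.
Proof.
have cum c : (c <= k.+1)%N ->
    \sum_(a < k'.+1 | (psi a < c)%N) dm f t a = f (cs (spush psi t) c) - f 0.
  move=> ck; have [N Nk hN] := mono_cut psi c; rewrite (cs_push t ck Nk hN).
  rewrite (eq_bigl (fun a : 'I_k'.+1 => (a < N)%N)); last by move=> a; rewrite hN // leq_ord.
  rewrite -(big_ord_widen k'.+1 (dm f t)) // -(big_mkord xpredT (dm f t)).
  by rewrite telescope_sumr // cs0.
rewrite /dm; have := cum b.+1 (ltn_ord b); have := cum b (ltnW (ltn_ord b)).
rewrite (bigID (fun a : 'I_k'.+1 => (psi a < b)%N) (fun a => (psi a < b.+1)%N)) /=.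
have -> : \sum_(a < k'.+1 | (psi a < b.+1)%N && (psi a < b)%N) dm f t a =
    \sum_(a < k'.+1 | (psi a < b)%N) dm f t a by apply: eq_bigl => a; lia.
have -> : \sum_(a < k'.+1 | (psi a < b.+1)%N && ~~ (psi a < b)%N) dm f t a =
    \sum_(a < k'.+1 | (psi a == b)%N) dm f t a by apply: eq_bigl => a; lia.
by move=> -> E; rewrite -[f (cs (spush psi t) b.+1)](subrK (f 0)) -E; ring.
Qed.

Lemma dm_sum f k (t : simplex k) : \sum_(a < k.+1) dm f t a = f 1 - f 0.
Proof. by rewrite -(big_mkord xpredT (dm f t)) telescope_sumr // cs_end cs0. Qed.

End Cumulative.

Section Cut.
Local Open Scope ring_scope.

(* Cutting the unit interval at [v] splits the mass of each vertex [a] into the part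
   [m0] before the cut and the part [m1] after it. *)
Definition m0 (v : R) k (t : simplex k) a := dm (fun y => Order.min y v) t a.
Definition m1 (v : R) k (t : simplex k) a := dm (fun y => Order.max y v) t a.

Lemma m0_ge0 v k (t : simplex k) a : 0 <= m0 v t a.
Proof. by rewrite subr_ge0; have := cs_homo t (leqnSn a) => h; rewrite le_min !ge_min h lexx !orbT. Qed.

Lemma m1_ge0 v k (t : simplex k) a : 0 <= m1 v t a.
Proof. by rewrite subr_ge0; have := cs_homo t (leqnSn a) => h; rewrite ge_max !le_max h lexx !orbT. Qed.

(** The prism at [i] consists of the source rows [0..i] followed by the target rows [i..k], shifted
    by one. Mass before the cut goes to row [a], mass after it to row [a+1]; [minn] and [maxn] keep
    the total equal to 1 even when the cut is not in the interval of [i]. *)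
Definition cutw (i : nat) (v : R) k (t : simplex k) (x : 'I_k.+2) : R :=
  \sum_(a < k.+1) ((if minn a i == x :> nat then m0 v t a else 0) +
                   (if (maxn a i).+1 == x :> nat then m1 v t a else 0)).

(** Reversed, so that at [u = 0] all mass lies before the cut and the homotopy starts at the
    source. *)
Definition cvm (u : R) : R := 1 - clamp u.

Lemma cvm_range u : 0 <= cvm u <= 1.
Proof.
have : 0 <= clamp u <= 1 by rewrite /clamp le_max lexx /= ge_max ler01 ge_min lexx orbT.
by rewrite /cvm; lra.
Qed.

Lemma cutw_ge0 i u k (t : simplex k) x : 0 <= cutw (minn i k) (cvm u) t x.
Proof.
by apply: sumr_ge0 => a _; rewrite addr_ge0 //; case: ifP => // _; [exact: m0_ge0|exact: m1_ge0].
Qed.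

Lemma cutw_sum i u k (t : simplex k) : \sum_(x < k.+2) cutw (minn i k) (cvm u) t x = 1.
Proof.
rewrite /cutw exchange_big /=.
transitivity (\sum_(a < k.+1) (m0 (cvm u) t a + m1 (cvm u) t a)).
  apply: eq_bigr => a _; rewrite big_split /= -!big_mkcond /=.
  have h1 : (minn a (minn i k) < k.+2)%N by lia.
  have h2 : ((maxn a (minn i k)).+1 < k.+2)%N by have := ltn_ord a; lia.
  by rewrite (big_pred1 (Ordinal h1)) ?(big_pred1 (Ordinal h2)) // => x; rewrite -val_eqE eq_sym.
rewrite big_split /= !dm_sum; have /andP[v0 v1] := cvm_range u.
rewrite (min_r v1) (min_l v0) (max_l v1) (max_r v0); lra.
Qed.

Definition cut i u k (t : simplex k) : simplex k.+1 :=
  mk_simplex (cutw_ge0 i u t) (cutw_sum i u t).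

Lemma cut_continuous i k : continuous (fun w : simplex k * R => cut i w.2 w.1).
Proof.
apply: continuous_simplex => x; under eq_fun do rewrite co_mk.
have cc : continuous (fun w : simplex k * R => cvm w.2).
  by apply: cB; [exact: ccst|apply: clamp_continuous; exact: continuous_snd].
have ccs a : continuous (fun w : simplex k * R => cs w.1 a).
  exact: (continuous_compf (@cs_continuous k a) (@continuous_fst _ _)).
apply: csum => a; apply: cD.
- case: (minn a (minn i k) == x :> nat); last exact: ccst.
  by apply: cB; apply: cmin; (exact: ccs || exact: cc).
- case: ((maxn a (minn i k)).+1 == x :> nat); last exact: ccst.
  by apply: cB; apply: cmax; (exact: ccs || exact: cc).
Qed.

Definition cutting i u k (t : simplex k) := cs t i <= cvm u <= cs t i.+1.

Lemma cutting_ex u k (t : simplex k) : exists2 i, (i <= k)%N & cutting i u t.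
Proof.
have /andP[v0 v1] := cvm_range u.
have ex : exists i, cvm u <= cs t i by exists k.+1; rewrite cs_end.
case: (ex_minnP ex) => -[|i] hi mi.
  by exists 0%N => //; rewrite /cutting cs0 v0 (le_trans hi) // cs_homo.
exists i; last by rewrite /cutting hi andbT leNgt; apply/negP => /ltW /mi; rewrite ltnn.
by have := mi k.+1; rewrite cs_end => /(_ v1); lia.
Qed.

Lemma cutting_push i u k' k (psi : mono k' k) (t : simplex k') : (i <= k')%N ->
  cutting i u t -> cutting (psi i) u (spush psi t).
Proof.
move=> ik /andP[h1 h2]; have pk := mf_le psi i.
have [N Nk hN] := mono_cut psi (psi i); have [N' Nk' hN'] := mono_cut psi (psi i).+1.
rewrite /cutting (cs_push t _ Nk hN) ?(cs_push t _ Nk' hN') //; last exact: leqW.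
apply/andP; split.
  by apply: le_trans h1; apply: cs_homo; have := hN i ik; rewrite ltnn; lia.
by apply: (le_trans h2); apply: cs_homo; have := hN' i ik; rewrite ltnSn; lia.
Qed.

Lemma m0_eq0 i u k (t : simplex k) a : cutting i u t -> (i < a)%N -> m0 (cvm u) t a = 0.
Proof.
move=> /andP[_ h] ia; have h1 := le_trans h (cs_homo t ia).
by rewrite /m0 /dm !min_r ?subrr //; apply: (le_trans h1); exact: cs_homo.
Qed.

Lemma m1_eq0 i u k (t : simplex k) a : cutting i u t -> (a < i)%N -> m1 (cvm u) t a = 0.
Proof.
move=> /andP[h _] ai; have h1 := le_trans (cs_homo t ai) h.
by rewrite /m1 /dm !max_r ?subrr //; apply: le_trans h1; exact: cs_homo.
Qed.

(* Two cutting vertices only differ by vertices without mass. *)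
Lemma cut_unique i i2 u k (t : simplex k) : (i < i2)%N -> (i2 <= k)%N ->
  cutting i u t -> cutting i2 u t -> cut i u t = cut i2 u t.
Proof.
move=> ii ik c1 c2; apply: simplex_eq => x; rewrite !co_mk; apply: eq_bigr => a _.
have -> : minn i k = i by lia.
have -> : minn i2 k = i2 by lia.
congr (_ + _).
  have [ai|ai] : (a <= i \/ i < a)%N by lia.
  2: by rewrite (m0_eq0 c1 ai) !if_same.
  by have -> : minn a i2 = minn a i by lia.
have [ai|ai] : (i2 <= a \/ a < i2)%N by lia.
2: by rewrite (m1_eq0 c2 ai) !if_same.
by have -> : maxn a i2 = maxn a i by lia.
Qed.

(** The prisms at [i] and [i2] differ only in the rows [i+1] to [i2], and when both vertices can be
    used for the cut these rows carry no mass. *)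
Lemma cut_supp i i2 u k (t : simplex k) (x : 'I_k.+2) : (i < i2)%N -> (i2 <= k)%N ->
  cutting i u t -> cutting i2 u t -> co (cut i u t) x != 0 -> (x <= i)%N \/ (i2 < x)%N.
Proof.
move=> ii ik c1 c2; have [xi|xi] := leqP x i; first by left.
have [xi2|xi2] := ltnP i2 x; first by right.
rewrite co_mk /cutw big1 ?eqxx // => a _; have -> : minn i k = i by lia.
rewrite [X in X + _]ifF; last by lia.
case: ifP => [/eqP E|_]; last by rewrite addr0.
by rewrite (m1_eq0 c2) ?addr0 //; lia.
Qed.

(** The operator that [psi] induces between prisms: it is [psi] on the source rows, and [psi]
    conjugated by the shift on the target rows. *)
Definition mlift (i : nat) k' k (psi : mono k' k) : mono k'.+1 k.+1.
Proof.
refine (@Mono k'.+1 k.+1 (fun a => if a <= minn i k' then psi a else (psi a.-1).+1)%N _ _ _).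
- move=> a b ab; case: ifP => h1; case: ifP => h2.
  + exact: mf_homo.
  + by apply: leqW; apply: mf_homo; lia.
  + by lia.
  + by rewrite ltnS; apply: mf_homo; lia.
- by move=> a; case: ifP => _; [apply: leqW|rewrite ltnS]; exact: mf_le.
- move=> a; have -> : (minn a k'.+1 <= minn i k')%N = (a <= minn i k')%N by lia.
  case: ifP => h; first by congr (mf psi); lia.
  by congr S; rewrite mf_norm; congr (mf psi); lia.
Defined.

Lemma cut_push i u k' k (psi : mono k' k) (t : simplex k') : (i <= k')%N ->
  spush (mlift i psi) (cut i u t) = cut (psi i) u (spush psi t).
Proof.
move=> ik; apply: simplex_eq => x; rewrite co_push; under eq_bigr do rewrite co_mk.
rewrite co_mk /cutw exchange_big /=; have pk := mf_le psi i.
rewrite (minn_idPl ik) (minn_idPl pk).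
transitivity (\sum_(a < k'.+1)
   ((if minn (psi a) (psi i) == x :> nat then m0 (cvm u) t a else 0) +
    (if (maxn (psi a) (psi i)).+1 == x :> nat then m1 (cvm u) t a else 0))).
  apply: eq_bigr => a _; rewrite big_split /=; congr (_ + _); rewrite -big_mkcondr /=.
    have h1 : (minn a i < k'.+2)%N by lia.
    have -> : minn (psi a) (psi i) = mlift i psi (minn a i).
      rewrite /= ifT; last lia.
      case: (leqP a i) => h; last by rewrite (minn_idPr (mf_homo psi (ltnW h))).
      by rewrite (minn_idPl (mf_homo psi h)).
    case: ifP => E.
      rewrite (big_pred1 (Ordinal h1)) // => y /=; rewrite -val_eqE /=.
      by apply/andP/eqP => [[_ /eqP -> //]|->]; split; [move: E; rewrite /= (minn_idPl ik)|rewrite eqxx].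
    rewrite big_pred0 // => y; apply/negP => /andP[/eqP E1 /eqP E2].
    by move: E; rewrite E2 /= (minn_idPl ik) E1 eqxx.
  have h1 : ((maxn a i).+1 < k'.+2)%N by have := ltn_ord a; lia.
  have -> : (maxn (psi a) (psi i)).+1 = mlift i psi (maxn a i).+1.
    rewrite /= ifF; last lia.
    congr S; case: (leqP a i) => h; first by rewrite (maxn_idPr (mf_homo psi h)).
    by rewrite (maxn_idPl (mf_homo psi (ltnW h))).
  case: ifP => E.
    rewrite (big_pred1 (Ordinal h1)) // => y /=; rewrite -val_eqE /=.
    by apply/andP/eqP => [[_ /eqP -> //]|->]; split; [move: E; rewrite /= (minn_idPl ik)|rewrite eqxx].
  rewrite big_pred0 // => y; apply/negP => /andP[/eqP E1 /eqP E2].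
  by move: E; rewrite E2 /= (minn_idPl ik) E1 eqxx.
under [RHS]eq_bigr do rewrite /m0 /m1 !dm_push.
rewrite (partition_big (fun a : 'I_k'.+1 => inord (psi a) : 'I_k.+1) xpredT) //=.
apply: eq_bigr => b _.
have pE (a : 'I_k'.+1) : (inord (psi a) == b) = (psi a == b).
  by rewrite -val_eqE /= inordK // ltnS mf_le.
rewrite (eq_bigl _ _ pE) big_split /=; congr (_ + _).
  case: ifP => E; first by apply: eq_bigr => a /eqP ->; rewrite E.
  by rewrite big1 // => a /eqP ->; rewrite E.
case: ifP => E; first by apply: eq_bigr => a /eqP ->; rewrite E.
by rewrite big1 // => a /eqP ->; rewrite E.
Qed.

Definition mlow k : mono k k.+1.
Proof. by refine (@Mono k k.+1 (minn^~ k) _ _ _) => *; lia. Defined.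

Definition mhigh k : mono k k.+1.
Proof. by refine (@Mono k k.+1 (fun a => (minn a k).+1) _ _ _) => *; lia. Defined.

Lemma cut_low u k (t : simplex k) : u <= 0 -> cut k u t = spush (mlow k) t.
Proof.
move=> u0; have v1 : cvm u = 1 by rewrite /cvm clamp0 // subr0.
have le1 a : cs t a <= 1.
  rewrite -(co_sum t) /cs big_mkcond /=; apply: ler_sum => x _; case: ifP => // _.
  exact: co_ge0.
apply: simplex_eq => x; rewrite co_mk co_push big_mkcond /=; apply: eq_bigr => a _.
rewrite v1 /m0 /m1 /dm !(min_l (le1 _)) !(max_r (le1 _)) subrr if_same addr0 csS.
by rewrite minnn addrAC subrr add0r.
Qed.

Lemma cut_high u k (t : simplex k) : 1 <= u -> cut 0 u t = spush (mhigh k) t.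
Proof.
move=> u1; have v0 : cvm u = 0 by rewrite /cvm clamp1 // subrr.
have ge0 a : 0 <= cs t a by rewrite -(cs0 t) cs_homo.
apply: simplex_eq => x; rewrite co_mk co_push big_mkcond /=; apply: eq_bigr => a _.
rewrite v0 /m0 /m1 /dm !(min_r (ge0 _)) !(max_l (ge0 _)) subrr if_same add0r csS.
rewrite addrAC subrr add0r; have -> : minn 0 k = 0%N by lia.
by rewrite maxn0 (minn_idPl (leq_ord a)).
Qed.

End Cut.

Section Cylinder.
Local Open Scope ring_scope.
Variables (B : bset) (X0 X1 : forall d, B d -> B d) (pr : forall d, B d -> nat -> B (d.1, d.2.+1)).
Hypothesis pr_act : forall d d' (h : hom d' d) (b : B d) i, (i <= d'.2)%N ->
  pr (bact h b) i = bact ((h.1, mlift i h.2) : hom (d'.1, d'.2.+1) (d.1, d.2.+1)) (pr b (h.2 i)).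
Hypothesis pr_low : forall d (b : B d),
  bact ((mid d.1, mlow d.2) : hom d (d.1, d.2.+1)) (pr b d.2) = X0 b.
Hypothesis pr_high : forall d (b : B d),
  bact ((mid d.1, mhigh d.2) : hom d (d.1, d.2.+1)) (pr b 0) = X1 b.
Hypothesis pr_indep : forall d (b : B d) i i2 (e : mono d.2.+1 d.2.+1),
  (i < i2)%N -> (i2 <= d.2)%N -> (forall x, (e x <= i)%N \/ (i2 < e x)%N) ->
  bact ((mid d.1, e) : hom (d.1, d.2.+1) (d.1, d.2.+1)) (pr b i) =
  bact ((mid d.1, e) : hom (d.1, d.2.+1) (d.1, d.2.+1)) (pr b i2).

(** A point is cut at [cvm u] and placed in the prism at a vertex whose interval contains the cut.
    Each of the finitely many vertices serves on a closed set, and [pr_indep] makes them agree on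
    overlaps. The last clause tells which elements occur, in order to control marks. *)
Lemma cylinder : exists H : breal B * R -> breal B, [/\ continuous H,
  forall d (b : B d) p u, u <= 0 -> H (cls b p, u) = cls (X0 b) p,
  forall d (b : B d) p u, 1 <= u -> H (cls b p, u) = cls (X1 b) p
  & forall d (b : B d) p u, exists i q, (i <= d.2)%N /\ H (cls b p, u) = cls (pr b i) q].
Proof.
have ex u k (t : simplex k) : exists i, (i <= k)%N /\ cutting i u t.
  by have [i ik c] := cutting_ex u t; exists i.
pose ci u k (t : simplex k) := sval (cid (ex u k t)).
have ciP u k (t : simplex k) : (ci u k t <= k)%N /\ cutting (ci u k t) u t.
  exact: svalP (cid (ex u k t)).
pose Fi i d (b : B d) (w : pt d * R) := cls (pr b i) ((w.1.1, cut i w.2 w.1.2) : pt (d.1, d.2.+1)).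
have indep d (b : B d) w i i2 : (i <= d.2)%N -> (i2 <= d.2)%N ->
    cutting i w.2 w.1.2 -> cutting i2 w.2 w.1.2 -> Fi i d b w = Fi i2 d b w.
  wlog ii : i i2 / (i < i2)%N.
    move=> W h1 h2 c1 c2; have [h|h|->//] := ltngtP i i2; first exact: W.
    by apply/esym; apply: W.
  move=> h1 h2 c1 c2; rewrite /Fi -(cut_unique ii h2 c1 c2).
  set q := cut i w.2 w.1.2.
  have qE : spush (ssupp q) q = q by apply: spush_fix => x; exact: ssupp_fix.
  have e x : (ssupp q x <= i)%N \/ (i2 < ssupp q x)%N.
    by have [y nz ->] := ssupp_in q x; exact: (cut_supp ii h2 c1 c2 nz).
  have sE j : cls (pr b j) ((w.1.1, q) : pt (d.1, d.2.+1)) =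
      cls (bact ((mid d.1, ssupp q) : hom (d.1, d.2.+1) (d.1, d.2.+1)) (pr b j)) ((w.1.1, q) : pt (d.1, d.2.+1)).
    by rewrite cls_act /push /= spush_id qE.
  by rewrite (sE i) (sE i2) (pr_indep b ii h2 e).
pose F d (b : B d) (w : pt d * R) := Fi (ci w.2 d.2 w.1.2) d b w.
have FE d (b : B d) w i : (i <= d.2)%N -> cutting i w.2 w.1.2 -> F d b w = Fi i d b w.
  by move=> ik c; have [ck cc] := ciP w.2 d.2 w.1.2; apply: indep.
have [||H [cH HE]] := @breal_lift B R _ F (@locally_compactR R) (@Rhausdorff R).
- move=> d b.
  have c2 : continuous (fun w : pt d * R => w.1.2).
    by apply: (continuous_compf (@continuous_snd _ _)); exact: continuous_fst.
  have c1 : continuous (fun w : pt d * R => w.1.1).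
    by apply: (continuous_compf (@continuous_fst _ _)); exact: continuous_fst.
  have cv : continuous (fun w : pt d * R => cvm w.2).
    by apply: cB; [exact: ccst|apply: clamp_continuous; exact: continuous_snd].
  apply: (@continuous_cover _ _ 'I_d.2.+1 (fun i => [set w : pt d * R | cutting i w.2 w.1.2])
    (fun i => Fi i d b)).
  + move=> i; rewrite (_ : mkset _ = [set w : pt d * R | cs w.1.2 i <= cvm w.2] `&`
      [set w : pt d * R | cvm w.2 <= cs w.1.2 i.+1]).
      by apply: closedI; apply: closed_lef => //; apply: (continuous_compf (@cs_continuous _ _)).
    by apply/seteqP; split => w /=; [move=> /andP[]|move=> [h1 h2]; apply/andP].
  + move=> w; have [ck cc] := ciP w.2 d.2 w.1.2.
    by exists (Ordinal (ck : (_ < d.2.+1)%N)).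
  + by move=> i w c; apply: FE => //; exact: leq_ord.
  + move=> i; apply: (continuous_compf (@cls_continuous _ _ _)); apply: continuous_pair => //.
    apply: (@continuous_compf _ _ _ (fun w : simplex d.2 * R => cut i w.2 w.1)
      (fun w : pt d * R => (w.1.2, w.2))); first exact: cut_continuous.
    by apply: continuous_pair => //; exact: continuous_snd.
- move=> d d' h b p u; have [ik c] := ciP u d'.2 p.2.
  rewrite (FE d' (bact h b) (p, u) _ ik c) (FE d b (push h p, u) (h.2 (ci u d'.2 p.2)));
    [|exact: mf_le|exact: cutting_push].
  by rewrite /Fi /= pr_act // cls_act /push /= cut_push.
exists H; split => //.
- move=> d b p u u0; rewrite HE (FE _ _ _ d.2) // /Fi /= ?cut_low -?pr_low ?cls_act //.
    by rewrite /push /= spush_id.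
  rewrite /cutting cs_end /cvm clamp0 // subr0 lexx andbT.
  by rewrite -(cs_end p.2); exact: cs_homo.
- move=> d b p u u1; rewrite HE (FE _ _ _ 0%N) // /Fi /= ?cut_high -?pr_high ?cls_act //.
    by rewrite /push /= spush_id.
  by rewrite /cutting cs0 /cvm clamp1 // subrr lexx -(cs0 p.2) cs_homo.
- move=> d b p u; rewrite HE /F /Fi /=; have [ik _] := ciP u d.2 p.2.
  by do 2 eexists; split; first exact: ik.
Qed.

End Cylinder.

(** * Grids *)

Lemma mf_max m n (f : mono m n) a b : f (maxn a b) = maxn (f a) (f b).
Proof.
case: (leqP a b) => h; first by rewrite (maxn_idPr (mf_homo f h)).
by rewrite (maxn_idPl (mf_homo f (ltnW h))).
Qed.

Section Grids.
Variable C : squaresCat.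
Local Notation O := (sqc_O C).

(* A chain of [k] morphisms between objects of level [n] of the collage of T and S.
   Rows are indexed by [a], positions by [j <= l]: [gob a j l] is [A_{jl}] (for a T-object
   [C] it is [C_l], with identity vertical maps), [gh], [gv] are its composite structure
   maps, [gf a b] is the composite of the chain from row [a] to row [b], and [gm a] says
   that row [a] is an S-object.  Indices out of range are clamped and sorted, so that
   simplicial operators act by plain reindexing. *)
Record gdata := GData {
  gob : nat -> nat -> nat -> dob C;
  gh : nat -> nat -> nat -> nat -> hmor C;
  gv : nat -> nat -> nat -> nat -> vmor C;
  gf : nat -> nat -> nat -> nat -> vmor C;
  gm : nat -> bool }.

Lemma gdata_eq x y :
  (forall a j l, gob x a j l = gob y a j l) ->
  (forall a j l l', gh x a j l l' = gh y a j l l') ->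
  (forall a j j' l, gv x a j j' l = gv y a j j' l) ->
  (forall a b j l, gf x a b j l = gf y a b j l) ->
  (forall a, gm x a = gm y a) -> x = y.
Proof.
case: x y => [c1 h1 v1 f1 m1] [c2 h2 v2 f2 m2] /= ho hh hv hf hm.
have -> : c1 = c2 by apply/funext => a; apply/funext => j; apply/funext => l.
have -> : h1 = h2.
  by apply/funext => a; apply/funext => j; apply/funext => l; apply/funext => l'.
have -> : v1 = v2.
  by apply/funext => a; apply/funext => j; apply/funext => l; apply/funext => l'.
have -> : f1 = f2.
  by apply/funext => a; apply/funext => j; apply/funext => l; apply/funext => l'.
by have -> : m1 = m2 by apply/funext.
Qed.

(** The fields ending in 1 clamp indices and those ending in 2 sort them. By [g_mm] a chain may pass
    from T to S but not back. *)
Record isG (n k : nat) (g : gdata) : Prop := IsG {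
  g_ob1 : forall a j l, gob g a j l = gob g (minn a k) (minn j n) (minn l n);
  g_ob2 : forall a j l, gob g a j l = gob g a j (maxn j l);
  g_h1 : forall a j l l', gh g a j l l' = gh g (minn a k) (minn j n) (minn l n) (minn l' n);
  g_h2 : forall a j l l', gh g a j l l' = gh g a j (maxn j l) (maxn (maxn j l) l');
  g_v1 : forall a j j' l, gv g a j j' l = gv g (minn a k) (minn j n) (minn j' n) (minn l n);
  g_v2 : forall a j j' l, gv g a j j' l = gv g a j (maxn j j') (maxn (maxn j j') l);
  g_f1 : forall a b j l, gf g a b j l = gf g (minn a k) (minn b k) (minn j n) (minn l n);
  g_f2 : forall a b j l, gf g a b j l = gf g a (maxn a b) j (maxn j l);
  g_m1 : forall a, gm g a = gm g (minn a k);
  g_hs : forall a j l l', j <= l -> l <= l' -> hs (gh g a j l l') = gob g a j l;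
  g_ht : forall a j l l', j <= l -> l <= l' -> ht (gh g a j l l') = gob g a j l';
  g_vs : forall a j j' l, j <= j' -> j' <= l -> vs (gv g a j j' l) = gob g a j l;
  g_vt : forall a j j' l, j <= j' -> j' <= l -> vt (gv g a j j' l) = gob g a j' l;
  g_fs : forall a b j l, a <= b -> j <= l -> vs (gf g a b j l) = gob g a j l;
  g_ft : forall a b j l, a <= b -> j <= l -> vt (gf g a b j l) = gob g b j l;
  g_hid : forall a j l, j <= l -> gh g a j l l = hid (gob g a j l);
  g_vid : forall a j l, j <= l -> gv g a j j l = vid (gob g a j l);
  g_fid : forall a j l, j <= l -> gf g a a j l = vid (gob g a j l);
  g_hc : forall a j l l' l'', j <= l -> l <= l' -> l' <= l'' ->
    hcomp (gh g a j l' l'') (gh g a j l l') = gh g a j l l'';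
  g_vc : forall a j j' j'' l, j <= j' -> j' <= j'' -> j'' <= l ->
    vcomp (gv g a j' j'' l) (gv g a j j' l) = gv g a j j'' l;
  g_fc : forall a b c j l, a <= b -> b <= c -> j <= l ->
    vcomp (gf g b c j l) (gf g a b j l) = gf g a c j l;
  g_sq : forall a j j' l l', j <= j' -> j' <= l -> l <= l' ->
    dsq (gh g a j l l') (gv g a j j' l) (gv g a j j' l') (gh g a j' l l');
  g_sqf : forall a b j l l', a <= b -> j <= l -> l <= l' ->
    dsq (gh g a j l l') (gf g a b j l) (gf g a b j l') (gh g b j l l');
  g_nat : forall a b j j' l, a <= b -> j <= j' -> j' <= l ->
    vcomp (gf g a b j' l) (gv g a j j' l) = vcomp (gv g b j j' l) (gf g a b j l);
  g_mm : forall a b, a <= b -> gm g a -> gm g b;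
  g_T : forall a j j' l, ~~ gm g a -> j <= j' -> j' <= l -> gv g a j j' l = vid (gob g a j l);
  g_Th : forall a j j' l l', ~~ gm g a -> j <= j' -> j' <= l -> l <= l' ->
    gh g a j l l' = gh g a j' l l';
  g_S : forall a j, gm g a -> gob g a j j = O }.

Definition gact n n' k k' (t : mono n' n) (p : mono k' k) (g : gdata) : gdata :=
  GData (fun a j l => gob g (p a) (t j) (t l))
        (fun a j l l' => gh g (p a) (t j) (t l) (t l'))
        (fun a j j' l => gv g (p a) (t j) (t j') (t l))
        (fun a b j l => gf g (p a) (p b) (t j) (t l))
        (fun a => gm g (p a)).

Lemma isG_act n n' k k' (t : mono n' n) (p : mono k' k) g : isG n k g -> isG n' k' (gact t p g).
Proof.
move=> H; have ht := mf_homo t; have hp := mf_homo p.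
split => /=; rewrite ?mf_max.
- by move=> a j l; rewrite -(mf_norm p a) -(mf_norm t j) -(mf_norm t l).
- by move=> a j l; rewrite mf_max; exact: (g_ob2 H).
- by move=> a j l l'; rewrite -(mf_norm p a) -(mf_norm t j) -(mf_norm t l) -(mf_norm t l').
- by move=> a j l l'; rewrite !mf_max; exact: (g_h2 H).
- by move=> a j j' l; rewrite -(mf_norm p a) -(mf_norm t j) -(mf_norm t l) -(mf_norm t j').
- by move=> a j j' l; rewrite !mf_max; exact: (g_v2 H).
- by move=> a b j l; rewrite -(mf_norm p a) -(mf_norm t j) -(mf_norm t l) -(mf_norm p b).
- by move=> a b j l; rewrite !mf_max; exact: (g_f2 H).
- by move=> a; rewrite -(mf_norm p a).
- by move=> a j l l' /ht h1 /ht h2; exact: (g_hs H).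
- by move=> a j l l' /ht h1 /ht h2; exact: (g_ht H).
- by move=> a j l l' /ht h1 /ht h2; exact: (g_vs H).
- by move=> a j l l' /ht h1 /ht h2; exact: (g_vt H).
- by move=> a j l l' /hp h1 /ht h2; exact: (g_fs H).
- by move=> a j l l' /hp h1 /ht h2; exact: (g_ft H).
- by move=> a j l /ht h1; exact: (g_hid H).
- by move=> a j l /ht h1; exact: (g_vid H).
- by move=> a j l /ht h1; exact: (g_fid H).
- by move=> a j l l' l'' /ht h1 /ht h2 /ht h3; exact: (g_hc H).
- by move=> a j l l' l'' /ht h1 /ht h2 /ht h3; exact: (g_vc H).
- by move=> a b c j l /hp h1 /hp h2 /ht h3; exact: (g_fc H).
- by move=> a j l l' l'' /ht h1 /ht h2 /ht h3; exact: (g_sq H).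
- by move=> a b j l l' /hp h1 /ht h2 /ht h3; exact: (g_sqf H).
- by move=> a b j l l' /hp h1 /ht h2 /ht h3; exact: (g_nat H).
- by move=> a b /hp h1; exact: (g_mm H).
- by move=> a j j' l h /ht h1 /ht h2; exact: (g_T H).
- by move=> a j j' l l' h /ht h1 /ht h2 /ht h3; exact: (g_Th H).
- by move=> a j; exact: (g_S H).
Qed.

Lemma gact_id n k g : isG n k g -> gact (mid n) (mid k) g = g.
Proof.
move=> H; apply: gdata_eq => * /=.
- by rewrite -(g_ob1 H).
- by rewrite -(g_h1 H).
- by rewrite -(g_v1 H).
- by rewrite -(g_f1 H).
- by rewrite -(g_m1 H).
Qed.

(** The collage is the same for both [b]; the marks single out the end onto which it is to be
    deformed. *)
Definition gset (b : bool) : bset.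
Proof.
refine (@Bset (fun d => {g : gdata | isG d.1 d.2 g})
  (fun d d' h g => exist _ (gact h.1 h.2 (sval g)) (isG_act h.1 h.2 (svalP g)))
  (fun d g => forall a, gm (sval g) a = b) _ _ _).
- by move=> d [g H]; apply: sval_inj; exact: gact_id.
- by move=> *; apply: sval_inj.
- by move=> d d' h g h1 a /=; exact: h1.
Defined.

Lemma gset_mark b d j (t : mono d.1 j) (c : gset b (j, d.2)) :
  bmk (bact ((t, mid d.2) : hom d (j, d.2)) c) -> bmk c.
Proof. by move=> h a; have := h a; rewrite /= -(g_m1 (svalP c)). Qed.

Record isTr (n k : nat) (x0 x1 : gdata) (tr : nat -> nat -> nat -> vmor C) : Prop := IsTr {
  t_1 : forall a j l, tr a j l = tr (minn a k) (minn j n) (minn l n);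
  t_2 : forall a j l, tr a j l = tr a j (maxn j l);
  t_s : forall a j l, j <= l -> vs (tr a j l) = gob x0 a j l;
  t_t : forall a j l, j <= l -> vt (tr a j l) = gob x1 a j l;
  t_sq : forall a j l l', j <= l -> l <= l' ->
    dsq (gh x0 a j l l') (tr a j l) (tr a j l') (gh x1 a j l l');
  t_v : forall a j j' l, j <= j' -> j' <= l ->
    vcomp (tr a j' l) (gv x0 a j j' l) = vcomp (gv x1 a j j' l) (tr a j l);
  t_f : forall a b j l, a <= b -> j <= l ->
    vcomp (tr b j l) (gf x0 a b j l) = vcomp (gf x1 a b j l) (tr a j l);
  t_m : forall a, gm x0 a -> gm x1 a }.

(** A composite that crosses the cut applies [tr] at its first row; by [t_f], crossing at any other
    row gives the same. *)
Definition prism (i : nat) (x0 x1 : gdata) (tr : nat -> nat -> nat -> vmor C) : gdata :=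
  GData (fun a j l => if a <= i then gob x0 a j l else gob x1 a.-1 j l)
        (fun a j l l' => if a <= i then gh x0 a j l l' else gh x1 a.-1 j l l')
        (fun a j j' l => if a <= i then gv x0 a j j' l else gv x1 a.-1 j j' l)
        (fun a b j l => if maxn a b <= i then gf x0 a b j l
           else if a <= i then vcomp (gf x1 a b.-1 j l) (tr a j l) else gf x1 a.-1 b.-1 j l)
        (fun a => if a <= i then gm x0 a else gm x1 a.-1).

Section Prism.
Variables (n k i : nat) (x0 x1 : gdata) (tr : nat -> nat -> nat -> vmor C).
Hypotheses (H0 : isG n k x0) (H1 : isG n k x1) (HT : isTr n k x0 x1 tr) (ik : i <= k).

Lemma isG_prism : isG n k.+1 (prism i x0 x1 tr).
Proof.
have ai a : (minn a k.+1 <= i) = (a <= i) by lia.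
have mab a b : (maxn (minn a k.+1) (minn b k.+1) <= i) = (maxn a b <= i) by lia.
have mx a b : (maxn a (maxn a b) <= i) = (maxn a b <= i) by lia.
split => /=.
- move=> a j l; rewrite ai; case: ifP => h;
    [rewrite [LHS](g_ob1 H0) [RHS](g_ob1 H0)|rewrite [LHS](g_ob1 H1) [RHS](g_ob1 H1)]; congr gob; lia.
- by move=> a j l; case: ifP => h; [exact: (g_ob2 H0)|exact: (g_ob2 H1)].
- move=> a j l l'; rewrite ai; case: ifP => h;
    [rewrite [LHS](g_h1 H0) [RHS](g_h1 H0)|rewrite [LHS](g_h1 H1) [RHS](g_h1 H1)]; congr gh; lia.
- by move=> a j l l'; case: ifP => h; [exact: (g_h2 H0)|exact: (g_h2 H1)].
- move=> a j l l'; rewrite ai; case: ifP => h;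
    [rewrite [LHS](g_v1 H0) [RHS](g_v1 H0)|rewrite [LHS](g_v1 H1) [RHS](g_v1 H1)]; congr gv; lia.
- by move=> a j l l'; case: ifP => h; [exact: (g_v2 H0)|exact: (g_v2 H1)].
- move=> a b j l; rewrite ai mab; case: ifP => h.
    by rewrite [LHS](g_f1 H0) [RHS](g_f1 H0); congr gf; lia.
  case: ifP => h'; last by rewrite [LHS](g_f1 H1) [RHS](g_f1 H1); congr gf; lia.
  congr vcomp; first by rewrite [LHS](g_f1 H1) [RHS](g_f1 H1); congr gf; lia.
  by rewrite [LHS](t_1 HT) [RHS](t_1 HT); congr tr; lia.
- move=> a b j l; rewrite mx; case: ifP => h; first exact: (g_f2 H0).
  case: ifP => h'; last by rewrite [LHS](g_f2 H1) [RHS](g_f2 H1); congr gf; lia.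
  congr vcomp; first by rewrite [LHS](g_f2 H1) [RHS](g_f2 H1); congr gf; lia.
  exact: (t_2 HT).
- move=> a; rewrite ai; case: ifP => h;
    [rewrite [LHS](g_m1 H0) [RHS](g_m1 H0)|rewrite [LHS](g_m1 H1) [RHS](g_m1 H1)]; congr gm; lia.
- by move=> a j l l' h1 h2; case: ifP => _; [exact: (g_hs H0)|exact: (g_hs H1)].
- by move=> a j l l' h1 h2; case: ifP => _; [exact: (g_ht H0)|exact: (g_ht H1)].
- by move=> a j l l' h1 h2; case: ifP => _; [exact: (g_vs H0)|exact: (g_vs H1)].
- by move=> a j l l' h1 h2; case: ifP => _; [exact: (g_vt H0)|exact: (g_vt H1)].
- move=> a b j l ab jl; rewrite (maxn_idPr ab); case: ifP => h.
    by rewrite (leq_trans ab h); exact: (g_fs H0).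
  case: ifP => h'; last by apply: (g_fs H1) => //; lia.
  by rewrite vs_comp ?(t_s HT) // (t_t HT) // (g_fs H1) //; lia.
- move=> a b j l ab jl; rewrite (maxn_idPr ab); case: ifP => h; first exact: (g_ft H0).
  case: ifP => h'; last by apply: (g_ft H1) => //; lia.
  have ab' : a <= b.-1 by lia.
  by rewrite vt_comp ?(g_ft H1) // (t_t HT) // (g_fs H1).
- by move=> a j l h; case: ifP => _; [exact: (g_hid H0)|exact: (g_hid H1)].
- by move=> a j l h; case: ifP => _; [exact: (g_vid H0)|exact: (g_vid H1)].
- by move=> a j l h; rewrite maxnn; case: ifP => h'; rewrite ?h'; [exact: (g_fid H0)|exact: (g_fid H1)].
- by move=> a j l l' l'' *; case: ifP => _; [exact: (g_hc H0)|exact: (g_hc H1)].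
- by move=> a j l l' l'' *; case: ifP => _; [exact: (g_vc H0)|exact: (g_vc H1)].
- move=> a b c j l ab bc jl; rewrite (maxn_idPr ab) (maxn_idPr bc) (maxn_idPr (leq_trans ab bc)).
  have [ci|ic] := leqP c i.
    by rewrite (leq_trans bc ci); exact: (g_fc H0).
  have [bi|ib] := leqP b i.
    have h1 : b <= c.-1 by lia.
    rewrite (leq_trans ab bi) -vcompA ?(g_ft H0) ?(t_s HT) ?(t_t HT) ?(g_fs H1) //.
    rewrite (t_f HT) // vcompA ?(t_t HT) ?(g_fs H1) ?(g_ft H1) //.
    by rewrite (g_fc H1).
  have h1 : b.-1 <= c.-1 by lia.
  have [ai'|ia] := leqP a i; last by apply: (g_fc H1) => //; lia.
  have h2 : a <= b.-1 by lia.
  by rewrite vcompA ?(t_t HT) ?(g_fs H1) ?(g_ft H1) // (g_fc H1).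
- by move=> a j l l' l'' *; case: ifP => _; [exact: (g_sq H0)|exact: (g_sq H1)].
- move=> a b j l l' ab jl ll; rewrite (maxn_idPr ab).
  have [bi|ib] := leqP b i; first by rewrite (leq_trans ab bi); exact: (g_sqf H0).
  have [ai'|ia] := leqP a i; last by apply: (g_sqf H1) => //; lia.
  apply: dsq_vcomp; first exact: (t_sq HT).
  by apply: (g_sqf H1) => //; lia.
- move=> a b j j' l ab jj jl; rewrite (maxn_idPr ab).
  have [bi|ib] := leqP b i; first by rewrite (leq_trans ab bi); exact: (g_nat H0).
  have [ai'|ia] := leqP a i; last by apply: (g_nat H1) => //; lia.
  have h1 : a <= b.-1 by lia.
  have jl' := leq_trans jj jl.
  rewrite -vcompA ?(g_vt H0) ?(t_s HT) ?(t_t HT) ?(g_fs H1) // (t_v HT) //.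
  rewrite !vcompA ?(t_t HT) ?(g_fs H1) ?(g_vs H1) ?(g_vt H1) ?(g_ft H1) //.
  by rewrite (g_nat H1).
- move=> a b ab; case: ifP => ai'; case: ifP => bi.
  + exact: (g_mm H0).
  + by move=> /(t_m HT); apply: (g_mm H1); lia.
  + by lia.
  + by apply: (g_mm H1); lia.
- by move=> a j j' l; case: ifP => _ *; [exact: (g_T H0)|exact: (g_T H1)].
- by move=> a j j' l l'; case: ifP => _ *; [exact: (g_Th H0)|exact: (g_Th H1)].
- by move=> a j; case: ifP => _ *; [exact: (g_S H0)|exact: (g_S H1)].
Qed.

Lemma prism_low : i = k -> gact (mid n) (mlow k) (prism i x0 x1 tr) = x0.
Proof.
move=> iE; have mk a : minn a k <= i by lia.
have mk2 a b : maxn (minn a k) (minn b k) <= i by lia.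
apply: gdata_eq => * /=; rewrite ?mk ?mk2.
- by rewrite -(g_ob1 H0).
- by rewrite -(g_h1 H0).
- by rewrite -(g_v1 H0).
- by rewrite -(g_f1 H0).
- by rewrite -(g_m1 H0).
Qed.

Lemma prism_high : i = 0 -> gact (mid n) (mhigh k) (prism i x0 x1 tr) = x1.
Proof.
move=> iE; have mk a : ((minn a k).+1 <= i) = false by lia.
have mk2 a b : (maxn (minn a k).+1 (minn b k).+1 <= i) = false by lia.
apply: gdata_eq => * /=; rewrite ?mk ?mk2.
- by rewrite -(g_ob1 H1).
- by rewrite -(g_h1 H1).
- by rewrite -(g_v1 H1).
- by rewrite -(g_f1 H1).
- by rewrite -(g_m1 H1).
Qed.

Lemma prism_indep i2 (e : mono k.+1 k.+1) : i < i2 -> (forall x, e x <= i \/ i2 < e x) ->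
  gact (mid n) e (prism i x0 x1 tr) = gact (mid n) e (prism i2 x0 x1 tr).
Proof.
move=> ii h; have E x : (e x <= i) = (e x <= i2) by case: (h x); lia.
have E2 x y : (maxn (e x) (e y) <= i) = (maxn (e x) (e y) <= i2).
  by rewrite !geq_max !E.
by apply: gdata_eq => * /=; rewrite ?E2 ?E.
Qed.

Lemma prism_act k' (p : mono k' k) i' : i' <= k' -> i = p i' ->
  prism i' (gact (mid n) p x0) (gact (mid n) p x1) (fun a j l => tr (p a) (minn j n) (minn l n)) =
  gact (mid n) (mlift i' p) (prism i x0 x1 tr).
Proof.
move=> ik' iE.
have E a : ((if a <= minn i' k' then p a else (p a.-1).+1) <= i) = (a <= i').
  rewrite iE (minn_idPl ik'); case: ifP => h; first by rewrite (mf_homo p h).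
  by apply/negbTE; rewrite -ltnNge ltnS; apply: mf_homo; lia.
have E2 a b : (maxn (if a <= minn i' k' then p a else (p a.-1).+1)
    (if b <= minn i' k' then p b else (p b.-1).+1) <= i) = (maxn a b <= i').
  by rewrite !geq_max !E.
apply: gdata_eq => [a j l|a j l l'|a j j' l|a b j l|a] /=; rewrite ?E2 ?E (minn_idPl ik').
1-3: by case: ifP.
- case: ifP => h.
    by have [-> ->] : a <= i' /\ b <= i' by lia.
  case: ifP => h'; first by have -> : (b <= i') = false by lia.
  (* Here [b] is on the source side and [a] on the target side, so the row indices are in the wrong
     order and sorting makes the two entries equal. *)
  case: ifP => h2 //; rewrite [LHS](g_f2 H1) [RHS](g_f2 H1); congr gf.
  have := mf_homo p (_ : b <= a.-1); have := mf_homo p (_ : b.-1 <= a.-1).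
  by move=> /(_ ltac:(lia)) + /(_ ltac:(lia)); lia.
- by case: ifP.
Qed.

End Prism.

Section LevelCylinder.
(** Naturality is asked for chain operators only, with [n] fixed, since the retractions do not
    commute with operators on [[n]]. *)
Variables (n : nat) (X0 X1 : gdata -> gdata) (tr : gdata -> nat -> nat -> nat -> vmor C).
Hypothesis X0P : forall k g, isG n k g -> isG n k (X0 g).
Hypothesis X1P : forall k g, isG n k g -> isG n k (X1 g).
Hypothesis trP : forall k g, isG n k g -> isTr n k (X0 g) (X1 g) (tr g).
Hypothesis X0N : forall k k' (p : mono k' k) g, isG n k g ->
  X0 (gact (mid n) p g) = gact (mid n) p (X0 g).
Hypothesis X1N : forall k k' (p : mono k' k) g, isG n k g ->
  X1 (gact (mid n) p g) = gact (mid n) p (X1 g).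
Hypothesis trN : forall k k' (p : mono k' k) g, isG n k g -> forall a j l,
  tr (gact (mid n) p g) a j l = tr g (p a) (minn j n) (minn l n).

Variables (b : bool) (m : nat) (q : forall a, mono a m -> Prop) (cq : mclosed q).
Local Notation B := (bsub (qlev_closed (M := gset b) (n := n) cq)).

Definition lX0 d (x : B d) : B d :=
  exist (qlev (M := gset b) q (d:=d)) (exist (isG n d.2) _ (X0P (svalP (sval x).1)), (sval x).2) (svalP x).

Definition lX1 d (x : B d) : B d :=
  exist (qlev (M := gset b) q (d:=d)) (exist (isG n d.2) _ (X1P (svalP (sval x).1)), (sval x).2) (svalP x).

Lemma lpr_subproof d (x : B d) i :
  isG n d.2.+1 (prism (minn i d.2) (X0 (sval (sval x).1)) (X1 (sval (sval x).1)) (tr (sval (sval x).1))).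
Proof.
have H := svalP (sval x).1; apply: isG_prism; [exact: X0P|exact: X1P|exact: trP|exact: geq_minr].
Qed.

Definition lpr d (x : B d) (i : nat) : B (d.1, d.2.+1) :=
  exist (qlev (M := gset b) q (d:=(d.1, d.2.+1)))
    (exist (isG n d.2.+1) _ (lpr_subproof x i), (sval x).2) (svalP x).

Lemma level_cylinder : exists H : breal B * R -> breal B, [/\ continuous H,
  forall d (x : B d) p u, (u <= 0)%R -> H (cls x p, u) = cls (lX0 x) p,
  forall d (x : B d) p u, (1 <= u)%R -> H (cls x p, u) = cls (lX1 x) p
  & forall d (x : B d) p u, exists i y, (i <= d.2)%N /\ H (cls x p, u) = cls (lpr x i) y].
Proof.
apply: cylinder.
- move=> d d' h x i id; apply: sval_inj => /=.
  congr pair; apply: sval_inj => /=.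
  have H := svalP (sval x).1; rewrite (minn_idPl id) (minn_idPl (mf_le h.2 i)).
  rewrite -(@prism_act n d.2 (h.2 i) _ _ _ (X1P H) (mf_le h.2 i) d'.2 h.2 i id erefl) X0N // X1N //.
  congr prism; apply/funext => a; apply/funext => j; apply/funext => l.
  by rewrite trN.
- move=> d x; apply: sval_inj => /=; congr pair; last by rewrite mcomp_idr.
  apply: sval_inj => /=; have H := svalP (sval x).1; rewrite minnn.
  by apply: prism_low => //; exact: X0P.
- move=> d x; apply: sval_inj => /=; congr pair; last by rewrite mcomp_idr.
  apply: sval_inj => /=; have H := svalP (sval x).1; rewrite min0n.
  by apply: prism_high => //; exact: X1P.
- move=> d x i i2 e ii id he; apply: sval_inj => /=; congr pair.
  apply: sval_inj => /=; have iid : i <= d.2 by lia.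
  by rewrite (minn_idPl id) (minn_idPl iid); apply: prism_indep.
Qed.

End LevelCylinder.

End Grids.

(** * Iterated quotients *)

Section Quotients.
Variables (C : squaresCat) (W : protoWaldhausen C).
Local Notation O := (sqc_O C).

Lemma term_ex (A : dob C) : exists u : vmor C, vs u = A /\ vt u = O.
Proof. by have [u [hu _]] := sqc_term A; exists u. Qed.

Definition term A : vmor C := sval (cid (term_ex A)).

Lemma vs_term A : vs (term A) = A. Proof. by case: (svalP (cid (term_ex A))). Qed.
Lemma vt_term A : vt (term A) = O. Proof. by case: (svalP (cid (term_ex A))). Qed.

Lemma term_uniq (u w : vmor C) : vs u = vs w -> vt u = O -> vt w = O -> u = w.
Proof.
move=> uw tu tw; have [x [_ hx]] := sqc_term (vs w).
by rewrite -(hx u) // -(hx w).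
Qed.

Lemma vid_vid A : vcomp (vid A) (vid A) = vid A :> vmor C.
Proof. by rewrite -[in X in vcomp _ X](@vs_id C A) vcomp_idr. Qed.

(* Total versions of the structure of [W]; the values on incompatible boundaries are junk. *)
Definition sg (f : hmor C) (u : vmor C) : hmor C :=
  match pselect (hs f = vs u) with left H => s_g W (SpanC H) | right _ => f end.

Definition sv (f : hmor C) (u : vmor C) : vmor C :=
  match pselect (hs f = vs u) with left H => s_v W (SpanC H) | right _ => u end.

Definition smor f u f' u' (ta tb tc : vmor C) : vmor C :=
  match pselect (hs f = vs u), pselect (hs f' = vs u') with
  | left H, left H' => match pselect (isSpanMor (SpanC H) (SpanC H') ta tb tc) with
    | left K => s_mor W K | right _ => ta end
  | _, _ => ta end.

Definition wd f u v g : vmor C :=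
  match pselect (dsq f u v g) with left H => w_d W (SqC H) | right _ => u end.

Lemma dsq_sg f u : hs f = vs u -> dsq f u (sv f u) (sg f u).
Proof. by move=> fu; rewrite /sg /sv; case: pselect => // H; exact: (s_sq W (SpanC H)). Qed.

Definition spanmor f u f' u' (ta tb tc : vmor C) :=
  [/\ hs f = vs u, hs f' = vs u', dsq f ta tb f', vcomp tc u = vcomp u' ta
    & vs tc = vt u /\ vt tc = vt u'].

Lemma smorE f u f' u' ta tb tc (H : hs f = vs u) (H' : hs f' = vs u')
    (K : isSpanMor (SpanC H) (SpanC H') ta tb tc) : smor f u f' u' ta tb tc = s_mor W K.
Proof.
rewrite /smor; case: pselect => // h1; case: pselect => // h2.
move: K; rewrite (Prop_irrelevance H h1) (Prop_irrelevance H' h2) => K.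
by case: pselect => // K'; rewrite (Prop_irrelevance K K').
Qed.

Lemma spanmorP f u f' u' ta tb tc (H : hs f = vs u) (H' : hs f' = vs u') :
  spanmor f u f' u' ta tb tc -> isSpanMor (SpanC H) (SpanC H') ta tb tc.
Proof. by move=> [_ _ sq cm ?]; have [? [? [? ?]]] := dsq_bd sq. Qed.

Lemma smor_ok f u f' u' ta tb tc : spanmor f u f' u' ta tb tc ->
  dsq (sg f u) tc (smor f u f' u' ta tb tc) (sg f' u') /\
  vcomp (smor f u f' u' ta tb tc) (sv f u) = vcomp (sv f' u') tb.
Proof.
move=> sp; have [H H' _ _ _] := sp; rewrite (smorE (spanmorP H H' sp)) /sg /sv.
case: pselect => // h1; case: pselect => // h2.
move: (spanmorP H H' sp); rewrite (Prop_irrelevance H h1) (Prop_irrelevance H' h2) => K.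
by have [_ _ ? _ ?] := s_mor_ok W K.
Qed.

Lemma smor_id f u : hs f = vs u ->
  smor f u f u (vid (hs f)) (vid (ht f)) (vid (vt u)) = vid (ht (sg f u)).
Proof.
move=> H; have K : isSpanMor (SpanC H) (SpanC H) (vid (hs f)) (vid (ht f)) (vid (vt u)).
  split; rewrite /= ?vs_id ?vt_id //; first exact: dsq_vid.
  by rewrite vcomp_idl H vcomp_idr.
rewrite (smorE K) s_mor_id /sg; case: pselect => // h.
by rewrite (Prop_irrelevance H h).
Qed.

Lemma spanmor_comp f u f' u' f'' u'' ta tb tc ta' tb' tc' :
  spanmor f u f' u' ta tb tc -> spanmor f' u' f'' u'' ta' tb' tc' ->
  spanmor f u f'' u'' (vcomp ta' ta) (vcomp tb' tb) (vcomp tc' tc).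
Proof.
move=> [h1 h2 sq cm [e1 e2]] [h3 h4 sq' cm' [e3 e4]].
have [b1 [b2 [b3 b4]]] := dsq_bd sq; have [b1' [b2' [b3' b4']]] := dsq_bd sq'.
split => //; first exact: dsq_vcomp sq sq'.
- rewrite -vcompA ?e1 ?e2 ?e3 // cm vcompA ?b3 ?h2 ?e3 // cm' -vcompA //.
  + by rewrite b3 b1'.
  + by rewrite b3' h4.
- by rewrite vs_comp ?vt_comp ?e2 ?e3.
Qed.

Lemma smor_comp f u f' u' f'' u'' ta tb tc ta' tb' tc' :
  spanmor f u f' u' ta tb tc -> spanmor f' u' f'' u'' ta' tb' tc' ->
  smor f u f'' u'' (vcomp ta' ta) (vcomp tb' tb) (vcomp tc' tc) =
  vcomp (smor f' u' f'' u'' ta' tb' tc') (smor f u f' u' ta tb tc).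
Proof.
move=> sp sp'; have sp'' := spanmor_comp sp sp'.
have [h1 h2 _ _ _] := sp; have [_ h3 _ _ _] := sp'.
rewrite (smorE (spanmorP h1 h3 sp'')) (smorE (spanmorP h1 h2 sp)) (smorE (spanmorP h2 h3 sp')).
exact: s_mor_comp.
Qed.

Lemma ht_sg f u : hs f = vs u -> ht (sg f u) = vt (sv f u).
Proof. by move=> /dsq_sg /dsq_bd[_ [_ [_ ->]]]. Qed.
Lemma vs_sv f u : hs f = vs u -> vs (sv f u) = ht f.
Proof. by move=> /dsq_sg /dsq_bd[_ [-> _]]. Qed.

Lemma wd_ok f u v g : dsq f u v g ->
  dsq (sg f u) (vid (vt u)) (wd f u v g) g /\ vcomp (wd f u v g) (sv f u) = v.
Proof.
move=> sq; rewrite /wd; case: pselect => // H.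
have [_ _ h1 _ h2] := w_ok W (SqC H).
have [b1 [b2 _]] := dsq_bd sq.
have hfu : hs f = vs u by rewrite b1.
rewrite /sg /sv; case: pselect => // h; rewrite /= in h1 h2.
move: h1 h2; rewrite /iObj (Prop_irrelevance (sqC_span_ok (SqC H)) h) /= => h1 h2.
by split => //; rewrite h2 -b2 vcomp_idr.
Qed.

Lemma wd_nat f u v g f' u' v' g' ma mb mc md :
  dsq f u v g -> dsq f' u' v' g' -> dsq f ma mb f' -> dsq g mc md g' ->
  vcomp mc u = vcomp u' ma -> vcomp md v = vcomp v' mb ->
  vcomp md (wd f u v g) = vcomp (wd f' u' v' g') (smor f u f' u' ma mb mc).
Proof.
move=> sq sq' m1 m2 c1 c2; rewrite /wd; case: pselect => // H; case: pselect => // H'.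
have [b1 [b2 [b3 b4]]] := dsq_bd m1; have [d1 [d2 [d3 d4]]] := dsq_bd m2.
have K : isSqMor (SqC H) (SqC H') ma mb mc md by split.
have [e1 [e2 [e3 e4]]] := dsq_bd H; have [e1' [e2' [e3' e4']]] := dsq_bd H'.
have sp : spanmor f u f' u' ma mb mc by split; rewrite ?e1 ?e1' ?e3 ?e3'.
rewrite (smorE (spanmorP (sqC_span_ok (SqC H)) (sqC_span_ok (SqC H')) sp)).
exact: w_nat.
Qed.

Record row := Row { rob : nat -> dob C; rh : nat -> hmor C }.

Definition vrow s r := forall l, s <= l -> hs (rh r l) = rob r l /\ ht (rh r l) = rob r l.+1.

Definition rmor s r r' (p : nat -> vmor C) := forall l, s <= l ->
  [/\ vs (p l) = rob r l, vt (p l) = rob r' l & dsq (rh r l) (p l) (p l.+1) (rh r' l)].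

(* The map from [r_l] to the quotient [r_l / r_s], obtained by completing squares along the
   row from [r_s ->> O]; junk for [l < s]. *)
Fixpoint qv (s : nat) (r : row) (l : nat) : vmor C :=
  match l with
  | 0 => term (rob r 0)
  | l'.+1 => if l'.+1 <= s then term (rob r l'.+1) else sv (rh r l') (qv s r l')
  end.

Definition Qr s r := Row (fun l => vt (qv s r l)) (fun l => sg (rh r l) (qv s r l)).

Lemma qv_start s r : qv s r s = term (rob r s).
Proof. by case: s => //= s; rewrite ltnSn. Qed.

Lemma qvS s r l : s <= l -> qv s r l.+1 = sv (rh r l) (qv s r l).
Proof. by move=> sl /=; rewrite ltnNge sl. Qed.

Lemma ind_from (s : nat) (P : nat -> Prop) : P s -> (forall l, s <= l -> P l -> P l.+1) ->
  forall l, s <= l -> P l.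
Proof.
move=> h0 hS l sl; rewrite -(subnKC sl); elim: (l - s) => [|k IH]; first by rewrite addn0.
by rewrite addnS; apply: hS => //; exact: leq_addr.
Qed.

Lemma vs_qv s r : vrow s r -> forall l, s <= l -> vs (qv s r l) = rob r l.
Proof.
move=> vr; apply: ind_from => [|l sl IH]; first by rewrite qv_start vs_term.
by have [h1 h2] := vr l sl; rewrite qvS // vs_sv ?h2 // IH.
Qed.

Lemma span_qv s r l : vrow s r -> s <= l -> hs (rh r l) = vs (qv s r l).
Proof. by move=> vr sl; rewrite vs_qv //; have [->] := vr l sl. Qed.

Lemma dsq_qv s r l : vrow s r -> s <= l -> dsq (rh r l) (qv s r l) (qv s r l.+1) (rh (Qr s r) l).
Proof. by move=> vr sl; rewrite qvS //; apply: dsq_sg; exact: span_qv. Qed.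

Lemma vrow_Qr s r : vrow s r -> vrow s (Qr s r).
Proof. by move=> vr l sl; have [_ [_ [h1 h2]]] := dsq_bd (dsq_qv vr sl). Qed.

Lemma vrowS s s' r : s <= s' -> vrow s r -> vrow s' r.
Proof. by move=> ss vr l sl; apply: vr; exact: leq_trans sl. Qed.

Lemma rmorS s s' r r' p : s <= s' -> rmor s r r' p -> rmor s' r r' p.
Proof. by move=> ss vr l sl; apply: vr; exact: leq_trans sl. Qed.

Lemma Qr_start s r : rob (Qr s r) s = O.
Proof. by rewrite /= qv_start vt_term. Qed.

Lemma rmor_qv s r : vrow s r -> rmor s r (Qr s r) (qv s r).
Proof. by move=> vr l sl; split; [exact: vs_qv| |exact: dsq_qv]. Qed.

(** The induced map of quotient rows, obtained from functoriality of the section one square at a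
    time, starting from the identity of [O] in position [s]. *)
Fixpoint Qm (s : nat) (r r' : row) (p : nat -> vmor C) (l : nat) : vmor C :=
  match l with
  | 0 => vid O
  | l'.+1 => if l'.+1 <= s then vid O else
      smor (rh r l') (qv s r l') (rh r' l') (qv s r' l') (p l') (p l'.+1) (Qm s r r' p l')
  end.

Lemma Qm_start s r r' p : Qm s r r' p s = vid O.
Proof. by case: s => //= s; rewrite ltnSn. Qed.

Lemma QmS s r r' p l : s <= l -> Qm s r r' p l.+1 =
  smor (rh r l) (qv s r l) (rh r' l) (qv s r' l) (p l) (p l.+1) (Qm s r r' p l).
Proof. by move=> sl /=; rewrite ltnNge sl. Qed.

(** The statements are proved together because [smor] is meaningful only on a morphism of spans,
    which the preceding position supplies. At [s] both composites end in the terminal object [O]. *)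
Lemma Qm_aux s r r' p : vrow s r -> vrow s r' -> rmor s r r' p -> forall l, s <= l ->
  [/\ vs (Qm s r r' p l) = rob (Qr s r) l, vt (Qm s r r' p l) = rob (Qr s r') l,
      vcomp (Qm s r r' p l) (qv s r l) = vcomp (qv s r' l) (p l)
    & spanmor (rh r l) (qv s r l) (rh r' l) (qv s r' l) (p l) (p l.+1) (Qm s r r' p l)].
Proof.
move=> vr vr' rp.
have sp l : s <= l -> vs (Qm s r r' p l) = rob (Qr s r) l -> vt (Qm s r r' p l) = rob (Qr s r') l ->
    vcomp (Qm s r r' p l) (qv s r l) = vcomp (qv s r' l) (p l) ->
    spanmor (rh r l) (qv s r l) (rh r' l) (qv s r' l) (p l) (p l.+1) (Qm s r r' p l).
  by move=> sl h1 h2 h3; have [? ? ?] := rp l sl; split => //; exact: span_qv.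
apply: ind_from => [|l sl [h1 h2 h3 h4]].
  have h1 : vs (Qm s r r' p s) = rob (Qr s r) s by rewrite Qm_start Qr_start vs_id.
  have h2 : vt (Qm s r r' p s) = rob (Qr s r') s by rewrite Qm_start Qr_start vt_id.
  have [e1 e2 _] := rp s (leqnn s).
  have h3 : vcomp (Qm s r r' p s) (qv s r s) = vcomp (qv s r' s) (p s).
    have q1 : vt (qv s r s) = vs (Qm s r r' p s) by rewrite h1.
    have q2 : vt (p s) = vs (qv s r' s) by rewrite e2 vs_qv.
    apply: term_uniq; rewrite ?vs_comp ?vt_comp ?vs_qv //; last exact: Qr_start.
    by rewrite h2; exact: Qr_start.
  by split => //; exact: sp.
have [sq cm] := smor_ok h4; have sl' := leqW sl.
have [b1 [b2 [b3 b4]]] := dsq_bd sq.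
have k1 : vs (Qm s r r' p l.+1) = rob (Qr s r) l.+1.
  by rewrite QmS // b2; have [_ ->] := vrow_Qr vr sl.
have k2 : vt (Qm s r r' p l.+1) = rob (Qr s r') l.+1.
  by rewrite QmS // b4; have [_ ->] := vrow_Qr vr' sl.
have k3 : vcomp (Qm s r r' p l.+1) (qv s r l.+1) = vcomp (qv s r' l.+1) (p l.+1).
  by rewrite QmS // !qvS.
by split => //; exact: sp.
Qed.

Lemma Qm_rmor s r r' p : vrow s r -> vrow s r' -> rmor s r r' p -> rmor s (Qr s r) (Qr s r') (Qm s r r' p).
Proof.
move=> vr vr' rp l sl; have [h1 h2 _ sp] := Qm_aux vr vr' rp sl; split => //.
by rewrite QmS //; have [] := smor_ok sp.
Qed.

Lemma Qm_qv s r r' p l : vrow s r -> vrow s r' -> rmor s r r' p -> s <= l ->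
  vcomp (Qm s r r' p l) (qv s r l) = vcomp (qv s r' l) (p l).
Proof. by move=> vr vr' rp sl; have [] := Qm_aux vr vr' rp sl. Qed.

Lemma Qm_id s r p : vrow s r -> (forall l, s <= l -> p l = vid (rob r l)) ->
  forall l, s <= l -> Qm s r r p l = vid (rob (Qr s r) l).
Proof.
move=> vr pE; apply: ind_from => [|l sl IH]; first by rewrite Qm_start Qr_start.
have [h1 h2] := vr l sl; have hq := span_qv vr sl.
rewrite QmS // IH pE // pE ?leqW // -h1 -h2 smor_id // ht_sg // -qvS //.
Qed.

Lemma Qm_comp s r r' r'' p p' p'' : vrow s r -> vrow s r' -> vrow s r'' ->
  rmor s r r' p -> rmor s r' r'' p' -> (forall l, s <= l -> p'' l = vcomp (p' l) (p l)) ->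
  forall l, s <= l -> Qm s r r'' p'' l = vcomp (Qm s r' r'' p' l) (Qm s r r' p l).
Proof.
move=> vr vr' vr'' rp rp' pE; apply: ind_from => [|l sl IH].
  by rewrite !Qm_start vid_vid.
have [_ _ _ sp] := Qm_aux vr vr' rp sl; have [_ _ _ sp'] := Qm_aux vr' vr'' rp' sl.
by rewrite !QmS // IH pE // pE ?leqW // (smor_comp sp sp').
Qed.

(* The factorization of [f : r -> D] through the quotient by [r_s], when [D_s = O]. *)
Fixpoint wt (s : nat) (r D : row) (f : nat -> vmor C) (l : nat) : vmor C :=
  match l with
  | 0 => vid O
  | l'.+1 => if l'.+1 <= s then vid O else
      vcomp (wd (rh r l') (f l') (f l'.+1) (rh D l'))
            (smor (rh r l') (qv s r l') (rh r l') (f l') (vid (hs (rh r l'))) (vid (ht (rh r l')))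
                  (wt s r D f l'))
  end.

Lemma wt_start s r D f : wt s r D f s = vid O.
Proof. by case: s => //= s; rewrite ltnSn. Qed.

Lemma wtS s r D f l : s <= l -> wt s r D f l.+1 =
  vcomp (wd (rh r l) (f l) (f l.+1) (rh D l))
        (smor (rh r l) (qv s r l) (rh r l) (f l) (vid (hs (rh r l))) (vid (ht (rh r l))) (wt s r D f l)).
Proof. by move=> sl /=; rewrite ltnNge sl. Qed.

Lemma wt_aux s r D f : vrow s r -> vrow s D -> rob D s = O -> rmor s r D f -> forall l, s <= l ->
  [/\ vs (wt s r D f l) = rob (Qr s r) l, vt (wt s r D f l) = rob D l,
      vcomp (wt s r D f l) (qv s r l) = f l
    & spanmor (rh r l) (qv s r l) (rh r l) (f l) (vid (hs (rh r l))) (vid (ht (rh r l))) (wt s r D f l)].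
Proof.
move=> vr vD D0 rf.
have sp l : s <= l -> vs (wt s r D f l) = rob (Qr s r) l -> vt (wt s r D f l) = rob D l ->
    vcomp (wt s r D f l) (qv s r l) = f l ->
    spanmor (rh r l) (qv s r l) (rh r l) (f l) (vid (hs (rh r l))) (vid (ht (rh r l))) (wt s r D f l).
  move=> sl h1 h2 h3; have [e1 e2 sq] := rf l sl; have [b1 _] := dsq_bd sq.
  split => //; first exact: span_qv.
  - exact: dsq_vid.
  - by rewrite h3 -b1 vcomp_idr.
  - by rewrite h2 e2.
apply: ind_from => [|l sl [h1 h2 h3 h4]].
  have h1 : vs (wt s r D f s) = rob (Qr s r) s by rewrite wt_start Qr_start vs_id.
  have h2 : vt (wt s r D f s) = rob D s by rewrite wt_start D0 vt_id.
  have [e1 e2 _] := rf s (leqnn s).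
  have h3 : vcomp (wt s r D f s) (qv s r s) = f s.
    by apply: term_uniq; rewrite ?vs_comp ?vt_comp ?h1 ?h2 ?e2 ?e1 ?vs_qv.
  by split => //; exact: sp.
have [sq cm] := smor_ok h4; have sl' := leqW sl; have [e1 e2 fsq] := rf l sl.
have [b1 [b2 [b3 b4]]] := dsq_bd sq; have [wsq wE] := wd_ok fsq.
have [d1 [d2 [d3 d4]]] := dsq_bd wsq.
have hf : hs (rh r l) = vs (f l) by have [->] := dsq_bd fsq.
set x := smor _ _ _ _ _ _ _ in sq cm b2 b4; set y := wd _ _ _ _ in wsq wE d2 d4.
have xy : vt x = vs y by rewrite b4 d2.
have k1 : vs (wt s r D f l.+1) = rob (Qr s r) l.+1.
  by rewrite wtS // vs_comp // b2; have [_ ->] := vrow_Qr vr sl.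
have k2 : vt (wt s r D f l.+1) = rob D l.+1.
  by rewrite wtS // vt_comp // d4; have [_ ->] := vD l sl.
have k3 : vcomp (wt s r D f l.+1) (qv s r l.+1) = f l.+1.
  have hq := span_qv vr sl.
  rewrite wtS // qvS // -/x -/y -vcompA //; last by rewrite b2 ht_sg.
  by rewrite cm -(vs_sv hf) vcomp_idr wE.
by split => //; exact: sp.
Qed.

Lemma wt_rmor s r D f : vrow s r -> vrow s D -> rob D s = O -> rmor s r D f ->
  rmor s (Qr s r) D (wt s r D f).
Proof.
move=> vr vD D0 rf l sl; have [h1 h2 h3 sp] := wt_aux vr vD D0 rf sl; split => //.
have [e1 e2 fsq] := rf l sl; have [sq _] := smor_ok sp; have [wsq _] := wd_ok fsq.
rewrite wtS //; have := dsq_vcomp sq wsq.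
by rewrite e2 -h2 vcomp_idl.
Qed.

Lemma wt_qv s r D f l : vrow s r -> vrow s D -> rob D s = O -> rmor s r D f -> s <= l ->
  vcomp (wt s r D f l) (qv s r l) = f l.
Proof. by move=> vr vD D0 rf sl; have [] := wt_aux vr vD D0 rf sl. Qed.

(** Naturality in the target: [w_nat] moves [g] past [wd], and functoriality of the section merges
    the two span maps. *)
Lemma wt_post s r D D' f f' g : vrow s r -> vrow s D -> rob D s = O -> vrow s D' -> rob D' s = O ->
  rmor s r D f -> rmor s r D' f' -> rmor s D D' g -> (forall l, s <= l -> f' l = vcomp (g l) (f l)) ->
  forall l, s <= l -> wt s r D' f' l = vcomp (g l) (wt s r D f l).
Proof.
move=> vr vD D0 vD' D0' rf rf' rg fE; apply: ind_from => [|l sl IH].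
  have [e1 e2 _] := rg s (leqnn s).
  rewrite !wt_start (_ : g s = vid O); last by apply: term_uniq; rewrite ?vs_id ?vt_id ?e1 ?e2.
  by rewrite vid_vid.
have [h1 h2 h3 sp] := wt_aux vr vD D0 rf sl; have [g1 g2 gsq] := rg l sl.
have [e1 e2 fsq] := rf l sl; have [e1' e2' fsq'] := rf' l sl; have sl' := leqW sl.
have [_ _ _ sp'] := wt_aux vr vD' D0' rf' sl.
have [sq cm] := smor_ok sp; have [wsq wE] := wd_ok fsq.
have [vr1 vr2] := vr l sl.
have spg : spanmor (rh r l) (f l) (rh r l) (f' l) (vid (hs (rh r l))) (vid (ht (rh r l))) (g l).
  split; rewrite ?e1 ?e1' //; first exact: dsq_vid.
  - by rewrite -fE // vr1 -e1' vcomp_idr.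
  - by rewrite g1 g2 e2 e2'.
have := smor_comp sp spg; rewrite !vid_vid -IH => E.
have [_ [f1 _]] := dsq_bd fsq; have [_ [f1' _]] := dsq_bd fsq'.
have c1 : vcomp (g l) (f l) = vcomp (f' l) (vid (hs (rh r l))) by rewrite -fE // vr1 -e1' vcomp_idr.
have c2 : vcomp (g l.+1) (f l.+1) = vcomp (f' l.+1) (vid (ht (rh r l))).
  by rewrite -fE // -f1' vcomp_idr.
have nt := wd_nat fsq fsq' (dsq_vid _) gsq c1 c2.
have [_ [b2 [_ b4]]] := dsq_bd sq; have [_ [d2 [_ d4]]] := dsq_bd wsq.
have [sqg _] := smor_ok spg; have [_ [k2 [_ k4]]] := dsq_bd sqg.
have [wsq' _] := wd_ok fsq'; have [_ [d2' _]] := dsq_bd wsq'.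
have [_ [m2 _]] := dsq_bd gsq.
rewrite !wtS // E !vcompA; first by rewrite nt.
- by rewrite b4 d2.
- by rewrite d4 m2.
- by rewrite b4 k2.
- by rewrite k4 d2'.
Qed.

(** Naturality in the source: the two sides factor one span map through different middle spans, and
    functoriality of the section identifies them. *)
Lemma wt_pre s r r' D f f' e : vrow s r -> vrow s r' -> vrow s D -> rob D s = O ->
  rmor s r D f -> rmor s r' D f' -> rmor s r' r e -> (forall l, s <= l -> f' l = vcomp (f l) (e l)) ->
  forall l, s <= l -> wt s r' D f' l = vcomp (wt s r D f l) (Qm s r' r e l).
Proof.
move=> vr vr' vD D0 rf rf' re fE; apply: ind_from => [|l sl IH].
  by rewrite !wt_start Qm_start vid_vid.
have [h1 h2 h3 sp] := wt_aux vr vD D0 rf sl; have [h1' h2' h3' sp'] := wt_aux vr' vD D0 rf' sl.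
have [q1 q2 _ spq] := Qm_aux vr' vr re sl.
have [e1 e2 fsq] := rf l sl; have [e1' e2' fsq'] := rf' l sl; have [g1 g2 esq] := re l sl.
have [vD1 vD2] := vD l sl.
have [_ [f1 [_ f2]]] := dsq_bd fsq; have [_ [f1' [_ f2']]] := dsq_bd fsq'.
have [_ [m1 [_ m2]]] := dsq_bd esq.
have c1 : vcomp (vid (hs (rh D l))) (f' l) = vcomp (f l) (e l) by rewrite vD1 -e2' vcomp_idl fE.
have c2 : vcomp (vid (ht (rh D l))) (f' l.+1) = vcomp (f l.+1) (e l.+1).
  by rewrite -f2' vcomp_idl fE // leqW.
have nt := wd_nat fsq' fsq esq (dsq_vid _) c1 c2.
have spe : spanmor (rh r' l) (f' l) (rh r l) (f l) (e l) (e l.+1) (vid (hs (rh D l))).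
  split => //; rewrite ?vs_id ?vt_id ?vD1 //.
  - by rewrite e1'; have [-> ] := vr' l sl.
  - by rewrite e1; have [-> ] := vr l sl.
have [wsq _] := wd_ok fsq; have [_ [d2 [_ d4]]] := dsq_bd wsq.
have [wsq' _] := wd_ok fsq'; have [_ [d2' [_ d4']]] := dsq_bd wsq'.
have E1 := smor_comp sp' spe; have E2 := smor_comp spq sp.
have [hq hq' _ _ _] := spq.
have [sq1 _] := smor_ok sp'; have [_ [b2 [_ b4]]] := dsq_bd sq1.
have [sq2 _] := smor_ok spe; have [_ [k2 [_ k4]]] := dsq_bd sq2.
have [sq3 _] := smor_ok spq; have [_ [p2 [_ p4]]] := dsq_bd sq3.
have [sq4 _] := smor_ok sp; have [_ [r2 [_ r4]]] := dsq_bd sq4.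
rewrite !wtS // QmS // -vcompA ?p4 ?r2 ?r4 ?d2 // -E2 -IH.
rewrite -[X in vcomp X _ = _]vcomp_idl d4' nt -vcompA ?b4 ?k2 ?k4 ?d2 // -E1; congr vcomp; congr smor.
- by have [z1 [_ [z3 _]]] := dsq_bd esq; rewrite -z1 -z3 vcomp_idr vcomp_idl.
- by rewrite -m1 vcomp_idr -m2 vcomp_idl.
- by rewrite vD1 -h2' vcomp_idl.
Qed.

End Quotients.

(** * Composites of elementary arrows and normalization of grids *)

Section Paths.
Variable C : squaresCat.

Definition hval (A : nat -> dob C) (h : nat -> hmor C) p k :=
  forall i, p <= i < p + k -> hs (h i) = A i /\ ht (h i) = A i.+1.

Definition vval (A : nat -> dob C) (u : nat -> vmor C) p k :=
  forall i, p <= i < p + k -> vs (u i) = A i /\ vt (u i) = A i.+1.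

Lemma hvalS A h p k : hval A h p k.+1 -> hval A h p k.
Proof. by move=> H i hi; apply: H; lia. Qed.

Lemma vvalS A h p k : vval A h p k.+1 -> vval A h p k.
Proof. by move=> H i hi; apply: H; lia. Qed.

Lemma hpath_st A h p k : hval A h p k ->
  hs (hpath A h p k) = A p /\ ht (hpath A h p k) = A (p + k).
Proof.
elim: k => [|k IH] H /=; first by rewrite addn0 hs_id ht_id.
have [h1 h2] := IH (hvalS H); have [h3 h4] : hs (h (p + k)) = A (p + k) /\ ht (h (p + k)) = A (p + k).+1.
  by apply: H; lia.
by rewrite hs_comp ?ht_comp ?h2 ?h3 // addnS.
Qed.

Lemma vpath_st A h p k : vval A h p k ->
  vs (vpath A h p k) = A p /\ vt (vpath A h p k) = A (p + k).
Proof.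
elim: k => [|k IH] H /=; first by rewrite addn0 vs_id vt_id.
have [h1 h2] := IH (vvalS H); have [h3 h4] : vs (h (p + k)) = A (p + k) /\ vt (h (p + k)) = A (p + k).+1.
  by apply: H; lia.
by rewrite vs_comp ?vt_comp ?h2 ?h3 // addnS.
Qed.

Lemma hpath_cat A h p k k' : hval A h p (k + k') ->
  hcomp (hpath A h (p + k) k') (hpath A h p k) = hpath A h p (k + k').
Proof.
elim: k' => [|k' IH] H /=.
  have [|_ <-] := @hpath_st A h p k; first by move: H; rewrite addn0.
  by rewrite hcomp_idl addn0.
have H' : hval A h p (k + k') by apply: hvalS; rewrite -addnS.
have [_ h2] : hs (hpath A h p k) = A p /\ ht (hpath A h p k) = A (p + k).
  by apply: hpath_st => i hi; apply: H; lia.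
have [h3 h4] : hs (hpath A h (p + k) k') = A (p + k) /\ ht (hpath A h (p + k) k') = A (p + k + k').
  by apply: hpath_st => i hi; apply: H; lia.
have [h5 _] : hs (h (p + k + k')) = A (p + k + k') /\ ht (h (p + k + k')) = A (p + k + k').+1.
  by apply: H; lia.
by rewrite -hcompA ?h2 ?h3 ?h4 ?h5 // IH // addnS /= addnA.
Qed.

Lemma vpath_cat A h p k k' : vval A h p (k + k') ->
  vcomp (vpath A h (p + k) k') (vpath A h p k) = vpath A h p (k + k').
Proof.
elim: k' => [|k' IH] H /=.
  have [|_ <-] := @vpath_st A h p k; first by move: H; rewrite addn0.
  by rewrite vcomp_idl addn0.
have H' : vval A h p (k + k') by apply: vvalS; rewrite -addnS.
have [_ h2] : vs (vpath A h p k) = A p /\ vt (vpath A h p k) = A (p + k).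
  by apply: vpath_st => i hi; apply: H; lia.
have [h3 h4] : vs (vpath A h (p + k) k') = A (p + k) /\ vt (vpath A h (p + k) k') = A (p + k + k').
  by apply: vpath_st => i hi; apply: H; lia.
have [h5 _] : vs (h (p + k + k')) = A (p + k + k') /\ vt (h (p + k + k')) = A (p + k + k').+1.
  by apply: H; lia.
by rewrite -vcompA ?h2 ?h3 ?h4 ?h5 // IH // addnS /= addnA.
Qed.

Lemma hpath_sq A h A' h' (m : nat -> vmor C) p k : vs (m p) = A p -> vt (m p) = A' p ->
  (forall i, p <= i < p + k -> dsq (h i) (m i) (m i.+1) (h' i)) ->
  dsq (hpath A h p k) (m p) (m (p + k)) (hpath A' h' p k).
Proof.
move=> h1 h2; elim: k => [|k IH] H /=.
  by rewrite addn0 -h1 -h2; exact: dsq_hid.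
rewrite addnS; apply: dsq_hcomp; first by apply: IH => i hi; apply: H; lia.
by apply: H; lia.
Qed.

Lemma vpath_sq (h : nat -> hmor C) A u A' u' p k : hs (h p) = A p -> ht (h p) = A' p ->
  (forall i, p <= i < p + k -> dsq (h i) (u i) (u' i) (h i.+1)) ->
  dsq (h p) (vpath A u p k) (vpath A' u' p k) (h (p + k)).
Proof.
move=> h1 h2; elim: k => [|k IH] H /=.
  by rewrite addn0 -h1 -h2; exact: dsq_vid.
rewrite addnS; apply: dsq_vcomp; first by apply: IH => i hi; apply: H; lia.
by apply: H; lia.
Qed.

Lemma vpath_nat A u A' u' (m : nat -> vmor C) p k : vval A u p k -> vval A' u' p k ->
  (forall i, p <= i <= p + k -> vs (m i) = A i /\ vt (m i) = A' i) ->
  (forall i, p <= i < p + k -> vcomp (m i.+1) (u i) = vcomp (u' i) (m i)) ->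
  vcomp (m (p + k)) (vpath A u p k) = vcomp (vpath A' u' p k) (m p).
Proof.
move=> + + mA; elim: k mA => [|k IH] mA H H' mE /=.
  have [|<- <-] := mA p; first by lia.
  by rewrite addn0 vcomp_idr vcomp_idl.
have [h1 h2] := vpath_st (vvalS H); have [h1' h2'] := vpath_st (vvalS H').
have [e1 e2] := H (p + k) ltac:(lia); have [e1' e2'] := H' (p + k) ltac:(lia).
have [m1 m2] := mA (p + k) ltac:(lia); have [m3 m4] := mA (p + k).+1 ltac:(lia).
have [m5 m6] := mA p ltac:(lia).
rewrite addnS vcompA ?h2 ?e1 ?e2 ?m3 // mE; last by lia.
rewrite -vcompA ?h2 ?m1 ?m2 ?e1' //.
rewrite IH //; first by rewrite vcompA ?m6 ?h1' ?h2' ?e1'.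
- by move=> i hi; apply: mA; lia.
- exact: vvalS H.
- exact: vvalS H'.
- by move=> i hi; apply: mE; lia.
Qed.

Lemma vpath_id A u p k : vval A u p k -> (forall i, p <= i < p + k -> u i = vid (A i)) ->
  vpath A u p k = vid (A p).
Proof.
elim: k => [|k IH] H E //=; have E' := E (p + k) ltac:(lia).
rewrite IH ?E'; [|exact: vvalS H|by move=> i hi; apply: E; lia].
have [_] := vpath_st (vvalS H); rewrite IH; [|exact: vvalS H|by move=> i hi; apply: E; lia].
by rewrite vt_id => ->; exact: vid_vid.
Qed.

End Paths.

Section Normalize.
Variable C : squaresCat.
Local Notation O := (sqc_O C).

(** Data that behave well for ordered indices up to [n] become a grid by clamping and sorting;
    [preG] collects what then has to be checked. *)
Definition gnorm (n : nat) (g : gdata C) : gdata C :=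
  GData (fun a j l => gob g a (minn j n) (minn (maxn j l) n))
        (fun a j l l' => gh g a (minn j n) (minn (maxn j l) n) (minn (maxn (maxn j l) l') n))
        (fun a j j' l => gv g a (minn j n) (minn (maxn j j') n) (minn (maxn (maxn j j') l) n))
        (fun a b j l => gf g a (maxn a b) (minn j n) (minn (maxn j l) n))
        (gm g).

Record preG (n k : nat) (g : gdata C) : Prop := PreG {
  p_ob1 : forall a j l, gob g a j l = gob g (minn a k) j l;
  p_h1 : forall a j l l', gh g a j l l' = gh g (minn a k) j l l';
  p_v1 : forall a j j' l, gv g a j j' l = gv g (minn a k) j j' l;
  p_f1 : forall a b j l, gf g a b j l = gf g (minn a k) (minn b k) j l;
  p_m1 : forall a, gm g a = gm g (minn a k);
  p_hs : forall a j l l', j <= l -> l <= l' -> l' <= n -> hs (gh g a j l l') = gob g a j l;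
  p_ht : forall a j l l', j <= l -> l <= l' -> l' <= n -> ht (gh g a j l l') = gob g a j l';
  p_vs : forall a j j' l, j <= j' -> j' <= l -> l <= n -> vs (gv g a j j' l) = gob g a j l;
  p_vt : forall a j j' l, j <= j' -> j' <= l -> l <= n -> vt (gv g a j j' l) = gob g a j' l;
  p_fs : forall a b j l, a <= b -> j <= l -> l <= n -> vs (gf g a b j l) = gob g a j l;
  p_ft : forall a b j l, a <= b -> j <= l -> l <= n -> vt (gf g a b j l) = gob g b j l;
  p_hid : forall a j l, j <= l -> l <= n -> gh g a j l l = hid (gob g a j l);
  p_vid : forall a j l, j <= l -> l <= n -> gv g a j j l = vid (gob g a j l);
  p_fid : forall a j l, j <= l -> l <= n -> gf g a a j l = vid (gob g a j l);
  p_hc : forall a j l l' l'', j <= l -> l <= l' -> l' <= l'' -> l'' <= n ->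
    hcomp (gh g a j l' l'') (gh g a j l l') = gh g a j l l'';
  p_vc : forall a j j' j'' l, j <= j' -> j' <= j'' -> j'' <= l -> l <= n ->
    vcomp (gv g a j' j'' l) (gv g a j j' l) = gv g a j j'' l;
  p_fc : forall a b c j l, a <= b -> b <= c -> j <= l -> l <= n ->
    vcomp (gf g b c j l) (gf g a b j l) = gf g a c j l;
  p_sq : forall a j j' l l', j <= j' -> j' <= l -> l <= l' -> l' <= n ->
    dsq (gh g a j l l') (gv g a j j' l) (gv g a j j' l') (gh g a j' l l');
  p_sqf : forall a b j l l', a <= b -> j <= l -> l <= l' -> l' <= n ->
    dsq (gh g a j l l') (gf g a b j l) (gf g a b j l') (gh g b j l l');
  p_nat : forall a b j j' l, a <= b -> j <= j' -> j' <= l -> l <= n ->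
    vcomp (gf g a b j' l) (gv g a j j' l) = vcomp (gv g b j j' l) (gf g a b j l);
  p_mm : forall a b, a <= b -> gm g a -> gm g b;
  p_T : forall a j j' l, ~~ gm g a -> j <= j' -> j' <= l -> l <= n ->
    gv g a j j' l = vid (gob g a j l);
  p_Th : forall a j j' l l', ~~ gm g a -> j <= j' -> j' <= l -> l <= l' -> l' <= n ->
    gh g a j l l' = gh g a j' l l';
  p_S : forall a j, gm g a -> j <= n -> gob g a j j = O }.

Lemma isG_norm n k g : preG n k g -> isG n k (gnorm n g).
Proof.
move=> H; have mm i j : i <= j -> minn i n <= minn j n by lia.
have mn i : minn i n <= n by exact: geq_minr.
split => /=.
- by move=> a j l; rewrite (p_ob1 H); congr gob; lia.
- by move=> a j l; congr gob; lia.
- by move=> a j l l'; rewrite (p_h1 H); congr gh; lia.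
- by move=> a j l l'; congr gh; lia.
- by move=> a j l l'; rewrite (p_v1 H); congr gv; lia.
- by move=> a j l l'; congr gv; lia.
- by move=> a b j l; rewrite (p_f1 H) [RHS](p_f1 H); congr gf; lia.
- by move=> a b j l; congr gf; lia.
- exact: (p_m1 H).
- move=> a j l l' h1 h2; rewrite (maxn_idPr h1) (maxn_idPr h2) (p_hs H) //; exact: mm.
- move=> a j l l' h1 h2; rewrite (maxn_idPr h1) (maxn_idPr h2) (maxn_idPr (leq_trans h1 h2)).
  by rewrite (p_ht H) //; exact: mm.
- move=> a j l l' h1 h2; rewrite (maxn_idPr h1) (maxn_idPr h2) (maxn_idPr (leq_trans h1 h2)).
  by rewrite (p_vs H) //; exact: mm.
- move=> a j l l' h1 h2; rewrite (maxn_idPr h1) (maxn_idPr h2).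
  by rewrite (p_vt H) //; exact: mm.
- by move=> a b j l ab jl; rewrite (maxn_idPr ab) (maxn_idPr jl) (p_fs H) //; exact: mm.
- by move=> a b j l ab jl; rewrite (maxn_idPr ab) (maxn_idPr jl) (p_ft H) //; exact: mm.
- by move=> a j l jl; rewrite (maxn_idPr jl) maxnn (p_hid H) //; exact: mm.
- by move=> a j l jl; rewrite maxnn (maxn_idPr jl) (p_vid H) //; exact: mm.
- by move=> a j l jl; rewrite maxnn (maxn_idPr jl) (p_fid H) //; exact: mm.
- move=> a j l l' l'' h1 h2 h3; have h4 := leq_trans h1 h2.
  rewrite (maxn_idPr h4) (maxn_idPr h1) (maxn_idPr h3) (maxn_idPr h2) (maxn_idPr (leq_trans h2 h3)).
  by rewrite (p_hc H) //; exact: mm.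
- move=> a j j' j'' l h1 h2 h3; have h4 := leq_trans h1 h2; have h5 := leq_trans h2 h3.
  rewrite (maxn_idPr h1) (maxn_idPr h2) (maxn_idPr h4) (maxn_idPr h3) (maxn_idPr h5).
  by rewrite (p_vc H) //; exact: mm.
- move=> a b c j l h1 h2 h3; have h4 := leq_trans h1 h2.
  rewrite (maxn_idPr h1) (maxn_idPr h2) (maxn_idPr h4) (maxn_idPr h3).
  by rewrite (p_fc H) //; exact: mm.
- move=> a j j' l l' h1 h2 h3; have h4 := leq_trans h1 h2; have h5 := leq_trans h2 h3.
  rewrite (maxn_idPr h1) (maxn_idPr h2) (maxn_idPr h4) (maxn_idPr h3) (maxn_idPr h5).
  by apply: (p_sq H) => //; exact: mm.
- move=> a b j l l' h1 h2 h3; have h4 := leq_trans h2 h3.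
  rewrite (maxn_idPr h1) (maxn_idPr h2) (maxn_idPr h3) (maxn_idPr h4).
  by apply: (p_sqf H) => //; exact: mm.
- move=> a b j j' l h1 h2 h3; have h4 := leq_trans h2 h3.
  rewrite (maxn_idPr h1) (maxn_idPr h2) (maxn_idPr h3) (maxn_idPr h4).
  by apply: (p_nat H) => //; exact: mm.
- exact: (p_mm H).
- move=> a j j' l am h2 h3; have h4 := leq_trans h2 h3.
  rewrite (maxn_idPr h2) (maxn_idPr h3) (maxn_idPr h4).
  by apply: (p_T H) => //; exact: mm.
- move=> a j j' l l' am h2 h3 h5; have h4 := leq_trans h2 h3.
  rewrite (maxn_idPr h3) (maxn_idPr h4) (maxn_idPr h5).
  by apply: (p_Th H) => //; exact: mm.
- by move=> a j am; rewrite maxnn (p_S H).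
Qed.

End Normalize.

(** * The S-object of iterated quotients of a T-object *)

Section Sigma.
Variables (C : squaresCat) (W : protoWaldhausen C).
Local Notation O := (sqc_O C).
Local Notation row := (row C).

(* [srow r j.+1] is the [j]-th row of the S-object associated with the T-object [r]:
   the quotient of [srow r j] by its entry in position [j]. *)
Fixpoint srow (r : row) (j : nat) : row :=
  match j with 0 => r | j'.+1 => Qr W j' (srow r j') end.

Fixpoint smap (r r' : row) (p : nat -> vmor C) (j : nat) : nat -> vmor C :=
  match j with 0 => p | j'.+1 => Qm W j' (srow r j') (srow r' j') (smap r r' p j') end.

(* [imap j] goes from [srow r j] to the [j]-th row [D j] of an S-object, and [qmap j] is
   its factorization through [srow r j.+1]. *)
Fixpoint imap (r : row) (D : nat -> row) (dv : nat -> nat -> vmor C) (f : nat -> vmor C) (j : nat)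
    : nat -> vmor C :=
  match j with
  | 0 => f
  | j'.+1 => fun l => vcomp (dv j' l) (wt W j' (srow r j') (D j') (imap r D dv f j') l)
  end.

Definition qmap r D dv f j := wt W j (srow r j) (D j) (imap r D dv f j).

Definition sver (r : row) (j j' l : nat) : vmor C :=
  vpath (fun i => rob (srow r i) l) (fun i => qv W i (srow r i) l) j (j' - j).

Definition hor (r : row) (l l' : nat) : hmor C := hpath (rob r) (rh r) l (l' - l).

Lemma vrow_srow r : vrow 0 r -> forall j, vrow j (srow r j).
Proof. by move=> vr; elim=> [//|j IH]; apply: (@vrowS _ j) => //; exact: vrow_Qr. Qed.

(** The quotient keeps column [j], where its entry is [O]: this is the diagonal of the S-object. *)
Lemma vrow_srow1 r j : vrow 0 r -> vrow j (srow r j.+1).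
Proof. by move=> vr; exact/vrow_Qr/vrow_srow. Qed.

Lemma srow_diag r j : rob (srow r j.+1) j = O.
Proof. exact: Qr_start. Qed.

Lemma smap_rmor r r' p : vrow 0 r -> vrow 0 r' -> rmor 0 r r' p ->
  forall j, rmor j (srow r j) (srow r' j) (smap r r' p j).
Proof.
move=> vr vr' rp; elim=> [//|j IH]; apply: (@rmorS _ j) => //.
by apply: Qm_rmor => //; exact: vrow_srow.
Qed.

Lemma smap_rmor1 r r' p j : vrow 0 r -> vrow 0 r' -> rmor 0 r r' p ->
  rmor j (srow r j.+1) (srow r' j.+1) (smap r r' p j.+1).
Proof. by move=> vr vr' rp; apply: Qm_rmor; [exact: vrow_srow|exact: vrow_srow|exact: smap_rmor]. Qed.

Lemma smap_qv r r' p j l : vrow 0 r -> vrow 0 r' -> rmor 0 r r' p -> j <= l ->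
  vcomp (smap r r' p j.+1 l) (qv W j (srow r j) l) = vcomp (qv W j (srow r' j) l) (smap r r' p j l).
Proof. by move=> vr vr' rp jl; apply: Qm_qv => //; [exact: vrow_srow|exact: vrow_srow|exact: smap_rmor]. Qed.

Lemma smap_id r p : vrow 0 r -> (forall l, p l = vid (rob r l)) -> forall j,
  (forall l, j <= l -> smap r r p j l = vid (rob (srow r j) l)) /\
  (forall l, j <= l -> smap r r p j.+1 l = vid (rob (srow r j.+1) l)).
Proof.
move=> vr pE.
have step j : (forall l, j <= l -> smap r r p j l = vid (rob (srow r j) l)) ->
    forall l, j <= l -> smap r r p j.+1 l = vid (rob (srow r j.+1) l).
  by move=> h; apply: Qm_id => //; exact: vrow_srow.
elim=> [|j [IH1 IH2]]; split => //; do ?[by move=> l _; exact: pE].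
- by apply: step => l _; exact: pE.
- by move=> l jl; apply: IH2; lia.
- by apply: step => l jl; apply: IH2; lia.
Qed.

Lemma smap_comp r r' r'' p p' p'' : vrow 0 r -> vrow 0 r' -> vrow 0 r'' ->
  rmor 0 r r' p -> rmor 0 r' r'' p' -> (forall l, p'' l = vcomp (p' l) (p l)) -> forall j,
  (forall l, j <= l -> smap r r'' p'' j l = vcomp (smap r' r'' p' j l) (smap r r' p j l)) /\
  (forall l, j <= l -> smap r r'' p'' j.+1 l = vcomp (smap r' r'' p' j.+1 l) (smap r r' p j.+1 l)).
Proof.
move=> vr vr' vr'' rp rp' pE.
have step j : (forall l, j <= l -> smap r r'' p'' j l = vcomp (smap r' r'' p' j l) (smap r r' p j l)) ->
    forall l, j <= l -> smap r r'' p'' j.+1 l = vcomp (smap r' r'' p' j.+1 l) (smap r r' p j.+1 l).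
  by move=> h; apply: Qm_comp => //; do ?[exact: vrow_srow|exact: smap_rmor].
elim=> [|j [IH1 IH2]]; split => //; do ?[by move=> l _; exact: pE].
- by apply: step => l _; exact: pE.
- by move=> l jl; apply: IH2; lia.
- by apply: step => l jl; apply: IH2; lia.
Qed.

Lemma hval_row s (r : row) l l' : vrow s r -> s <= l -> hval (rob r) (rh r) l l'.
Proof. by move=> vr sl i hi; apply: vr; lia. Qed.

Lemma hor_st s (r : row) l l' : vrow s r -> s <= l -> l <= l' -> hs (hor r l l') = rob r l /\ ht (hor r l l') = rob r l'.
Proof.
move=> vr sl ll; have [h1 h2] := hpath_st (hval_row (l' := l' - l) vr sl).
by split => //; rewrite h2 subnKC.
Qed.

Lemma hor_id (r : row) l : hor r l l = hid (rob r l).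
Proof. by rewrite /hor subnn. Qed.

Lemma hor_comp s (r : row) l l' l'' : vrow s r -> s <= l -> l <= l' -> l' <= l'' ->
  hcomp (hor r l' l'') (hor r l l') = hor r l l''.
Proof.
move=> vr sl h1 h2; rewrite /hor -[X in hpath _ _ X (l'' - l')](subnKC h1) hpath_cat.
  by congr hpath; lia.
exact: hval_row vr sl.
Qed.

Lemma hor_sq s (r r' : row) p l l' : rmor s r r' p -> s <= l -> l <= l' ->
  dsq (hor r l l') (p l) (p l') (hor r' l l').
Proof.
move=> rp sl ll; have [h1 h2 _] := rp l sl.
rewrite -[X in dsq _ _ (p X) _](subnKC ll); apply: hpath_sq => // i hi.
by have [] := rp i ltac:(lia).
Qed.

Lemma vval_srow r l j k : vrow 0 r -> j + k <= l.+1 ->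
  vval (fun i => rob (srow r i) l) (fun i => qv W i (srow r i) l) j k.
Proof. by move=> vr jl i hi; split => //; apply: vs_qv; [exact: vrow_srow|lia]. Qed.

Lemma sver_st r j j' l : vrow 0 r -> j <= j' -> j' <= l.+1 ->
  vs (sver r j j' l) = rob (srow r j) l /\ vt (sver r j j' l) = rob (srow r j') l.
Proof.
move=> vr jj jl; have jl' : j + (j' - j) <= l.+1 by rewrite subnKC.
have [h1 h2] := vpath_st (vval_srow vr jl').
by split => //; rewrite h2 subnKC.
Qed.

Lemma sver_id r j l : sver r j j l = vid (rob (srow r j) l).
Proof. by rewrite /sver subnn. Qed.

Lemma sverS r j l : vrow 0 r -> j <= l -> sver r j j.+1 l = qv W j (srow r j) l.
Proof.
move=> vr jl; rewrite /sver subSnn /= addn0.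
by rewrite -(vs_qv W (vrow_srow (j := j) vr) jl) vcomp_idr.
Qed.

Lemma sver_comp r j j' j'' l : vrow 0 r -> j <= j' -> j' <= j'' -> j'' <= l.+1 ->
  vcomp (sver r j' j'' l) (sver r j j' l) = sver r j j'' l.
Proof.
move=> vr h1 h2 h3; rewrite /sver -[X in vpath _ _ X (j'' - j')](subnKC h1) vpath_cat.
  by congr vpath; lia.
by apply: vval_srow => //; lia.
Qed.

Lemma sver_sq r j j' l l' : vrow 0 r -> j <= j' -> j' <= l.+1 -> l <= l' -> j.-1 <= l ->
  (0 < j) || (j <= l) ->
  dsq (hor (srow r j) l l') (sver r j j' l) (sver r j j' l') (hor (srow r j') l l').
Proof.
move=> vr jj jl ll j1 j0.
have vj : vrow j.-1 (srow r j) by case: j {jj j1 j0} => //= j; exact: vrow_srow1.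
have [h1 h2] := hor_st vj j1 ll.
have := @vpath_sq C (fun i => hor (srow r i) l l') (fun i => rob (srow r i) l)
  (fun i => qv W i (srow r i) l) (fun i => rob (srow r i) l') (fun i => qv W i (srow r i) l')
  j (j' - j) h1 h2.
rewrite subnKC //; apply=> i hi.
by apply: (hor_sq (s := i)) => //; [apply: rmor_qv; exact: vrow_srow|lia].
Qed.

Lemma sver_nat r r' p j j' l : vrow 0 r -> vrow 0 r' -> rmor 0 r r' p -> j <= j' -> j' <= l.+1 ->
  vcomp (smap r r' p j' l) (sver r j j' l) = vcomp (sver r' j j' l) (smap r r' p j l).
Proof.
move=> vr vr' rp jj jl; have jl' : j + (j' - j) <= l.+1 by rewrite subnKC.
have := @vpath_nat C _ _ _ _ (fun i => smap r r' p i l) j (j' - j)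
  (vval_srow vr jl') (vval_srow vr' jl').
rewrite subnKC //; apply=> i hi; last by apply: smap_qv => //; lia.
case: i hi => [|i] hi; first by have [] := rp l (leq0n l).
have il : i <= l by lia.
by have [? ? _] := smap_rmor1 vr vr' rp il.
Qed.

Section Target.
Variables (r : row) (D : nat -> row) (dv : nat -> nat -> vmor C) (f : nat -> vmor C).
Hypotheses (vr : vrow 0 r) (vD : forall j, vrow j (D j)) (D0 : forall j, rob (D j) j = O).
Hypothesis rdv : forall j, rmor j.+1 (D j) (D j.+1) (dv j).
Hypothesis rf : rmor 0 r (D 0) f.

Lemma imap_rmor j : rmor j (srow r j) (D j) (imap r D dv f j).
Proof.
elim: j => [//|j IH] l jl.
have [h1 h2 h3] := wt_rmor W (vrow_srow (j := j) vr) (@vD j) (D0 j) IH (ltnW jl).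
have [e1 e2 e3] := rdv jl; rewrite /=.
have vm : vt (wt W j (srow r j) (D j) (imap r D dv f j) l) = vs (dv j l) by rewrite h2 e1.
by rewrite vs_comp // vt_comp //; split => //; exact: dsq_vcomp h3 e3.
Qed.

Lemma qmap_rmor j : rmor j (srow r j.+1) (D j) (qmap r D dv f j).
Proof. by apply: wt_rmor => //; [exact: vrow_srow|exact: imap_rmor]. Qed.

Lemma qmap_qv j l : j <= l -> vcomp (qmap r D dv f j l) (qv W j (srow r j) l) = imap r D dv f j l.
Proof. by move=> jl; apply: wt_qv => //; [exact: vrow_srow|exact: imap_rmor]. Qed.

Lemma qmap_ver j l : j < l ->
  vcomp (qmap r D dv f j.+1 l) (sver r j.+1 j.+2 l) = vcomp (dv j l) (qmap r D dv f j l).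
Proof. by move=> jl; rewrite sverS // qmap_qv. Qed.

(** Here [dp] stands for [f] followed by the vertical maps of [D], that is, for the T-to-S
    components of a grid; the factorizations through the quotients give them back. *)
Lemma qmap_sver0 (dp : nat -> nat -> vmor C) :
  (forall l, dp 0 l = f l) -> (forall j l, j < l -> dp j.+1 l = vcomp (dv j l) (dp j l)) ->
  forall j l, j <= l -> vcomp (qmap r D dv f j l) (sver r 0 j.+1 l) = dp j l.
Proof.
move=> dp0 dpS j l jl.
have E i : i <= l -> vcomp (imap r D dv f i l) (sver r 0 i l) = dp i l /\
    vcomp (qmap r D dv f i l) (sver r 0 i.+1 l) = vcomp (imap r D dv f i l) (sver r 0 i l).
  elim: i => [|i IH] il.
    have [h1 _ _] := rf (leq0n l).
    rewrite sver_id /= -h1 vcomp_idr dp0; split => //.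
    by rewrite sverS // qmap_qv.
  have [IH1 IH2] := IH (ltnW il).
  have [q1 q2 _] := qmap_rmor (ltnW il); have [e1 e2 _] := rdv il.
  have [q1' q2' _] := qmap_rmor il.
  have [s1 s2] := sver_st vr (leq0n i.+1) (leqW il).
  have [qs qt] := sver_st vr (leqnSn i.+1) (il : i.+2 <= l.+1).
  split.
    rewrite /= -[wt _ _ _ _ _ _]/(qmap r D dv f i l) -vcompA ?s2 ?q1 ?q2 ?e1 // IH2 IH1 dpS //.
  rewrite -(sver_comp (j' := i.+1) vr) // vcompA ?s2 ?qs ?qt ?q1' // qmap_ver //.
by have [E1 E2] := E j jl; rewrite E2 E1.
Qed.

End Target.

(** Compatibility with composites from T to S to S in the collage, as [qmap_pre] is for those from T
    to T to S. *)
Lemma qmap_post r D D' dv dv' f f' g : vrow 0 r ->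
  (forall j, vrow j (D j)) -> (forall j, rob (D j) j = O) -> (forall j, rmor j.+1 (D j) (D j.+1) (dv j)) ->
  (forall j, vrow j (D' j)) -> (forall j, rob (D' j) j = O) -> (forall j, rmor j.+1 (D' j) (D' j.+1) (dv' j)) ->
  rmor 0 r (D 0) f -> rmor 0 r (D' 0) f' -> (forall j, rmor j (D j) (D' j) (g j)) ->
  (forall j l, j < l -> vcomp (g j.+1 l) (dv j l) = vcomp (dv' j l) (g j l)) ->
  (forall l, f' l = vcomp (g 0 l) (f l)) ->
  forall j l, j <= l -> qmap r D' dv' f' j l = vcomp (g j l) (qmap r D dv f j l).
Proof.
move=> vr vD D0 rdv vD' D0' rdv' rf rf' rg gn fE.
have step j : (forall l, j <= l -> imap r D' dv' f' j l = vcomp (g j l) (imap r D dv f j l)) ->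
    forall l, j <= l -> qmap r D' dv' f' j l = vcomp (g j l) (qmap r D dv f j l).
  by move=> h; apply: wt_post => //; do ?[exact: vrow_srow|exact: imap_rmor].
suff E j : forall l, j <= l -> imap r D' dv' f' j l = vcomp (g j l) (imap r D dv f j l).
  by move=> j; apply: step; exact: E.
elim: j => [l _|j IH l jl]; first exact: fE.
have := step j IH l (ltnW jl); rewrite /qmap /= => ->.
have [q1 q2 _] := qmap_rmor vr vD D0 rdv rf (ltnW jl).
have [e1 e2 _] := rdv j l jl; have [e1' e2' _] := rdv' j l jl.
have [g1 g2 _] := rg j l (ltnW jl); have [g1' g2' _] := rg j.+1 l jl.
by rewrite !vcompA ?q2 ?e1 ?e2 ?g1 ?g2 ?e1' ?g1' // -gn.
Qed.

Lemma qmap_pre r r' D dv f f' e : vrow 0 r -> vrow 0 r' ->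
  (forall j, vrow j (D j)) -> (forall j, rob (D j) j = O) -> (forall j, rmor j.+1 (D j) (D j.+1) (dv j)) ->
  rmor 0 r (D 0) f -> rmor 0 r' (D 0) f' -> rmor 0 r' r e ->
  (forall l, f' l = vcomp (f l) (e l)) ->
  forall j l, j <= l -> qmap r' D dv f' j l = vcomp (qmap r D dv f j l) (smap r' r e j.+1 l).
Proof.
move=> vr vr' vD D0 rdv rf rf' re fE.
have step j : (forall l, j <= l -> imap r' D dv f' j l = vcomp (imap r D dv f j l) (smap r' r e j l)) ->
    forall l, j <= l -> qmap r' D dv f' j l = vcomp (qmap r D dv f j l) (smap r' r e j.+1 l).
  by move=> h; apply: wt_pre => //; do ?[exact: vrow_srow|exact: imap_rmor|exact: smap_rmor].
suff E j : forall l, j <= l -> imap r' D dv f' j l = vcomp (imap r D dv f j l) (smap r' r e j l).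
  by move=> j; apply: step; exact: E.
elim: j => [l _|j IH l jl]; first exact: fE.
have := step j IH l (ltnW jl); rewrite /qmap => E.
have [q1 q2 _] := qmap_rmor vr vD D0 rdv rf (ltnW jl).
have [e1 e2 _] := rdv j l jl; have [m1 m2 _] := smap_rmor1 vr' vr re (ltnW jl).
rewrite [LHS]/= E [imap r D dv f j.+1 l]/= vcompA //; first by rewrite m2 q1.
by rewrite q2 e1.
Qed.

End Sigma.

(** * The two levelwise deformations *)

Local Arguments srow : simpl never.
Local Arguments smap : simpl never.

Section NormTr.
Variable C : squaresCat.

Record preTr (n k : nat) (x0 x1 : gdata C) (tr : nat -> nat -> nat -> vmor C) : Prop := PreTr {
  pt_1 : forall a j l, tr a j l = tr (minn a k) j l;
  pt_s : forall a j l, j <= l -> l <= n -> vs (tr a j l) = gob x0 a j l;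
  pt_t : forall a j l, j <= l -> l <= n -> vt (tr a j l) = gob x1 a j l;
  pt_sq : forall a j l l', j <= l -> l <= l' -> l' <= n ->
    dsq (gh x0 a j l l') (tr a j l) (tr a j l') (gh x1 a j l l');
  pt_v : forall a j j' l, j <= j' -> j' <= l -> l <= n ->
    vcomp (tr a j' l) (gv x0 a j j' l) = vcomp (gv x1 a j j' l) (tr a j l);
  pt_f : forall a b j l, a <= b -> j <= l -> l <= n ->
    vcomp (tr b j l) (gf x0 a b j l) = vcomp (gf x1 a b j l) (tr a j l);
  pt_m : forall a, gm x0 a -> gm x1 a }.

Definition trnorm n (tr : nat -> nat -> nat -> vmor C) a j l := tr a (minn j n) (minn (maxn j l) n).

Lemma isTr_norm n k x0 x1 tr : preTr n k x0 x1 tr -> isTr n k (gnorm n x0) (gnorm n x1) (trnorm n tr).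
Proof.
move=> H; have mm i j : i <= j -> minn i n <= minn j n by lia.
have mn i : minn i n <= n by exact: geq_minr.
rewrite /trnorm; split => /=.
- by move=> a j l; rewrite (pt_1 H); congr tr; lia.
- by move=> a j l; congr tr; lia.
- by move=> a j l h; rewrite (maxn_idPr h); apply: (pt_s H) => //; exact: mm.
- by move=> a j l h; rewrite (maxn_idPr h); apply: (pt_t H) => //; exact: mm.
- move=> a j l l' h h'; rewrite (maxn_idPr h) (maxn_idPr h') (maxn_idPr (leq_trans h h')).
  by apply: (pt_sq H) => //; exact: mm.
- move=> a j j' l h h'; rewrite (maxn_idPr h) (maxn_idPr h') (maxn_idPr (leq_trans h h')).
  by apply: (pt_v H) => //; exact: mm.
- move=> a b j l h h'; rewrite (maxn_idPr h) (maxn_idPr h').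
  by apply: (pt_f H) => //; exact: mm.
- exact: (pt_m H).
Qed.

End NormTr.

Section SigmaGrid.
Variables (C : squaresCat) (W : protoWaldhausen C).
Local Notation O := (sqc_O C).

Definition grow (g : gdata C) a j : row C := Row (gob g a j) (fun l => gh g a j l l.+1).

Definition gdv (g : gdata C) b j l := gv g b j j.+1 l.

Section Facts.
Variables (n k : nat) (g : gdata C).
Hypothesis H : isG n k g.

Lemma gnorm_id : gnorm n g = g.
Proof.
apply: gdata_eq => [a j l|a j l l'|a j j' l|a b j l|a] //=.
- by rewrite [RHS](g_ob2 H) (g_ob1 H) [RHS](g_ob1 H); congr gob; lia.
- by rewrite [RHS](g_h2 H) (g_h1 H) [RHS](g_h1 H); congr gh; lia.
- by rewrite [RHS](g_v2 H) (g_v1 H) [RHS](g_v1 H); congr gv; lia.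
- by rewrite [RHS](g_f2 H) (g_f1 H) [RHS](g_f1 H); congr gf; lia.
Qed.

Lemma gob_cl a j l : gob g a j l = gob g (minn a k) j l.
Proof. by rewrite [LHS](g_ob1 H) [RHS](g_ob1 H); congr gob; lia. Qed.

Lemma gh_cl a j l l' : gh g a j l l' = gh g (minn a k) j l l'.
Proof. by rewrite [LHS](g_h1 H) [RHS](g_h1 H); congr gh; lia. Qed.

Lemma gv_cl a j l l' : gv g a j l l' = gv g (minn a k) j l l'.
Proof. by rewrite [LHS](g_v1 H) [RHS](g_v1 H); congr gv; lia. Qed.

Lemma gf_cl a b j l : gf g a b j l = gf g (minn a k) (minn b k) j l.
Proof. by rewrite [LHS](g_f1 H) [RHS](g_f1 H); congr gf; lia. Qed.

Lemma grow_cl a : grow g a = grow g (minn a k).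
Proof.
by apply/funext => j; congr Row; apply/funext => l; [exact: gob_cl|exact: gh_cl].
Qed.

Lemma gdv_cl a : gdv g a = gdv g (minn a k).
Proof. by apply/funext => j; apply/funext => l; exact: gv_cl. Qed.

Lemma gf0_cl a b : gf g a b 0 = gf g (minn a k) (minn b k) 0.
Proof. by apply/funext => l; exact: gf_cl. Qed.

Lemma vrow_grow a j : vrow j (grow g a j).
Proof. by move=> l jl; split => /=; [exact: (g_hs H)|apply: (g_ht H)]. Qed.

Lemma rmor_gdv b j : rmor j.+1 (grow g b j) (grow g b j.+1) (gdv g b j).
Proof.
move=> l jl; rewrite /gdv; split => /=; [exact: (g_vs H)|exact: (g_vt H)|].
by apply: (g_sq H).
Qed.

Lemma rmor_gf a b j : a <= b -> rmor j (grow g a j) (grow g b j) (gf g a b j).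
Proof. by move=> ab l jl; split => /=; [exact: (g_fs H)|exact: (g_ft H)|exact: (g_sqf H)]. Qed.

Lemma gh_hor a j l l' : j <= l -> l <= l' -> gh g a j l l' = hor (grow g a j) l l'.
Proof.
move=> jl ll; rewrite -(subnKC ll); elim: (l' - l) => [|i IH].
  by rewrite addn0 hor_id (g_hid H).
rewrite addnS -(hor_comp (l' := l + i) (@vrow_grow a j)) ?leq_addr //.
have jli : j <= l + i by exact: leq_trans jl (leq_addr _ _).
rewrite -IH -(g_hc H a jl (leq_addr i l) (leqnSn _)); congr hcomp.
by rewrite /hor subSnn /= addn0 -[X in hcomp _ (hid X)](g_hs H a jli (leqnSn _)) hcomp_idr.
Qed.

Lemma T_ob a j l : ~~ gm g a -> j <= l -> gob g a j l = gob g a 0 l.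
Proof.
by move=> am jl; rewrite -(g_vt H a (leq0n j) jl) (g_T H) // vt_id.
Qed.

End Facts.

(** The index [j.+1] appears because [srow] number 0 is the T-object itself. S-rows are untouched,
    so the deformation along [seta] keeps S-points inside S. *)
Definition sgd (g : gdata C) : gdata C := GData
  (fun a j l => if gm g a then gob g a j l else rob (srow W (grow g a 0) j.+1) l)
  (fun a j l l' => if gm g a then gh g a j l l' else hor (srow W (grow g a 0) j.+1) l l')
  (fun a j j' l => if gm g a then gv g a j j' l else sver W (grow g a 0) j.+1 j'.+1 l)
  (fun a b j l => if gm g a then gf g a b j l else
     if gm g b then qmap W (grow g a 0) (grow g b) (gdv g b) (gf g a b 0) j l
     else smap W (grow g a 0) (grow g b 0) (gf g a b 0) j.+1 l)
  (fun _ => true).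

Definition seta (g : gdata C) a j l :=
  if gm g a then vid (gob g a j l) else sver W (grow g a 0) 0 j.+1 l.

Section Valid.
Variables (n k : nat) (g : gdata C).
Hypothesis H : isG n k g.
Let vr a : vrow 0 (grow g a 0) := vrow_grow H a (j := 0).
Let D0 b : gm g b -> forall j, rob (grow g b j) j = O := fun bm j => g_S H j bm.
Let vD b j : vrow j (grow g b j) := vrow_grow H b (j := j).
Let rdv b j : rmor j.+1 (grow g b j) (grow g b j.+1) (gdv g b j) := rmor_gdv H b (j:=j).

Lemma preG_sgd : preG n k (sgd g).
Proof.
split => /=.
- by move=> a j l; rewrite (g_m1 H) (grow_cl H) (gob_cl H).
- by move=> a j l l'; rewrite (g_m1 H) (grow_cl H) (gh_cl H).
- by move=> a j l l'; rewrite (g_m1 H) (grow_cl H) (gv_cl H).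
- move=> a b j l; rewrite (g_m1 H a) (g_m1 H b) (grow_cl H a) (grow_cl H b) (gf_cl H) (gdv_cl H b).
  by rewrite (gf0_cl H a b).
- by [].
- move=> a j l l' h1 h2 _; case: (boolP (gm g a)) => am; cbv iota; first exact: (g_hs H).
  by have [] := hor_st (vrow_srow1 W (j := j) (@vr a)) h1 h2.
- move=> a j l l' h1 h2 _; case: (boolP (gm g a)) => am; cbv iota; first exact: (g_ht H).
  by have [] := hor_st (vrow_srow1 W (j := j) (@vr a)) h1 h2.
- move=> a j j' l h1 h2 _; case: (boolP (gm g a)) => am; cbv iota; first exact: (g_vs H).
  by have [] := sver_st W (@vr a) (h1 : j.+1 <= j'.+1) (h2 : j'.+1 <= l.+1).
- move=> a j j' l h1 h2 _; case: (boolP (gm g a)) => am; cbv iota; first exact: (g_vt H).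
  by have [] := sver_st W (@vr a) (h1 : j.+1 <= j'.+1) (h2 : j'.+1 <= l.+1).
- move=> a b j l ab jl _; case: (boolP (gm g a)) => am; cbv iota; first exact: (g_fs H).
  case: (boolP (gm g b)) => bm; cbv iota.
    by have [] := qmap_rmor W (@vr a) (@vD b) (D0 bm) (@rdv b) (rmor_gf H ab) jl.
  by have [] := smap_rmor1 W (@vr a) (@vr b) (rmor_gf H ab) jl.
- move=> a b j l ab jl _; case: (boolP (gm g a)) => am; cbv iota; first by rewrite (g_mm H ab am); exact: (g_ft H).
  case: (boolP (gm g b)) => bm; cbv iota.
    by have [] := qmap_rmor W (@vr a) (@vD b) (D0 bm) (@rdv b) (rmor_gf H ab) jl.
  by have [] := smap_rmor1 W (@vr a) (@vr b) (rmor_gf H ab) jl.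
- move=> a j l jl _; case: (boolP (gm g a)) => am; cbv iota; first exact: (g_hid H).
  exact: hor_id.
- move=> a j l jl _; case: (boolP (gm g a)) => am; cbv iota; first exact: (g_vid H).
  exact: sver_id.
- move=> a j l jl _; case: (boolP (gm g a)) => am; cbv iota; first exact: (g_fid H).
  have pE i : gf g a a 0 i = vid (rob (grow g a 0) i) by rewrite (g_fid H).
  by have [_ e] := smap_id W (@vr a) pE j; exact: e.
- move=> a j l l' l'' h1 h2 h3 _; case: (boolP (gm g a)) => am; cbv iota; first exact: (g_hc H).
  exact: (hor_comp (vrow_srow1 W (j := j) (@vr a))).
- move=> a j l l' l'' h1 h2 h3 _; case: (boolP (gm g a)) => am; cbv iota; first exact: (g_vc H).
  exact: sver_comp.
- move=> a b c j l ab bc jl _; case: (boolP (gm g a)) => am; cbv iota.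
    by rewrite (g_mm H ab am); exact: (g_fc H).
  have pE i : gf g a c 0 i = vcomp (gf g b c 0 i) (gf g a b 0 i) by rewrite (g_fc H).
  have rab := rmor_gf H (j := 0) ab; have rbc := rmor_gf H (j := 0) bc.
  have rac := rmor_gf H (j := 0) (leq_trans ab bc).
  case: (boolP (gm g b)) => bm; cbv iota.
    have cm := g_mm H bc bm; rewrite cm; symmetry.
    apply: (@qmap_post C W _ _ _ _ _ _ _ (fun j => gf g b c j)) => //; do ?exact: D0.
    + by move=> i; exact: (rmor_gf H bc).
    + by move=> i i' ii; rewrite /gdv (g_nat H).
  case: (boolP (gm g c)) => cm; cbv iota; symmetry; first by apply: qmap_pre => //; exact: D0.
  by have [_ e] := smap_comp W (@vr a) (@vr b) (@vr c) rab rbc pE j; exact: e.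
- move=> a j j' l l' h1 h2 h3 _; case: (boolP (gm g a)) => am; cbv iota; first exact: (g_sq H).
  by apply: sver_sq => //=; lia.
- move=> a b j l l' ab h1 h2 _; case: (boolP (gm g a)) => am; cbv iota; first by rewrite (g_mm H ab am); exact: (g_sqf H).
  case: (boolP (gm g b)) => bm; cbv iota.
    rewrite (gh_hor H) //; apply: (hor_sq (s := j)) => //.
    by apply: qmap_rmor => //; [exact: D0|exact: (rmor_gf H ab)].
  by apply: (hor_sq (s := j)) => //; apply: smap_rmor1 => //; exact: (rmor_gf H ab).
- move=> a b j j' l ab h1 h2 _; case: (boolP (gm g a)) => am; cbv iota.
    by rewrite (g_mm H ab am); exact: (g_nat H).
  have rab := rmor_gf H (j := 0) ab.
  case: (boolP (gm g b)) => bm; cbv iota; last by apply: sver_nat.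
  (* [qmap_ver] crosses one row, so the vertical composite is built up row by row. *)
  move: h1 h2; move: j'; apply: ind_from => [jl|j' jj IH jl].
    have [q1 q2 _] := qmap_rmor W (@vr a) (@vD b) (D0 bm) (@rdv b) rab jl.
    by rewrite sver_id (g_vid H) // -[gob g b j l]q2 -q1 vcomp_idl vcomp_idr.
  have [q1 q2 _] := qmap_rmor W (@vr a) (@vD b) (D0 bm) (@rdv b) rab (leq_trans jj (ltnW jl)).
  have [p1 p2 _] := qmap_rmor W (@vr a) (@vD b) (D0 bm) (@rdv b) rab (ltnW jl).
  have [r1 r2 _] := qmap_rmor W (@vr a) (@vD b) (D0 bm) (@rdv b) rab jl.
  have [s1 s2] := sver_st W (@vr a) (jj : j.+1 <= j'.+1) (leqW jl : j'.+1 <= l.+1).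
  have [u1 u2] := sver_st W (@vr a) (leqnSn j'.+1) (jl : j'.+2 <= l.+1).
  have jl' := leq_trans jj (ltnW jl).
  rewrite -(sver_comp W (j' := j'.+1) (@vr a)) // vcompA ?s2 ?u1 ?u2 ?r1 //.
  rewrite qmap_ver //; [|exact: D0].
  rewrite -vcompA ?s2 ?p1 ?p2 // /gdv ?(g_vs H) //.
  rewrite IH ?(ltnW jl) // vcompA ?q2 ?(g_vs H) ?(g_vt H) ?(ltnW jl) // (g_vc H) //.
- by [].
- by [].
- by [].
- move=> a j _ _; case: (boolP (gm g a)) => am; cbv iota; first exact: (g_S H).
  exact: srow_diag.
Qed.

Lemma preTr_seta : preTr n k g (sgd g) (seta g).
Proof.
rewrite /seta; split => /=.
- by move=> a j l; rewrite (g_m1 H) (grow_cl H) (gob_cl H).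
- move=> a j l jl _; case: (boolP (gm g a)) => am; cbv iota; first by rewrite vs_id.
  have [-> _] := sver_st W (@vr a) (leq0n j.+1) (jl : j.+1 <= l.+1).
  by rewrite (T_ob H).
- move=> a j l jl _; case: (boolP (gm g a)) => am; cbv iota; first by rewrite vt_id.
  by have [_ ->] := sver_st W (@vr a) (leq0n j.+1) (jl : j.+1 <= l.+1).
- move=> a j l l' h1 h2 _; case: (boolP (gm g a)) => am; cbv iota.
    by rewrite -{1}(g_hs H a h1 h2) -(g_ht H a h1 h2); exact: dsq_vid.
  have := @sver_sq C W _ 0 j.+1 l l' (@vr a) (leq0n _) h1 h2 (leq0n _) (leq0n _).
  by rewrite -[srow _ _ 0]/(grow g a 0) -(gh_hor H) // (g_Th H am (leq0n j)).
- move=> a j j' l h1 h2 _; case: (boolP (gm g a)) => am; cbv iota.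
    by rewrite -(g_vt H a h1 h2) -(g_vs H a h1 h2) vcomp_idl vcomp_idr.
  rewrite (g_T H) // (T_ob H am) ?(leq_trans h1) //.
  have [s1 _] := sver_st W (@vr a) (leq0n j'.+1) (h2 : j'.+1 <= l.+1).
  by rewrite -[gob g a 0 l]s1 vcomp_idr sver_comp.
- move=> a b j l ab jl _; case: (boolP (gm g b)) => bm; cbv iota; case: (boolP (gm g a)) => am; cbv iota.
  + by rewrite -(g_ft H ab jl) -(g_fs H ab jl) vcomp_idl vcomp_idr.
  + rewrite -(g_ft H ab jl) vcomp_idl; symmetry.
    apply: (@qmap_sver0 C W _ _ _ _ (@vr a) (@vD b) (D0 bm) (@rdv b) (rmor_gf H ab) (gf g a b)) => // i i' ii.
    rewrite /gdv -(g_nat H) // (g_T H) // (T_ob H am (ltnW ii)) -(T_ob H am ii) -(g_fs H ab ii).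
    by rewrite vcomp_idr.
  + by rewrite (g_mm H ab am) in bm.
  + rewrite (sver_nat W (@vr a) (@vr b) (rmor_gf H ab)) // -[smap _ _ _ _ 0 l]/(gf g a b 0 l).
    congr vcomp; have := g_nat H ab (leq0n j) jl; rewrite !(g_T H) //.
    by rewrite -(T_ob H am jl) -(g_fs H ab jl) -(g_ft H ab (leq0n l)) vcomp_idr vcomp_idl.
- by [].
Qed.

End Valid.

Definition sigma n (g : gdata C) := gnorm n (sgd g).

Lemma isG_sigma n k g : isG n k g -> isG n k (sigma n g).
Proof. by move=> H; exact/isG_norm/preG_sgd. Qed.

Lemma isTr_sigma n k g : isG n k g -> isTr n k g (sigma n g) (trnorm n (seta g)).
Proof. by move=> H; rewrite -{1}(gnorm_id H); exact/isTr_norm/preTr_seta. Qed.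

Section Natural.
Variables (n k k' : nat) (p : mono k' k) (g : gdata C).
Hypothesis H : isG n k g.

Lemma grow_act a : grow (gact (mid n) p g) a = grow g (p a).
Proof.
apply/funext => j; congr Row; apply/funext => l /=.
- by rewrite [LHS](g_ob1 H) [RHS](g_ob1 H); congr gob; lia.
- by rewrite [LHS](g_h1 H) [RHS](g_h1 H); congr gh; lia.
Qed.

Lemma gdv_act a : gdv (gact (mid n) p g) a = gdv g (p a).
Proof.
apply/funext => j; apply/funext => l; rewrite /gdv /=.
by rewrite [LHS](g_v1 H) [RHS](g_v1 H); congr gv; lia.
Qed.

Lemma gf0_act a b : gf (gact (mid n) p g) a b 0 = gf g (p a) (p b) 0.
Proof.
by apply/funext => l /=; rewrite [LHS](g_f1 H) [RHS](g_f1 H); congr gf; lia.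
Qed.

(** A row of [sigma] depends on that row of [g] alone, and a map between rows on its two ends alone,
    so reindexing the chain passes through. *)
Lemma sigma_act : sigma n (gact (mid n) p g) = gact (mid n) p (sigma n g).
Proof.
have E1 j : minn (minn j n) n = minn j n by lia.
have E2 j l : minn (maxn (minn j n) (minn l n)) n = minn (maxn j l) n by lia.
have E3 j l l' : minn (maxn (maxn (minn j n) (minn l n)) (minn l' n)) n =
  minn (maxn (maxn j l) l') n by lia.
apply: gdata_eq => [a j l|a j l l'|a j j' l|a b j l|a] //=; rewrite ?E1 ?E3 ?E2 ?grow_act //.
by rewrite gdv_act; have := gf0_act a (maxn a b); rewrite /= => ->; rewrite !mf_max.
Qed.

Lemma seta_act a j l : trnorm n (seta (gact (mid n) p g)) a j l =
  trnorm n (seta g) (p a) (minn j n) (minn l n).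
Proof.
rewrite /trnorm /seta grow_act /=.
have E1 : minn (minn j n) n = minn j n by lia.
have E2 : minn (maxn (minn j n) (minn l n)) n = minn (maxn j l) n by lia.
have E3 : minn (minn (maxn j l) n) n = minn (maxn j l) n by lia.
by rewrite E1 E2 E3.
Qed.

End Natural.

Definition rhod (g : gdata C) : gdata C := GData (fun a j l => gob g a 0 l)
  (fun a j l l' => gh g a 0 l l') (fun a j j' l => vid (gob g a 0 l))
  (fun a b j l => gf g a b 0 l) (fun _ => false).

Definition rho n g := gnorm n (rhod g).

Definition reta (g : gdata C) a j l := gv g a 0 j l.

Lemma isG_rho n k g : isG n k g -> isG n k (rho n g).
Proof.
move=> H; apply: isG_norm; split => //=.
- by move=> a j l; exact: (gob_cl H).
- by move=> a j l l'; exact: (gh_cl H).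
- by move=> a j j' l; rewrite (gob_cl H).
- by move=> a b j l; exact: (gf_cl H).
- by move=> *; exact: (g_hs H).
- by move=> *; exact: (g_ht H).
- by move=> *; exact: vs_id.
- by move=> *; exact: vt_id.
- by move=> *; exact: (g_fs H).
- by move=> *; exact: (g_ft H).
- by move=> *; exact: (g_hid H).
- by move=> *; exact: (g_fid H).
- by move=> *; exact: (g_hc H).
- by move=> *; exact: vid_vid.
- by move=> *; exact: (g_fc H).
- move=> a j j' l l' h1 h2 h3 h4; rewrite -{1}(g_hs H a (leq0n l) h3) -(g_ht H a (leq0n l) h3).
  exact: dsq_vid.
- by move=> *; exact: (g_sqf H).
- move=> a b j j' l ab h1 h2 h3.
  by rewrite -(g_fs H ab (leq0n l)) -(g_ft H ab (leq0n l)) vcomp_idl vcomp_idr.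
Qed.

Lemma isTr_rho n k g : isG n k g -> isTr n k (rho n g) g (trnorm n (reta g)).
Proof.
move=> H; rewrite -{2}(gnorm_id H); apply: isTr_norm; rewrite /reta; split => //=.
- by move=> a j l; exact: (gv_cl H).
- by move=> *; exact: (g_vs H).
- by move=> *; exact: (g_vt H).
- by move=> *; exact: (g_sq H).
- move=> a j j' l h1 h2 h3; rewrite (g_vc H) // -(g_vs H a (leq0n j') h2) vcomp_idr //.
- by move=> *; rewrite -(g_nat H).
Qed.

Lemma rho_act n k k' (p : mono k' k) g : isG n k g -> rho n (gact (mid n) p g) = gact (mid n) p (rho n g).
Proof.
move=> H; apply: gdata_eq => [a j l|a j l l'|a j j' l|a b j l|a] //=.
- by rewrite [LHS](g_ob1 H) [RHS](g_ob1 H); congr gob; lia.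
- by rewrite [LHS](g_h1 H) [RHS](g_h1 H); congr gh; lia.
- by rewrite [in LHS](g_ob1 H) [in RHS](g_ob1 H); congr (vid (gob _ _ _ _)); lia.
- by rewrite [LHS](g_f1 H) [RHS](g_f1 H) !mf_max; congr gf; lia.
Qed.

Lemma reta_act n k k' (p : mono k' k) g a j l : isG n k g ->
  trnorm n (reta (gact (mid n) p g)) a j l = trnorm n (reta g) (p a) (minn j n) (minn l n).
Proof.
by move=> H; rewrite /trnorm /reta /= [LHS](g_v1 H) [RHS](g_v1 H); congr gv; lia.
Qed.

End SigmaGrid.

(** * Deformation of the collage onto its two ends *)

Section Deform.
Variables (C : squaresCat) (W : protoWaldhausen C).

(** The homotopy from the identity to [sigma] along [seta]. A prism on S-rows has only S-rows, which
    keeps marked points marked. *)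
Lemma level_good_true n m q (cq : @mclosed m q) :
  exists T H, good (B := bsub (qlev_closed (M := gset C true) (n := n) cq)) T H.
Proof.
have [H [cH H0 H1 Hi]] := @level_cylinder C n id (sigma W n) (fun g => trnorm n (seta W g))
  (fun k g h => h) (@isG_sigma C W n) (@isTr_sigma C W n) (fun k k' p g _ => erefl)
  (fun k k' p g h => sigma_act W p h) (fun k k' p g h => @seta_act C W n k k' p g h) true m q cq.
exists 1%R, H; split; first by split => //; exact: ler01.
- move=> x t t0; have [d [b [p ->]]] := cls_surj x; rewrite H0 //; congr cls.
  apply: sval_inj; rewrite /= [RHS]surjective_pairing; congr pair; exact: sval_inj.
- by move=> x t t1; have [d [b [p ->]]] := cls_surj x; rewrite !H1.
- move=> x; have [d [b [p ->]]] := cls_surj x; rewrite H1 //.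
  by eexists _, _, _; split; last by [].
- move=> x t [d [b [p [mb ->]]]]; have [i [y [id ->]]] := Hi d b p t.
  eexists _, _, _; split; last by []; move=> a /=.
  by case: ifP => _ //; exact: mb.
Qed.

(** The transformation goes from [rho] to the identity, so the homotopy is run backwards. *)
Lemma level_good_false n m q (cq : @mclosed m q) :
  exists T H, good (B := bsub (qlev_closed (M := gset C false) (n := n) cq)) T H.
Proof.
have [H [cH H0 H1 Hi]] := @level_cylinder C n (@rho C n) id (fun g => trnorm n (reta g))
  (@isG_rho C n) (fun k g h => h) (@isTr_rho C n)
  (fun k k' p g h => rho_act p h) (fun k k' p g _ => erefl)
  (fun k k' p g h a j l => @reta_act C n k k' p g a j l h) false m q cq.
exists 1%R, (fun u => H (u.1, (1 - u.2)%R)); split.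
- split; first exact: ler01.
  apply: (continuous_compf cH); apply: continuous_pair; first exact: continuous_fst.
  by apply: cB; [exact: ccst|exact: continuous_snd].
- move=> x t t0; have [d [b [p ->]]] := cls_surj x; rewrite H1 /=; last by lra.
  congr cls; apply: sval_inj; rewrite /= [RHS]surjective_pairing; congr pair; exact: sval_inj.
- by move=> x t t1; have [d [b [p ->]]] := cls_surj x; rewrite /= !H0 //; lra.
- move=> x; have [d [b [p ->]]] := cls_surj x; rewrite H0 /=; last by lra.
  by eexists _, _, _; split; last by [].
- move=> x t [d [b [p [mb ->]]]]; have [i [y [id ->]]] := Hi d b p (1 - t)%R.
  eexists _, _, _; split; last by []; move=> a /=.
  by case: ifP => _ //; exact: mb.
Qed.

Lemma gset_deform b : exists H : breal (gset C b) * R -> breal (gset C b),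
  [/\ continuous H, forall x t, (t <= 0)%R -> H (x, t) = x,
      forall x, inV (gset C b) (H (x, 1%R)) & forall x t, inV (gset C b) x -> inV (gset C b) (H (x, t))].
Proof.
apply: realization_deform; first exact: gset_mark.
by case: b; [exact: level_good_true|exact: level_good_false].
Qed.

End Deform.

Lemma breal_fun (B : bset) (Z : Type) (F : forall d, B d -> pt d -> Z) :
  (forall d d' (h : hom d' d) (b : B d) p, F d' (bact h b) p = F d b (push h p)) ->
  exists G : breal B -> Z, forall d (b : B d) p, G (cls b p) = F d b p.
Proof.
move=> FE; pose F' (u : BSig B) : Z := let: existT d x := u in F d x.1.1 (x.1.2, x.2).
exists (fun x => F' (repr x)) => d b p.
have : eqclos (@bgen B) (repr (cls b p)) (existT (BFib B) d (b, p.1, p.2)).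
  by apply/asboolP; apply/(@eqmodP _ (eqclos_rel (@bgen B))); apply: (reprK (cls b p)).
move/(_ (fun u v => F' u = F' v)) => /= ->.
- by rewrite -surjective_pairing.
- by [].
- by [].
- by move=> u v w -> ->.
- move=> x y [d1 [d' [h [z [q [-> ->]]]]]]; rewrite /F' /=.
  by have := FE _ _ h z q; rewrite -!surjective_pairing.
Qed.

(** The realization carries the final topology with respect to its cells. *)
Lemma breal_closed (B : bset) (D : set (breal B)) :
  (forall d (b : B d), closed (cls b @^-1` D)) -> closed D.
Proof.
move=> cD; rewrite -[D]setCK; apply: open_closedC.
suff : open (qcl (@bgen B) @^-1` (~` D)) by [].
apply/sigT_openP => d; rewrite openE => -[[b s] t] /= nD.
have /closed_openC := cD d b; rewrite openE => /(_ (s, t) nD) [[P Q] /= [nP nQ] PQ].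
exists ([set b] `*` P, Q) => /=.
  by split => //; exists ([set b], P) => //; split => //=; rewrite nbhs_principalE.
by move=> [[b' s'] t'] /= [[/= -> hs] ht]; exact: (PQ (s', t')).
Qed.

(** * The marked points as a closed subspace *)

Section Marked.
Variable C : squaresCat.

Definition nmk (b : bool) : bset :=
  bsub (M := gset C b) (P := fun d => @bmk (gset C b) d) (@bmk_act (gset C b)).

Definition nincl b : breal (nmk b) -> breal (gset C b) :=
  bmapr (bval (M := gset C b) (@bmk_act (gset C b))).

(** T-rows form an initial segment of a chain and S-rows a final one, so either part, if nonempty,
    is a monotone retract of [[k]]. *)
Lemma row_retraction n k (g : gdata C) b a0 : isG n k g -> a0 <= k -> gm g a0 = b ->
  exists ps : mono k k, (forall a, gm g (ps a) = b) /\ (forall a, a <= k -> gm g a = b -> ps a = a).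
Proof.
move=> H ak; case: b => ga.
  have [p gp pmin] := ex_minnP (ex_intro (fun a => gm g a) a0 ga).
  have pk : p <= k by exact: leq_trans (pmin _ ga) ak.
  have h i j : i <= j -> maxn (minn i k) p <= maxn (minn j k) p by lia.
  have h' i : maxn (minn i k) p <= k by lia.
  have h2 i : maxn (minn i k) p = maxn (minn (minn i k) k) p by lia.
  exists (Mono h h' h2); split => [a|a ka /pmin pa] /=; last by lia.
  by apply: (g_mm H _ gp); exact: leq_maxr.
have e0 : exists a, (a <= k) && ~~ gm g a by exists a0; rewrite ak ga.
have [//|p /andP[pk gp] pmax] := ex_maxnP (m := k) e0; first by move=> i /andP[].
have h i j : i <= j -> minn i p <= minn j p by lia.
have h' i : minn i p <= k by lia.
have h2 i : minn i p = minn (minn i k) p by lia.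
exists (Mono h h' h2); split => [a|a ka ga'] /=.
  apply/negbTE; apply: contra gp; apply: (g_mm H); exact: geq_minr.
by apply/minn_idPl; apply: pmax; rewrite ka ga'.
Qed.

Section Retract.
Variable b : bool.
Local Notation M := (gset C b).
Local Notation N := (nmk b).

Lemma cls_ext (B : bset) d (x y : B d) (p : pt d) :
  bact ((mid d.1, ssupp p.2) : hom d d) x = bact ((mid d.1, ssupp p.2) : hom d d) y -> cls x p = cls y p.
Proof.
move=> E; have pE : push ((mid d.1, ssupp p.2) : hom d d) p = p.
  case: p E => s t _; rewrite /push /= spush_id spush_fix // => i; exact: ssupp_fix.
by rewrite -pE -!cls_act E.
Qed.

Definition nel d (g : M d) (f : mono d.2 d.2) (H : forall a, gm (sval g) (f a) = b) : N d :=
  exist (fun x : M d => bmk x) (bact ((mid d.1, f) : hom d d) g) H.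

Lemma nel_ext d (g : M d) (f f' : mono d.2 d.2) H H' p :
  (forall i : 'I_d.2.+1, co p.2 i != 0%R -> f i = f' i) ->
  cls (@nel d g f H) p = cls (@nel d g f' H') p.
Proof.
move=> ff; apply: cls_ext; apply: sval_inj.
suff : bact ((mid d.1, ssupp p.2) : hom d d) (bact ((mid d.1, f) : hom d d) g) =
       bact ((mid d.1, ssupp p.2) : hom d d) (bact ((mid d.1, f') : hom d d) g) by [].
by rewrite !bact_comp /hc /= (mcomp_ssupp ff).
Qed.

Definition okpt d (g : M d) (p : pt d) := forall i : 'I_d.2.+1, co p.2 i != 0%R -> gm (sval g) i = b.

Lemma okpt_ssupp d (g : M d) p : okpt g p -> forall a, gm (sval g) (ssupp p.2 a) = b.
Proof. by move=> ok a; have [i /ok + ->] := ssupp_in p.2 a. Qed.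

Lemma okpt_push d d' (h : hom d' d) (g : M d) p : okpt (bact h g) p <-> okpt g (push h p).
Proof.
split => ok i.
  rewrite /= co_push => nz; apply: contrapT => gi; move/negP: nz; apply; apply/eqP.
  apply: big1 => j /eqP ji; apply/eqP; apply: contrapT => /negP /ok.
  by rewrite /= ji.
move=> nz; have hi : h.2 i < d.2.+1 by rewrite ltnS mf_le.
exact: (ok (Ordinal hi) (spush_gt0 (j := Ordinal hi) nz erefl)).
Qed.

(** The partial inverse of [nincl], defined where all the mass of [p.2] sits on rows with the mark
    [b]. *)
Definition nret d (g : M d) (p : pt d) : option (breal N) :=
  match pselect (okpt g p) with
  | left ok => Some (cls (nel (okpt_ssupp ok)) p) | right _ => None end.

Lemma nretE d (g : M d) p (f : mono d.2 d.2) H : okpt g p -> (forall i : 'I_d.2.+1, co p.2 i != 0%R -> f i = i) ->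
  nret g p = Some (cls (@nel d g f H) p).
Proof.
move=> ok fE; rewrite /nret; case: pselect => // ok'; congr Some.
by apply: nel_ext => i nz; rewrite fE // ssupp_fix.
Qed.

Lemma nret_act d d' (h : hom d' d) (g : M d) p : nret (bact h g) p = nret g (push h p).
Proof.
rewrite /nret; case: pselect => ok; case: pselect => ok' //.
- congr Some; rewrite -cls_act; apply: cls_ext; apply: sval_inj.
  suff : bact ((mid d'.1, ssupp p.2) : hom d' d') (bact ((mid d'.1, ssupp p.2) : hom d' d') (bact h g)) =
    bact ((mid d'.1, ssupp p.2) : hom d' d') (bact h (bact ((mid d.1, ssupp (push h p).2) : hom d d) g)).
    by [].
  rewrite !bact_comp /hc /= !mcomp_idl !mcomp_idr; rewrite ?mcompA; congr (bact (_, _) g).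
  apply: mcomp_ssupp => i nz /=; rewrite ssupp_fix //.
  have hi : h.2 i < d.2.+1 by rewrite ltnS mf_le.
  exact/esym/(ssupp_fix (spush_gt0 (j := Ordinal hi) nz erefl)).
- by case: ok'; apply/okpt_push.
- by case: ok; apply/okpt_push.
Qed.

Lemma nret_exists : exists G : breal M -> option (breal N),
  (forall d (g : M d) p, G (cls g p) = nret g p) /\ forall z, G (nincl z) = Some z.
Proof.
have [G GE] := breal_fun nret_act; exists G; split => // z.
have [d [x [p ->]]] := cls_surj z; rewrite /nincl bmapr_cls GE.
have H a : gm (sval (sval x)) (mid d.2 a) = b := svalP x (minn a d.2).
rewrite (nretE (f := mid d.2) H) => [|i _|i _]; last by rewrite /=; apply/minn_idPl; rewrite -ltnS.
  congr (Some (cls _ _)); apply: sval_inj; exact: bact_id.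
exact: (svalP x).
Qed.

Lemma nincl_inj : injective (@nincl b).
Proof. by have [G [_ GE]] := nret_exists; move=> x y /(congr1 G); rewrite !GE => -[]. Qed.

(** In each cell the preimage is the closed set where the rows of the other mark have total mass 0,
    intersected with the preimage of [Z] under one fixed operator, the retraction onto the marked
    rows. *)
Lemma nincl_closed (Z : set (breal N)) : closed Z -> closed (@nincl b @` Z).
Proof.
move=> cZ; apply: breal_closed => d g; have [G [GE Gn]] := nret_exists.
have okZ p : (@nincl b @` Z) (cls g p) -> okpt g p.
  move=> [z Zz zE]; have := GE _ g p; rewrite -zE Gn /nret.
  by case: pselect.
have [[a ak ga]|no] := pselect (exists2 a, a <= d.2 & gm (sval g) a = b); last first.
  suff -> : cls g @^-1` (@nincl b @` Z) = set0 by exact: closed0.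
  apply/seteqP; split => // p /= /okZ ok; apply: no.
  by have [i /ok gi] := ssupp_ex p.2; exists i => //; rewrite -ltnS.
have [ps [psm psf]] := row_retraction (svalP g) ak ga.
have okE p : okpt g p <-> (\sum_(i < d.2.+1 | gm (sval g) i != b) co p.2 i = 0)%R.
  split => [ok|s0 i nz].
    by apply: big1 => i gi; apply/eqP; apply: contrapT => /negP /ok gb; rewrite gb eqxx in gi.
  apply: contrapT => /eqP gi; move/negP: nz; apply; apply/eqP.
  move: s0; rewrite (bigD1 i) //= => s0.
  have := co_ge0 p.2 i; have : (0 <= \sum_(j < d.2.+1 | (gm (sval g) j != b) && (j != i)) co p.2 j)%R.
    by apply: sumr_ge0 => j _; exact: co_ge0.
  by move: s0; lra.
have okf p : okpt g p -> forall i : 'I_d.2.+1, co p.2 i != 0%R -> ps i = i.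
  by move=> ok i /ok gi; apply: psf => //; rewrite -ltnS.
rewrite (_ : _ @^-1` _ = [set p | (\sum_(i < d.2.+1 | gm (sval g) i != b) co p.2 i = 0)%R] `&`
    (cls (nel psm) @^-1` Z)).
  apply: closedI; last by apply: preimage_closed => // p _; exact: cls_continuous.
  apply: closed_eqf; last exact: ccst.
  apply: csum => i; apply: (@continuous_compf _ _ _ (fun s : simplex d.2 => co s i) snd).
    exact: co_continuous.
  exact: continuous_snd.
apply/seteqP; split => p /=.
  move=> Zp; have ok := okZ _ Zp; split; first exact/okE.
  have [z Zz zE] := Zp; have := GE _ g p; rewrite -zE Gn (nretE psm ok (okf _ ok)) => -[<-] //.
move=> [/okE ok Zp]; exists (cls (nel psm) p) => //.
rewrite /nincl bmapr_cls; transitivity (cls g (push ((mid d.1, ps) : hom d d) p)); first exact: cls_act.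
congr cls; case: p ok Zp => s t ok Zp; rewrite /push /= spush_id spush_fix // => i; exact: okf ok i.
Qed.

(** An injective closed map is an embedding, so continuity can be tested after it. *)
Lemma nincl_lift (X : topologicalType) (f : X -> breal M) : continuous f -> (forall x, inV M (f x)) ->
  exists f' : X -> breal N, continuous f' /\ forall x, nincl (f' x) = f x.
Proof.
move=> cf Vf.
have ex x : exists z, nincl z = f x.
  have [d [g [p [mg ->]]]] := Vf x; exists (cls (exist (fun x : M d => bmk x) g mg : N d) p).
  by rewrite /nincl bmapr_cls.
have [f' fE] := choice ex; exists f'; split => //.
apply/continuous_closedP => Z cZ.
rewrite (_ : _ @^-1` _ = f @^-1` (@nincl b @` Z)).
  by apply: preimage_closed; [move=> x _; exact: cf|exact: nincl_closed].
apply/seteqP; split => x /=; first by move=> Zx; exists (f' x).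
by move=> [z Zz]; rewrite -fE => /nincl_inj <-.
Qed.

End Retract.
End Marked.

Section HomotopyR.
Local Open Scope ring_scope.

Lemma homotopicR (A B : topologicalType) (f g : A -> B) (H : A * R -> B) : continuous H ->
  (forall a, H (a, 0) = f a) -> (forall a, H (a, 1) = g a) -> homotopic f g.
Proof.
move=> cH H0 H1; exists (fun u => H (u.1, val u.2)); split; last first.
  by split => a t /= ->.
apply: (continuous_compf cH); apply: continuous_pair; first exact: continuous_fst.
apply: (continuous_compf (g := fun t : unit_interval => val t)); last exact: continuous_snd.
exact: initial_continuous.
Qed.

End HomotopyR.

Lemma nmk_gset_equiv (C : squaresCat) (W : protoWaldhausen C) b :
  exists (e : breal (gset C b) -> breal (nmk C b)) (H : breal (gset C b) * R -> breal (gset C b))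
    (K : breal (nmk C b) * R -> breal (nmk C b)),
  [/\ continuous e, continuous H, continuous K,
    (forall x, H (x, 0%R) = x) /\ (forall x, H (x, 1%R) = nincl (e x))
    & (forall x, K (x, 0%R) = x) /\ (forall x, K (x, 1%R) = e (nincl x))].
Proof.
have [H [cH H0 H1 HV]] := gset_deform W b.
have cn : continuous (@nincl C b) by exact: bmapr_continuous.
have [|e [ce eE]] := nincl_lift (f := fun x => H (x, 1%R)) _ H1.
  by apply: (continuous_compf cH); apply: continuous_pair; [exact: cidf|exact: ccst].
have Vn x : inV (gset C b) (nincl x).
  have [d [y [p ->]]] := cls_surj x; rewrite /nincl bmapr_cls.
  by exists d, (sval y), p; split => //; exact: (svalP y).
(* Marked points stay marked under [H], so its restriction to them lifts; this is the second
   homotopy of the equivalence. *)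
have [||K [cK KE]] := nincl_lift (f := fun u : breal (nmk C b) * R => H (nincl u.1, u.2)).
- apply: (continuous_compf cH); apply: continuous_pair; last exact: continuous_snd.
  by apply: (continuous_compf cn); exact: continuous_fst.
- by move=> u; exact: HV.
exists e, H, K; split => //; split => x.
- by rewrite H0.
- by rewrite eE.
- by apply: nincl_inj; rewrite KE H0.
- by apply: nincl_inj; rewrite KE eE.
Qed.

(** * Grids and chains *)

Section PathExt.
Variable C : squaresCat.

Lemma hpath_ext (A A' : nat -> dob C) h h' p k : A p = A' p ->
  (forall i, p <= i < p + k -> h i = h' i) -> hpath A h p k = hpath A' h' p k.
Proof.
move=> Ap; elim: k => [_|k IH H] /=; first by rewrite Ap.
by rewrite H ?IH //; [move=> i hi; apply: H; lia|lia].
Qed.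

Lemma vpath_ext (A A' : nat -> dob C) u u' p k : A p = A' p ->
  (forall i, p <= i < p + k -> u i = u' i) -> vpath A u p k = vpath A' u' p k.
Proof.
move=> Ap; elim: k => [_|k IH H] /=; first by rewrite Ap.
by rewrite H ?IH //; [move=> i hi; apply: H; lia|lia].
Qed.

End PathExt.

Section Steps.
Variable C : squaresCat.
Local Notation O := (sqc_O C).

(* The elementary arrows [(l, l+1)], [(j, j+1)], [(a, a+1)] of a grid. *)
Record sdata := SData {
  ko : nat -> nat -> nat -> dob C;
  kh : nat -> nat -> nat -> hmor C;
  kv : nat -> nat -> nat -> vmor C;
  kf : nat -> nat -> nat -> vmor C }.

Record isSt (n k : nat) (b : bool) (s : sdata) : Prop := IsSt {
  k_h : forall a j l, a <= k -> j <= l < n -> hs (kh s a j l) = ko s a j l /\ ht (kh s a j l) = ko s a j l.+1;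
  k_v : forall a j l, a <= k -> j < l <= n -> vs (kv s a j l) = ko s a j l /\ vt (kv s a j l) = ko s a j.+1 l;
  k_f : forall a j l, a < k -> j <= l <= n -> vs (kf s a j l) = ko s a j l /\ vt (kf s a j l) = ko s a.+1 j l;
  k_hv : forall a j l, a <= k -> j < l < n -> dsq (kh s a j l) (kv s a j l) (kv s a j l.+1) (kh s a j.+1 l);
  k_hf : forall a j l, a < k -> j <= l < n -> dsq (kh s a j l) (kf s a j l) (kf s a j l.+1) (kh s a.+1 j l);
  k_vf : forall a j l, a < k -> j < l <= n ->
    vcomp (kf s a j.+1 l) (kv s a j l) = vcomp (kv s a.+1 j l) (kf s a j l);
  k_S : forall a j, b -> a <= k -> j <= n -> ko s a j j = O;
  k_T : forall a j l, ~~ b -> a <= k -> j < l <= n -> kv s a j l = vid (ko s a j l);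
  k_Th : forall a j l, ~~ b -> a <= k -> j < l < n -> kh s a j l = kh s a j.+1 l }.

Definition skh s a j l l' := hpath (ko s a j) (kh s a j) l (l' - l).
Definition skv s a j j' l := vpath (fun i => ko s a i l) (fun i => kv s a i l) j (j' - j).
Definition skf s a b j l := vpath (fun i => ko s i j l) (fun i => kf s i j l) a (b - a).

Definition gpaths k b s : gdata C := GData
  (fun a j l => ko s (minn a k) j l)
  (fun a j l l' => skh s (minn a k) j l l')
  (fun a j j' l => skv s (minn a k) j j' l)
  (fun a a' j l => skf s (minn a k) (minn a' k) j l)
  (fun _ => b).

Definition grid_of n k b s := gnorm n (gpaths k b s).

Section Valid.
Variables (n k : nat) (b : bool) (s : sdata).
Hypothesis H : isSt n k b s.

Lemma hval_st a j l m : a <= k -> j <= l -> l + m <= n -> hval (ko s a j) (kh s a j) l m.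
Proof. by move=> ak jl ln i hi; apply: (k_h H); lia. Qed.

Lemma vval_st a j l m : a <= k -> j + m <= l -> l <= n ->
  vval (fun i => ko s a i l) (fun i => kv s a i l) j m.
Proof. by move=> ak jl ln i hi; apply: (k_v H); lia. Qed.

Lemma fval_st a j l m : a + m <= k -> j <= l -> l <= n ->
  vval (fun i => ko s i j l) (fun i => kf s i j l) a m.
Proof. by move=> ak jl ln i hi; apply: (k_f H); lia. Qed.

Lemma skh_st a j l l' : a <= k -> j <= l -> l <= l' -> l' <= n ->
  hs (skh s a j l l') = ko s a j l /\ ht (skh s a j l l') = ko s a j l'.
Proof.
move=> ak jl ll ln; have [|h1 h2] := hpath_st (hval_st (m := l' - l) ak jl _); first by lia.
by split => //; rewrite h2 subnKC.
Qed.

Lemma skv_st a j j' l : a <= k -> j <= j' -> j' <= l -> l <= n ->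
  vs (skv s a j j' l) = ko s a j l /\ vt (skv s a j j' l) = ko s a j' l.
Proof.
move=> ak jl ll ln; have [|h1 h2] := vpath_st (vval_st (j := j) (m := j' - j) (l := l) ak _ ln); first by lia.
by split => //; rewrite h2 subnKC.
Qed.

Lemma skf_st a a' j l : a <= a' -> a' <= k -> j <= l -> l <= n ->
  vs (skf s a a' j l) = ko s a j l /\ vt (skf s a a' j l) = ko s a' j l.
Proof.
move=> aa ak jl ln; have [|h1 h2] := vpath_st (fval_st (a := a) (m := a' - a) _ jl ln); first by lia.
by split => //; rewrite h2 subnKC.
Qed.

Lemma skh_v a j l l' : a <= k -> j < l -> l <= l' -> l' <= n ->
  dsq (skh s a j l l') (kv s a j l) (kv s a j l') (skh s a j.+1 l l').
Proof.
move=> ak jl ll ln; have [h1 h2] := k_v H (a := a) (j := j) (l := l) ak ltac:(lia).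
rewrite -[in X in dsq _ _ X _](subnKC ll).
by apply: (hpath_sq (m := kv s a j)) => // i hi; apply: (k_hv H); lia.
Qed.

Lemma skh_f a j l l' : a < k -> j <= l -> l <= l' -> l' <= n ->
  dsq (skh s a j l l') (kf s a j l) (kf s a j l') (skh s a.+1 j l l').
Proof.
move=> ak jl ll ln; have [h1 h2] := k_f H (a := a) (j := j) (l := l) ak ltac:(lia).
rewrite -[in X in dsq _ _ X _](subnKC ll).
by apply: (hpath_sq (m := kf s a j)) => // i hi; apply: (k_hf H); lia.
Qed.

Lemma preG_paths : preG n k (gpaths k b s).
Proof.
have mk a : minn a k <= k by exact: geq_minr.
have mm a a' : a <= a' -> minn a k <= minn a' k by lia.
have mmk a : minn (minn a k) k = minn a k by lia.
split => //=.
- by move=> *; rewrite mmk.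
- by move=> *; rewrite mmk.
- by move=> *; rewrite mmk.
- by move=> *; rewrite !mmk.
- by move=> a j l l' h1 h2 h3; have [] := skh_st (mk a) h1 h2 h3.
- by move=> a j l l' h1 h2 h3; have [] := skh_st (mk a) h1 h2 h3.
- by move=> a j l l' h1 h2 h3; have [] := skv_st (mk a) h1 h2 h3.
- by move=> a j l l' h1 h2 h3; have [] := skv_st (mk a) h1 h2 h3.
- by move=> a a' j l h1 h2 h3; have [] := skf_st (mm _ _ h1) (mk a') h2 h3.
- by move=> a a' j l h1 h2 h3; have [] := skf_st (mm _ _ h1) (mk a') h2 h3.
- by move=> *; rewrite /skh subnn.
- by move=> *; rewrite /skv subnn.
- by move=> *; rewrite /skf subnn.
- move=> a j l l' l'' h1 h2 h3 h4; rewrite /skh -[X in hpath _ _ X (l'' - l')](subnKC h2) hpath_cat.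
    by congr hpath; lia.
  by apply: hval_st => //; lia.
- move=> a j j' j'' l h1 h2 h3 h4; rewrite /skv -[X in vpath _ _ X (j'' - j')](subnKC h1) vpath_cat.
    by congr vpath; lia.
  by apply: vval_st => //; lia.
- move=> a a' a'' j l /mm h1 /mm h2 h3 h4; rewrite /skf.
  rewrite -[X in vpath _ _ X (minn a'' k - _)](subnKC h1) vpath_cat; first by congr vpath; lia.
  by apply: fval_st => //; lia.
- move=> a j j' l l' h1 h2 h3 h4.
  have [e1 e2] := skh_st (mk a) (leq_trans h1 h2) h3 h4.
  have := @vpath_sq C (fun i => skh s (minn a k) i l l') (fun i => ko s (minn a k) i l)
    (fun i => kv s (minn a k) i l) (fun i => ko s (minn a k) i l')
    (fun i => kv s (minn a k) i l') j (j' - j) e1 e2.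
  by rewrite subnKC //; apply => i hi; apply: skh_v => //; lia.
- move=> a a' j l l' /mm h1 h2 h3 h4.
  have [e1 e2] := skh_st (mk a) h2 h3 h4.
  have := @vpath_sq C (fun i => skh s i j l l') (fun i => ko s i j l)
    (fun i => kf s i j l) (fun i => ko s i j l')
    (fun i => kf s i j l') (minn a k) (minn a' k - minn a k) e1 e2.
  by rewrite subnKC //; apply => i hi; apply: skh_f => //; lia.
- move=> a a' j j' l /mm h1 h2 h3 h4; have ak' := mk a'.
  have := @vpath_nat C _ _ _ _ (fun i => skf s (minn a k) (minn a' k) i l) j (j' - j)
    (vval_st (j := j) (m := j' - j) (l := l) (mk a) ltac:(lia) h4)
    (vval_st (j := j) (m := j' - j) (l := l) (mk a') ltac:(lia) h4).
  rewrite subnKC //; apply => i hi; first by apply: skf_st => //; lia.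
  (* The outer pasting runs through the rows of the object, this inner one along the chain. *)
  symmetry; have il : i < l by lia.
  have := @vpath_nat C _ _ _ _ (fun c => kv s c i l) (minn a k) (minn a' k - minn a k)
    (fval_st (a := minn a k) (m := minn a' k - minn a k) (j := i) (l := l) ltac:(lia) ltac:(lia) h4)
    (fval_st (a := minn a k) (m := minn a' k - minn a k) (j := i.+1) (l := l) ltac:(lia) il h4).
  rewrite subnKC //; apply => c hc; first by apply: (k_v H); lia.
  by symmetry; apply: (k_vf H); lia.
- move=> a j j' l bm h1 h2 h3; apply: (vpath_id (vval_st (mk a) _ h3)); first by lia.
  by move=> i hi; apply: (k_T H) => //; lia.
- move=> a j j' l l' bm h1 h2 h3 h4.
  have oE i : j <= i -> i <= l -> ko s (minn a k) i l = ko s (minn a k) j l.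
    move: i; apply: ind_from => // i ji IH il; rewrite -IH ?(ltnW il) //.
    have [_ <-] := k_v H (a := minn a k) (j := i) (l := l) (mk a) ltac:(lia).
    by rewrite (k_T H) ?vt_id //; lia.
  apply: hpath_ext => [|i hi]; first by rewrite oE.
  have : j' <= i by lia. 
  move: j' h1 {h2}; apply: ind_from => // j' jj IH ji.
  by rewrite IH ?(ltnW ji) // (k_Th H) //; lia.
- by move=> a j bm jn; exact: (k_S H).
Qed.

Lemma isG_grid_of : isG n k (grid_of n k b s).
Proof. exact/isG_norm/preG_paths. Qed.

End Valid.

Section OfGrid.
Variables (n k : nat) (g : gdata C) (b : bool) (s : sdata).
Hypotheses (H : isG n k g) (gb : forall a, gm g a = b).
Hypothesis so : forall a j l, a <= k -> j <= l <= n -> ko s a j l = gob g a j l.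
Hypothesis shh : forall a j l, a <= k -> j <= l < n -> kh s a j l = gh g a j l l.+1.
Hypothesis svv : forall a j l, a <= k -> j < l <= n -> kv s a j l = gv g a j j.+1 l.
Hypothesis sff : forall a j l, a < k -> j <= l <= n -> kf s a j l = gf g a a.+1 j l.

Lemma gh_path a j l m : j <= l -> hpath (gob g a j) (fun l => gh g a j l l.+1) l m = gh g a j l (l + m).
Proof.
move=> jl; elim: m => [|m IH] /=; first by rewrite addn0 (g_hid H).
by rewrite IH addnS (g_hc H) // ?leq_addr.
Qed.

Lemma gv_path a j l m : j + m <= l ->
  vpath (fun i => gob g a i l) (fun i => gv g a i i.+1 l) j m = gv g a j (j + m) l.
Proof.
elim: m => [|m IH] jl /=; first by rewrite addn0 (g_vid H) //; lia.
by rewrite IH ?addnS ?(g_vc H) // ?leq_addr //; lia.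
Qed.

Lemma gf_path a j l m : j <= l ->
  vpath (fun i => gob g i j l) (fun i => gf g i i.+1 j l) a m = gf g a (a + m) j l.
Proof.
move=> jl; elim: m => [|m IH] /=; first by rewrite addn0 (g_fid H).
by rewrite IH addnS (g_fc H) // ?leq_addr.
Qed.

Lemma grid_of_steps : grid_of n k b s = g.
Proof.
have mk a : minn a k <= k by exact: geq_minr.
rewrite -(gnorm_id H) /grid_of.
apply: gdata_eq => [a j l|a j l l'|a j j' l|a a' j l|a] //=.
- by rewrite so //; [rewrite -(gob_cl H)|lia].
- rewrite (gh_cl H) /skh; set x := minn j n; set y := minn _ n; set z := minn _ n.
  have [xy yz zn] : [/\ x <= y, y <= z & z <= n] by rewrite /x /y /z; split; lia.
  rewrite -[in RHS](subnKC yz) -gh_path //; apply: hpath_ext => [|i hi]; first by rewrite so //; lia.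
  by rewrite shh //; lia.
- rewrite (gv_cl H) /skv; set x := minn j n; set y := minn (maxn j j') n; set z := minn (maxn _ l) n.
  have [xy yz zn] : [/\ x <= y, y <= z & z <= n] by rewrite /x /y /z; split; lia.
  rewrite -[in RHS](subnKC xy) -gv_path; last by lia.
  apply: vpath_ext => [|i hi]; first by rewrite so //; lia.
  by rewrite svv //; lia.
- rewrite (gf_cl H) /skf; set x := minn j n; set y := minn _ n.
  have [xy yn] : x <= y /\ y <= n by rewrite /x /y; split; lia.
  have aa : minn a k <= minn (maxn a a') k by lia.
  rewrite -[in RHS](subnKC aa) -gf_path //; apply: vpath_ext => [|i hi]; first by rewrite so //; lia.
  by rewrite sff //; lia.
Qed.

End OfGrid.

End Steps.

(** * Identification with the realizations of T and S *)

Section Interface.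
Variables (X : simpCat) (N : bset) (gam : forall d, N d -> BEl X d.1 d.2).
Hypothesis gam_inj : forall d, injective (gam (d := d)).
Hypothesis gam_surj : forall d (c : BEl X d.1 d.2), exists x : N d, gam x = c.
Hypothesis gam_act : forall d d' (h : hom d' d) (x : N d),
  sval (gam (bact h x)) = @chain_map X d.1 d'.1 h.1 (@nerve_act (sc_lvl X d.1) d'.2 h.2 (sval (gam x))).
Hypothesis actO_ext : forall n m (t t' : nat -> nat), (forall i, i <= m -> t i = t' i) ->
  @sc_actO X n m t = @sc_actO X n m t'.
Hypothesis actM_ext : forall n m (t t' : nat -> nat), (forall i, i <= m -> t i = t' i) ->
  @sc_actM X n m t = @sc_actM X n m t'.

Definition mono_of m n t (H : monotone_map m n t) : mono m n.
Proof.
refine (@Mono m n (fun i => t (minn i m)) _ _ _) => [i j ij|i|i].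
- by apply: H.1; lia.
- by apply: H.2; lia.
- by congr t; lia.
Defined.

Lemma val_spush m n (f : mono m n) (t : nat -> nat) (s : simplex m) : (forall i, i <= m -> f i = t i) ->
  val (spush f s) = @simplex_push m n t (val s).
Proof.
move=> ft; apply/rowP => i; rewrite !mxE; apply: eq_bigl => j; rewrite ft //.
by rewrite -ltnS.
Qed.

Lemma nerve_act_ext (K : precat) k (t t' : nat -> nat) c : (forall i, i <= k -> t i = t' i) ->
  @nerve_act K k t c = @nerve_act K k t' c.
Proof.
move=> tt'; rewrite /nerve_act; congr pair; apply/funext => i.
  by rewrite tt' // geq_minr.
by case: ifP => ik; rewrite !tt' //; lia.
Qed.

Definition rcl d (c : BEl X d.1 d.2) (p : pt d) : realization X :=
  qcl (@real_gen X) (existT (Fib X) (d.1, d.2) (c, p.1, p.2)).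

(** Operators in [realization] are arbitrary functions constrained only on [0..m], while [mono]
    normalizes them; [mono_of] and the extensionality hypotheses bridge the two. *)
Lemma realization_iso : exists (f : breal N -> realization X) (g : realization X -> breal N),
  [/\ continuous f, continuous g, cancel f g & cancel g f].
Proof.
have [||f [cf fE]] := @breal_lift1 N (realization X) (fun d x p => rcl (gam x) p).
- move=> [n k] x p; apply: (@continuous_comp _ _ _
    (fun p : pt (n, k) => existT (Fib X) (n, k) (gam x, p.1, p.2))); last exact: qcl_continuous.
  apply: (@continuous_comp _ _ _ (fun p : pt (n, k) => ((gam x, p.1), p.2) : Fib X (n, k))).
    apply: continuous_pair; last exact: continuous_snd.
    by apply: continuous_pair; [exact: ccst|exact: continuous_fst].
  exact: existT_continuous.
- move=> d d' h x p; apply: qcl_rel.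
  exists d.1, d.2, d'.1, d'.2, h.1, h.2, (gam x), (gam (bact h x)), (push h p).1, p.1, (push h p).2, p.2.
  split => //; split; split => [i j ij _|i _]; do ?[exact: mf_homo|exact: mf_le].
have [del delE] : exists del : forall d, BEl X d.1 d.2 -> N d, forall d c, gam (del d c) = c.
  by exists (fun d c => sval (cid (gam_surj c))) => d c; case: cid.
have delK d x : del d (gam x) = x by apply: gam_inj; rewrite delE.
pose F (u : RSig X) : breal N := let: existT d x := u in cls (del d x.1.1) ((x.1.2, x.2) : pt d).
have [||g [cg gE]] := @qlift _ (@real_gen X) R (breal N) (fun u => F u.1) (@locally_compactR R) (@Rhausdorff R).
- apply: (@continuous_compf _ _ _ F fst); last exact: continuous_fst.
  move=> [d [[c s] t]] U /(@cls_continuous N d (del d c) (s, t)) [[P Q] [/= nP nQ] PQ].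
  exists ([set c] `*` P, Q) => /=.
    by split => //; exists ([set c], P) => //; split => //=; rewrite nbhs_principalE.
  by move=> [[c' s'] t'] /= [[/= -> hs] ht]; exact: (PQ (s', t')).
- move=> a b z [n [k [n' [k' [th [ps [y [y' [s [s' [t [t' [[mth mps] yE [sE tE] -> ->]]]]]]]]]]]]].
  rewrite /F /=.
  have thE i : i <= n' -> mono_of mth i = th i by move=> h; rewrite /= (minn_idPl h).
  have psE i : i <= k' -> mono_of mps i = ps i by move=> h; rewrite /= (minn_idPl h).
  pose h : hom (n', k') (n, k) := (mono_of mth, mono_of mps).
  have -> : s = spush h.1 s' by apply: val_inj; rewrite sE; apply/esym/val_spush.
  have -> : t = spush h.2 t' by apply: val_inj; rewrite tE; apply/esym/val_spush.
  have -> : del (n', k') y' = bact h (del (n, k) y).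
    apply: gam_inj; rewrite delE; apply: sval_inj; rewrite yE gam_act delE.
    rewrite (nerve_act_ext _ (psE : forall i, i <= k' -> h.2 i = ps i)); congr pair; apply/funext => i.
      by rewrite (actO_ext _ (thE : forall i, i <= n' -> h.1 i = th i)).
    by rewrite (actM_ext _ (thE : forall i, i <= n' -> h.1 i = th i)).
  by rewrite cls_act.
exists f, (fun x => g (x, 0%R)); split => //.
- by apply: (continuous_compf cg); apply: continuous_pair; [exact: cidf|exact: ccst].
- move=> x; have [[n k] [y [p ->]]] := cls_surj x; rewrite fE /rcl gE /F /= delK.
  by rewrite -surjective_pairing.
- by move=> x; have [[[n k] [[c s] t]] ->] := qcl_surj x; rewrite gE /F /= fE /rcl delE.
Qed.

End Interface.

Section GridOf.
Variables (C : squaresCat) (n k : nat) (b : bool) (s : sdata C).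
Hypothesis H : isSt n k b s.

Lemma grid_of_ob a j l : a <= k -> j <= l <= n -> gob (grid_of n k b s) a j l = ko s a j l.
Proof. by move=> ak jl /=; congr ko; lia. Qed.

Lemma grid_of_h a j l : a <= k -> j <= l < n -> gh (grid_of n k b s) a j l l.+1 = kh s a j l.
Proof.
move=> ak jl; have E : gh (grid_of n k b s) a j l l.+1 = skh s a j l l.+1 by rewrite /=; congr skh; lia.
by rewrite E /skh subSnn /= addn0; have [<- _] := k_h H ak jl; rewrite hcomp_idr.
Qed.

Lemma grid_of_v a j l : a <= k -> j < l <= n -> gv (grid_of n k b s) a j j.+1 l = kv s a j l.
Proof.
move=> ak jl; have E : gv (grid_of n k b s) a j j.+1 l = skv s a j j.+1 l by rewrite /=; congr skv; lia.
by rewrite E /skv subSnn /= addn0; have [<- _] := k_v H ak jl; rewrite vcomp_idr.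
Qed.

Lemma grid_of_f a j l : a < k -> j <= l <= n -> gf (grid_of n k b s) a a.+1 j l = kf s a j l.
Proof.
move=> ak jl; have E : gf (grid_of n k b s) a a.+1 j l = skf s a a.+1 j l by rewrite /=; congr skf; lia.
by rewrite E /skf subSnn /= addn0; have [<- _] := k_f H ak jl; rewrite vcomp_idr.
Qed.

End GridOf.

Section TGrids.
Variable C : squaresCat.
Local Notation O := (sqc_O C).

Definition trob n (g : gdata C) i : TOb C :=
  (fun l => if l <= n then gob g i 0 l else O, fun l => if l < n then gh g i 0 l l.+1 else hid O).

Definition trmor n (g : gdata C) a b : TMor C :=
  ((trob n g a, trob n g b), fun l => if l <= n then gf g a b 0 l else vid O).

Section Fixed.
Variables (n k : nat) (g : gdata C).
Hypothesis H : isG n k g.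

Lemma trob_cl a : trob n g a = trob n g (minn a k).
Proof.
by congr pair; apply/funext => l; [rewrite (gob_cl H)|rewrite (gh_cl H)].
Qed.

Lemma trmor_cl a b : trmor n g a b = trmor n g (minn a k) (minn b k).
Proof.
rewrite /trmor -!trob_cl; congr pair.
by apply/funext => l; rewrite (gf_cl H).
Qed.

Lemma trmor_id a : trmor n g a a = @pc_id (Tcat C n) (trob n g a).
Proof.
congr pair; apply/funext => l /=; case: ifP => // _; exact: (g_fid H).
Qed.

Lemma trmor_path a m : @cpath (Tcat C n) (trob n g) (fun i => trmor n g i i.+1) a m = trmor n g a (a + m).
Proof.
elim: m => [|m IH]; first by rewrite addn0 trmor_id.
rewrite [LHS]/= IH addnS; congr pair; apply/funext => l /=.
by case: ifP => _; [rewrite (g_fc H) ?leq_addr|rewrite vid_vid].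
Qed.

Lemma isTOb_trob a : isTOb n (trob n g a).
Proof.
split => i hi /=.
- by rewrite hi (ltnW hi) (g_hs H) ?(g_ht H).
- by rewrite leqNgt hi.
- by rewrite ltnNge hi.
Qed.

Lemma isTMor_trmor a b : a <= b -> isTMor n (trmor n g a b).
Proof.
move=> ab; split; rewrite /=; [exact: isTOb_trob|exact: isTOb_trob| | |].
- by move=> i; case: ifP => _; rewrite ?vs_id ?vt_id ?(g_fs H) ?(g_ft H).
- by move=> i hi; rewrite hi (ltnW hi); exact: (g_sqf H).
- by move=> i hi; rewrite leqNgt hi.
Qed.

Lemma isNerve_tr : @isNerve (Tcat C n) k (trob n g, fun i => trmor n g i i.+1).
Proof.
split => i ik /=; [exact: isTOb_trob|by split => //; exact: isTMor_trmor| |].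
- by rewrite trob_cl (minn_idPr (ltnW ik)).
- by rewrite trmor_cl (minn_idPr ik) (minn_idPr (leqW ik)) trmor_id.
Qed.

Hypothesis gT : forall a, gm g a = false.

(** Vertical maps of T-rows are identities, so naturality makes the components independent of
    [j]. *)
Lemma T_f a b j l : a <= b -> j <= l -> gf g a b j l = gf g a b 0 l.
Proof.
move=> ab jl; have := g_nat H ab (leq0n j) jl; rewrite !(g_T H) ?gT //.
by rewrite -(T_ob H (a := a) _ jl) ?gT // -(g_fs H ab jl) -(g_ft H ab (leq0n l)) vcomp_idr vcomp_idl.
Qed.

Variables (n' k' : nat) (t : mono n' n) (p : mono k' k).

Lemma trob_act a : trob n' (gact t p g) a = T_actO n n' t (trob n g (p a)).
Proof.
congr pair; apply/funext => l /=; case: ifP => // ln.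
  by rewrite mf_le (T_ob H) ?gT //; exact: mf_homo.
have tl : t l <= t l.+1 by exact: mf_homo.
rewrite -(g_Th H (j := 0)) ?gT //; last by exact: mf_homo.
rewrite -[in LHS](subnKC tl) -(gh_path H) //; apply: hpath_ext => [|i hi]; first by rewrite mf_le.
by have := mf_le t l.+1; case: ifP => //; lia.
Qed.

Lemma trmor_act a b : a <= b -> trmor n' (gact t p g) a b = T_actM n n' t (trmor n g (p a) (p b)).
Proof.
move=> ab; rewrite /trmor !trob_act; congr pair; apply/funext => l /=; case: ifP => // ln.
by rewrite mf_le T_f //; exact: mf_homo.
Qed.

Lemma nerve_tr_act :
  (trob n' (gact t p g), fun i => trmor n' (gact t p g) i i.+1) =
  @chain_map (Tsimp C) n n' t (@nerve_act (Tcat C n) k' p (trob n g, fun i => trmor n g i i.+1)).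
Proof.
congr pair; apply/funext => i; first by rewrite trob_act /= -mf_norm.
rewrite trmor_act //= -/(trmor n g); case: ifP => ik.
  by rewrite trmor_path subnKC //; exact: mf_homo.
have ki : k' <= i by lia.
by rewrite (mf_norm p i) (mf_norm p i.+1) (minn_idPr ki) (minn_idPr (leqW ki)) trmor_id.
Qed.

End Fixed.

Definition tsteps (c : (nat -> TOb C) * (nat -> TMor C)) : sdata C :=
  SData (fun a j l => (c.1 a).1 l) (fun a j l => (c.1 a).2 l)
        (fun a j l => vid ((c.1 a).1 l)) (fun a j l => (c.2 a).2 l).

Definition tnerve n g : (nat -> TOb C) * (nat -> TMor C) := (trob n g, fun i => trmor n g i i.+1).

Lemma tsteps_K n k g : isG n k g -> (forall a, gm g a = false) -> grid_of n k false (tsteps (tnerve n g)) = g.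
Proof.
move=> H gT; apply: grid_of_steps => //=.
- by move=> a j l ak /andP[jl ln]; rewrite ln (T_ob H) ?gT.
- by move=> a j l ak /andP[jl ln]; rewrite ln (g_Th H (j := 0) (j' := j)) ?gT.
- move=> a j l ak /andP[jl ln]; rewrite ln (g_T H) ?gT // (T_ob H) ?gT //; exact: ltnW.
- by move=> a j l ak /andP[jl ln]; rewrite ln [RHS](T_f H).
Qed.

Lemma isSt_tsteps n k c : @isNerve (Tcat C n) k c -> isSt n k false (tsteps c).
Proof.
move=> [c1 c2 c3 c4]; split => //=.
- by move=> a j l /c1 [h _ _] /andP[_ ln]; exact: h.
- by move=> a j l _ _; rewrite vs_id vt_id.
- by move=> a j l ak _; have [[_ _ h _ _] e1 e2] := c2 a ak; rewrite -e1 -e2; exact: h.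
- by move=> a j l /c1 [h _ _] /andP[_ ln]; have [<- <-] := h l ln; exact: dsq_vid.
- move=> a j l ak /andP[_ ln]; have [[_ _ _ h _] e1 e2] := c2 a ak.
  by rewrite -e1 -e2; exact: h.
- move=> a j l ak _; have [[_ _ h _ _] e1 e2] := c2 a ak; have [h1 h2] := h l.
  by rewrite -e1 -e2 /= -h1 -h2 vcomp_idl vcomp_idr.
Qed.

Lemma tnerve_K n k c : @isNerve (Tcat C n) k c -> tnerve n (grid_of n k false (tsteps c)) = c.
Proof.
move=> cN; have S := isSt_tsteps cN; have [c1 c2 c3 c4] := cN; have G := isG_grid_of S.
have obE a : a <= k -> trob n (grid_of n k false (tsteps c)) a = c.1 a.
  move=> ak; have [h1 h2 h3] := c1 a ak; rewrite [RHS]surjective_pairing; congr pair; apply/funext => l.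
    by case: leqP => ln; [rewrite grid_of_ob|rewrite h2].
  by case: ltnP => ln; [rewrite (grid_of_h S)|rewrite h3].
rewrite [RHS]surjective_pairing; congr pair; apply/funext => i.
  have [ik|ki] := leqP i k; first exact: obE.
  by rewrite (trob_cl G) (minn_idPr (ltnW ki)) obE // c3.
have [ki|ik] := leqP k i.
  by rewrite (trmor_cl G) (minn_idPr ki) (minn_idPr (leqW ki)) (trmor_id G) obE // c4.
have [[h1 h2 h3 h4 h5] e1 e2] := c2 i ik.
rewrite /trmor !obE ?(ltnW ik) // -e1 -e2.
rewrite [RHS]surjective_pairing [in RHS](surjective_pairing (c.2 i).1); congr pair; apply/funext => l.
by case: leqP => ln; [rewrite (grid_of_f S)|rewrite h5].
Qed.

Definition gamT d (x : nmk C false d) : BEl (Tsimp C) d.1 d.2 :=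
  exist _ (tnerve d.1 (sval (sval x))) (isNerve_tr (svalP (sval x))).

Lemma T_iso : exists (f : breal (nmk C false) -> realization (Tsimp C)) g,
  [/\ continuous f, continuous g, cancel f g & cancel g f].
Proof.
apply: (realization_iso (gam := gamT)).
- move=> d x y /(congr1 sval) /= E; apply: sval_inj; apply: sval_inj.
  by rewrite -(tsteps_K (svalP (sval x)) (svalP x)) -(tsteps_K (svalP (sval y)) (svalP y)) E.
- move=> d [c cN]; pose g : gset C false d := exist _ _ (isG_grid_of (isSt_tsteps cN)).
  exists (exist (fun x : gset C false d => bmk x) g (fun a => erefl)).
  by apply: sval_inj; exact: tnerve_K.
- by move=> d d' h x; exact: (nerve_tr_act (svalP (sval x)) (svalP x) h.1 h.2).
- move=> n m t t' tt; apply/funext => D; congr pair; apply/funext => i; case: ifP => // im.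
    by rewrite tt.
  by rewrite !tt // ltnW.
- move=> n m t t' tt; apply/funext => F /=; rewrite /T_actM.
  have E D : T_actO n m t D = T_actO n m t' D :> TOb C.
    congr pair; apply/funext => i; case: ifP => // im; first by rewrite tt.
    by rewrite !tt // ltnW.
  by rewrite !E; congr pair; apply/funext => i; case: ifP => // im; rewrite tt.
Qed.

End TGrids.

Section SGrids.
Variable C : squaresCat.
Local Notation O := (sqc_O C).

Definition srob n (g : gdata C) i : SOb C :=
  (fun j l => if j <= l <= n then gob g i j l else O,
   fun j l => if j <= l < n then gh g i j l l.+1 else hid O,
   fun j l => if j < l <= n then gv g i j j.+1 l else vid O).

Definition srmor n (g : gdata C) a b : SMor C :=
  ((srob n g a, srob n g b), fun j l => if j <= l <= n then gf g a b j l else vid O).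

Lemma SOb_eq (x y : SOb C) : SA x = SA y -> Sh x = Sh y -> Sv x = Sv y -> x = y.
Proof. by case: x y => [[? ?] ?] [[? ?] ?]; rewrite /SA /Sh /Sv /= => -> -> ->. Qed.

Section Fixed.
Variables (n k : nat) (g : gdata C).
Hypothesis H : isG n k g.

Lemma srob_cl a : srob n g a = srob n g (minn a k).
Proof.
by apply: SOb_eq; apply/funext => j; apply/funext => l; rewrite /SA /Sh /Sv /=;
  [rewrite (gob_cl H)|rewrite (gh_cl H)|rewrite (gv_cl H)].
Qed.

Lemma srmor_cl a b : srmor n g a b = srmor n g (minn a k) (minn b k).
Proof.
rewrite /srmor -!srob_cl; congr pair.
by apply/funext => j; apply/funext => l; rewrite (gf_cl H).
Qed.

Lemma srmor_id a : srmor n g a a = @pc_id (Scat C n) (srob n g a).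
Proof.
congr pair; apply/funext => j; apply/funext => l; rewrite /SA /=; case: ifP => // /andP[jl _].
exact: (g_fid H).
Qed.

Lemma srmor_path a m : @cpath (Scat C n) (srob n g) (fun i => srmor n g i i.+1) a m = srmor n g a (a + m).
Proof.
elim: m => [|m IH]; first by rewrite addn0 srmor_id.
rewrite [LHS]/= IH addnS; congr pair; apply/funext => j; apply/funext => l /=.
by case: ifP => [/andP[jl _]|_]; [rewrite (g_fc H) ?leq_addr|rewrite vid_vid].
Qed.

Hypothesis gS : forall a, gm g a = true.

Lemma isSOb_srob a : isSOb n (srob n g a).
Proof.
rewrite /srob; split; rewrite /SA /Sh /Sv /=.
- by move=> j; case: ifP => // _; rewrite (g_S H) ?gS.
- move=> j l /andP[jl ln]; rewrite jl ln (ltnW ln) (leqW jl) /=.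
  by rewrite (g_hs H) ?(g_ht H).
- move=> j l /andP[jl ln]; rewrite jl ln (ltnW jl) /=.
  by rewrite (g_vs H) ?(g_vt H).
- move=> j l /andP[jl ln]; rewrite jl ln (ltnW jl) (ltnW ln) (leqW jl) /=.
  by apply: (g_sq H).
- by split => j l /negbTE ->.
Qed.

Lemma isSMor_srmor a b : a <= b -> isSMor n (srmor n g a b).
Proof.
move=> ab; rewrite /srmor /srob; split; rewrite /SA /Sh /Sv /=; [exact: isSOb_srob|exact: isSOb_srob| | |].
- by move=> j l; case: ifP => [/andP[jl _]|_]; rewrite ?vs_id ?vt_id ?(g_fs H) ?(g_ft H).
- split => j l /andP[jl ln].
    by rewrite jl ln (ltnW ln) (leqW jl) /=; apply: (g_sqf H).
  by rewrite jl ln (ltnW jl) /=; apply: (g_nat H).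
- by move=> j l /negbTE ->.
Qed.

Lemma isNerve_sr : @isNerve (Scat C n) k (srob n g, fun i => srmor n g i i.+1).
Proof.
split => i ik; [exact: isSOb_srob|by split => //; exact: isSMor_srmor| |].
- by rewrite [LHS]srob_cl (minn_idPr (ltnW ik)).
- by rewrite [LHS]srmor_cl (minn_idPr ik) (minn_idPr (leqW ik)) srmor_id.
Qed.

Variables (n' k' : nat) (t : mono n' n) (p : mono k' k).

Lemma srob_act a : srob n' (gact t p g) a = S_actO n n' t (srob n g (p a)).
Proof.
apply: SOb_eq; apply/funext => j; apply/funext => l; rewrite /SA /Sh /Sv /= /SA /Sh /Sv /=.
- case: ifP => // /andP[jl ln]; by rewrite (mf_homo t jl) mf_le.
- case: ifP => // /andP[jl ln]; have tl : t l <= t l.+1 by exact: mf_homo.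
  have tj := mf_homo t jl; have tn := mf_le t l.+1.
  rewrite -[in LHS](subnKC tl) -(gh_path H) //; apply: hpath_ext => [|i hi].
    by rewrite tj mf_le.
  by have -> : t j <= i < n by lia.
- case: ifP => // /andP[jl ln]; have tl : t j <= t j.+1 by exact: mf_homo.
  have tj := mf_homo t jl; have tn := mf_le t l.
  rewrite -[in LHS](subnKC tl) -(gv_path H); last by rewrite subnKC.
  apply: vpath_ext => [|i hi]; first by rewrite (leq_trans tl tj) mf_le.
  by have -> : i < t l <= n by lia.
Qed.

Lemma srmor_act a b : a <= b -> srmor n' (gact t p g) a b = S_actM n n' t (srmor n g (p a) (p b)).
Proof.
move=> ab; rewrite /srmor !srob_act; congr pair; apply/funext => j; apply/funext => l /=.
by case: ifP => // /andP[jl ln]; rewrite (mf_homo t jl) mf_le.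
Qed.

Lemma nerve_sr_act :
  (srob n' (gact t p g), fun i => srmor n' (gact t p g) i i.+1) =
  @chain_map (Ssimp C) n n' t (@nerve_act (Scat C n) k' p (srob n g, fun i => srmor n g i i.+1)).
Proof.
congr pair; apply/funext => i; first by rewrite srob_act /= -mf_norm.
rewrite srmor_act //= -/(srmor n g); case: ifP => ik.
  by rewrite srmor_path subnKC //; exact: mf_homo.
have ki : k' <= i by lia.
by rewrite (mf_norm p i) (mf_norm p i.+1) (minn_idPr ki) (minn_idPr (leqW ki)) srmor_id.
Qed.

End Fixed.

Definition ssteps (c : (nat -> SOb C) * (nat -> SMor C)) : sdata C :=
  SData (fun a => SA (c.1 a)) (fun a => Sh (c.1 a)) (fun a => Sv (c.1 a)) (fun a => (c.2 a).2).

Definition snerve n g : (nat -> SOb C) * (nat -> SMor C) := (srob n g, fun i => srmor n g i i.+1).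

Lemma ssteps_K n k g : isG n k g -> (forall a, gm g a = true) -> grid_of n k true (ssteps (snerve n g)) = g.
Proof.
move=> H gS; apply: grid_of_steps => //=; rewrite /SA /Sh /Sv /=.
- by move=> a j l ak ->.
- by move=> a j l ak ->.
- by move=> a j l ak ->.
- by move=> a j l ak ->.
Qed.

Lemma isSt_ssteps n k c : @isNerve (Scat C n) k c -> isSt n k true (ssteps c).
Proof.
move=> [c1 c2 c3 c4]; split => //=.
- by move=> a j l /c1 [_ h _ _ _]; exact: h.
- by move=> a j l /c1 [_ _ h _ _]; exact: h.
- by move=> a j l ak _; have [[_ _ h _ _] e1 e2] := c2 a ak; rewrite -e1 -e2; exact: h.
- by move=> a j l /c1 [_ _ _ h _]; exact: h.
- by move=> a j l ak jl; have [[_ _ _ [h _] _] e1 e2] := c2 a ak; rewrite -e1 -e2; exact: h.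
- by move=> a j l ak jl; have [[_ _ _ [_ h] _] e1 e2] := c2 a ak; rewrite -e1 -e2; exact: h.
- by move=> a j _ /c1 [h _ _ _ _] _; exact: h.
Qed.

Lemma snerve_K n k c : @isNerve (Scat C n) k c -> snerve n (grid_of n k true (ssteps c)) = c.
Proof.
move=> cN; have S := isSt_ssteps cN; have [c1 c2 c3 c4] := cN; have G := isG_grid_of S.
have obE a : a <= k -> srob n (grid_of n k true (ssteps c)) a = c.1 a.
  move=> ak; have [_ _ _ _ [h1 h2 h3]] := c1 a ak.
  apply: SOb_eq; apply/funext => j; apply/funext => l.
  - rewrite -[LHS]/(if j <= l <= n then gob (grid_of n k true (ssteps c)) a j l else O).
    by case: ifPn => jl; [rewrite grid_of_ob|rewrite h1].
  - rewrite -[LHS]/(if j <= l < n then gh (grid_of n k true (ssteps c)) a j l l.+1 else hid O).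
    by case: ifPn => jl; [rewrite (grid_of_h S)|rewrite h2].
  - rewrite -[LHS]/(if j < l <= n then gv (grid_of n k true (ssteps c)) a j j.+1 l else vid O).
    by case: ifPn => jl; [rewrite (grid_of_v S)|rewrite h3].
rewrite [RHS]surjective_pairing; congr pair; apply/funext => i.
  have [ik|ki] := leqP i k; first exact: obE.
  by rewrite (srob_cl G) (minn_idPr (ltnW ki)) obE // c3.
have [ki|ik] := leqP k i.
  by rewrite (srmor_cl G) (minn_idPr ki) (minn_idPr (leqW ki)) (srmor_id G) obE // c4.
have [[h1 h2 h3 h4 h5] e1 e2] := c2 i ik.
rewrite /srmor !obE ?(ltnW ik) // -e1 -e2.
rewrite [RHS]surjective_pairing [in RHS](surjective_pairing (c.2 i).1); congr pair.
apply/funext => j; apply/funext => l.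
by case: ifPn => jl; [rewrite (grid_of_f S)|rewrite h5].
Qed.

Definition gamS d (x : nmk C true d) : BEl (Ssimp C) d.1 d.2 :=
  exist _ (snerve d.1 (sval (sval x))) (isNerve_sr (svalP (sval x)) (svalP x)).

Lemma S_iso : exists (f : breal (nmk C true) -> realization (Ssimp C)) g,
  [/\ continuous f, continuous g, cancel f g & cancel g f].
Proof.
have OE n m t t' (D : SOb C) : (forall i, i <= m -> t i = t' i) -> S_actO n m t D = S_actO n m t' D.
  move=> tt; apply: SOb_eq; apply/funext => j; apply/funext => l; rewrite /SA /Sh /Sv /=.
  - by case: ifP => // /andP[jl lm]; rewrite !tt // (leq_trans jl).
  - by case: ifP => // /andP[jl lm]; rewrite !tt //; lia.
  - by case: ifP => // /andP[jl lm]; rewrite !tt //; lia.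
apply: (realization_iso (gam := gamS)).
- move=> d x y /(congr1 sval) /= E; apply: sval_inj; apply: sval_inj.
  by rewrite -(ssteps_K (svalP (sval x)) (svalP x)) -(ssteps_K (svalP (sval y)) (svalP y)) E.
- move=> d [c cN]; pose g : gset C true d := exist _ _ (isG_grid_of (isSt_ssteps cN)).
  exists (exist (fun x : gset C true d => bmk x) g (fun a => erefl)).
  by apply: sval_inj; exact: snerve_K.
- by move=> d d' h x; exact: (nerve_sr_act (svalP (sval x)) h.1 h.2).
- by move=> n m t t' tt; apply/funext => D; exact: OE.
- move=> n m t t' tt; apply/funext => F /=; rewrite /S_actM !(OE _ _ _ _ _ tt); congr pair.
  by apply/funext => j; apply/funext => l; case: ifP => // /andP[jl lm]; rewrite !tt // (leq_trans jl).
Qed.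

End SGrids.

(** * Assembly of the equivalence *)

Section HomotopyConcat.
Local Open Scope ring_scope.

(** Both homotopies are run backwards, first [H] and then [K], at double speed. *)
Lemma homotopicR2 (A B : topologicalType) (f g : A -> B) (H K : A * R -> B) :
  continuous H -> continuous K -> (forall a, H (a, 1) = f a) -> (forall a, H (a, 0) = K (a, 1)) ->
  (forall a, K (a, 0) = g a) -> homotopic f g.
Proof.
move=> cH cK H1 HK K0.
have l2 (c : R) : continuous (fun u : A * R => (u.1, c - 2 * u.2)).
  apply: continuous_pair; first exact: continuous_fst.
  apply: cB; first exact: ccst.
  by apply: cM; [exact: ccst|exact: continuous_snd].
apply: (@homotopicR _ _ _ _ (fun u => if u.2 <= 1 / 2 then H (u.1, 1 - 2 * u.2) else K (u.1, 2 - 2 * u.2))).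
- apply: (@continuous_cover2 _ _ [set u : A * R | u.2 <= 1 / 2] [set u : A * R | 1 / 2 <= u.2]
    (fun u => H (u.1, 1 - 2 * u.2)) (fun u => K (u.1, 2 - 2 * u.2))).
  + by apply: closed_lef; [exact: continuous_snd|exact: ccst].
  + by apply: closed_lef; [exact: ccst|exact: continuous_snd].
  + by move=> [a t] /=; have [h|h] := leP t (1 / 2); [left|right; apply: ltW].
  + by move=> [a t] /= ->.
  + move=> [a t] /= h1; case: ifP => // h2.
    have -> : t = 1 / 2 by apply/eqP; rewrite eq_le h2.
    have -> : 1 - 2 * (1 / 2) = 0 :> R by lra.
    have -> : 2 - 2 * (1 / 2) = 1 :> R by lra.
    exact: HK.
  + exact: (continuous_compf cH (l2 1)).
  + exact: (continuous_compf cK (l2 2)).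
- move=> a /=; have -> : (0 : R) <= 1 / 2 by lra.
  by rewrite mulr0 subr0.
- move=> a /=; have -> : ((1 : R) <= 1 / 2) = false by lra.
  by rewrite mulr1 subrr.
Qed.

End HomotopyConcat.

Theorem theorem2p53 (C : squaresCat) (W : protoWaldhausen C) :
  homotopy_equivalent (realization (Tsimp C)) (realization (Ssimp C)).
Proof.
have [fT [gT [cfT cgT fgT gfT]]] := T_iso C; have [fS [gS [cfS cgS fgS gfS]]] := S_iso C.
have [eT [HT [KT [ceT cHT cKT [HT0 HT1] [KT0 KT1]]]]] := nmk_gset_equiv W false.
have [eS [HS [KS [ceS cHS cKS [HS0 HS1] [KS0 KS1]]]]] := nmk_gset_equiv W true.
have cnT : continuous (@nincl C false) by exact: bmapr_continuous.
have cnS : continuous (@nincl C true) by exact: bmapr_continuous.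
(* [gset C true] and [gset C false] differ only in their marks, so their realizations coincide. *)
pose nT : breal (nmk C false) -> breal (gset C true) := @nincl C false.
pose nS : breal (nmk C true) -> breal (gset C false) := @nincl C true.
exists (fun x => fS (eS (nT (gT x)))), (fun y => fT (eT (nS (gS y)))); split.
- apply: (continuous_compf cfS); apply: (continuous_compf ceS); exact: (continuous_compf cnT cgT).
- apply: (continuous_compf cfT); apply: (continuous_compf ceT); exact: (continuous_compf cnS cgS).
(* The round trip contains [nS] after [eS], which is the end of [HS]. Undoing it leaves [eT] after
   [nT], the end of [KT]. *)
- apply: (@homotopicR2 _ _ _ _ (fun u => fT (eT (HS (nT (gT u.1), u.2)))) (fun u => fT (KT (gT u.1, u.2)))).
  + apply: (continuous_compf cfT); apply: (continuous_compf ceT); apply: (continuous_compf cHS).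
    apply: continuous_pair; last exact: continuous_snd.
    by apply: (continuous_compf cnT); apply: (continuous_compf cgT); exact: continuous_fst.
  + apply: (continuous_compf cfT); apply: (continuous_compf cKT).
    apply: continuous_pair; last exact: continuous_snd.
    by apply: (continuous_compf cgT); exact: continuous_fst.
  + by move=> a /=; rewrite HS1 fgS.
  + by move=> a /=; rewrite HS0 KT1.
  + by move=> a /=; rewrite KT0 gfT.
- apply: (@homotopicR2 _ _ _ _ (fun u => fS (eS (HT (nS (gS u.1), u.2)))) (fun u => fS (KS (gS u.1, u.2)))).
  + apply: (continuous_compf cfS); apply: (continuous_compf ceS); apply: (continuous_compf cHT).
    apply: continuous_pair; last exact: continuous_snd.
    by apply: (continuous_compf cnS); apply: (continuous_compf cgS); exact: continuous_fst.
  + apply: (continuous_compf cfS); apply: (continuous_compf cKS).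
    apply: continuous_pair; last exact: continuous_snd.
    by apply: (continuous_compf cgS); exact: continuous_fst.
  + by move=> a /=; rewrite HT1 fgT.
  + by move=> a /=; rewrite HT0 KS1.
  + by move=> a /=; rewrite KS0 gfS.
Qed.
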